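(* Let $\nu\in[2,2.1]$ and let $$f(t,x)=1.6\cos(2x)-2\sin(3x)+\sum_{k=1}^{3}\bigl(\beta_k(t)\sin(kx)+\gamma_k(t)\cos(kx)\bigr),$$ where $\beta_k,\gamma_k:\mathbb{R}\to[-0.03,0.03]$ ($k=1,2,3$) are continuous functions. Then there exists a classical solution $v$ of $$u_t+u\,u_x-\nu u_{xx}=f(t,x),\qquad u(t,x)=u(t,x+2\pi),$$ defined for all $t\in\mathbb{R}$, which attracts, with exponential rate of convergence, every initial datum $u_0$ ($2\pi$-periodic in $x$) satisfying $u_0\in C^4$ and $\int_0^{2\pi}u_0(x)\,dx=\pi$. Moreover, if $f$ is periodic in time, then $v$ is periodic in time.
   Context: The equation is the viscous Burgers equation on the interval with periodic boundary conditions (period $2\pi$ in $x\in\mathbb{R}$), with initial condition $u(t_0,x)=u_0(x)$, where $t_0\in\mathbb{R}$ is arbitrary. A classical solution is a function possessing the derivatives appearing in the equation and satisfying it pointwise. ''$v$ attracts $u_0$ with exponential rate of convergence'' means: there is a rate $\lambda>0$ (independent of $u_0$ and $t_0$) such that for every $t_0\in\mathbb{R}$ the classical solution $u$ of the equation with $u(t_0,\cdot)=u_0$ exists for all $t\ge t_0$, and there is a constant $C$ with $\sup_{k\in\mathbb{Z}}|\hat u_k(t)-\hat v_k(t)|\le Ce^{-\lambda(t-t_0)}$ for all $t\ge t_0$, where $\hat w_k(t)=\frac1{2\pi}\int_0^{2\pi}w(t,x)e^{-ikx}\,dx$ denotes the $k$-th Fourier coefficient. *)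

(* Defs.v *)
From Stdlib Require Import Reals ZArith.
From Coquelicot Require Import Coquelicot.

Open Scope R_scope.

(* A time domain is a predicate [I : R -> Prop]: all of R, or [t0, +oo[.
   The time derivative is taken relative to [I], so at the endpoint t0 of
   [t0, +oo[ it is the one-sided derivative, and values of u at times outside
   [I] are irrelevant. *)
Definition partial_derivatives (I : R -> Prop) (u ut ux uxx : R -> R -> R) : Prop :=
  forall t x : R, I t ->
    filterdiff (fun s => u s x) (within I (locally t)) (fun h => scal h (ut t x)) /\
    is_derive (u t) x (ux t x) /\
    is_derive (ux t) x (uxx t x).

Definition classical_solution (I : R -> Prop) (nu : R) (f u : R -> R -> R) : Prop :=
  exists ut ux uxx : R -> R -> R,
    partial_derivatives I u ut ux uxx /\
    (forall t x, I t -> ut t x + u t x * ux t x - nu * uxx t x = f t x) /\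
    (forall t x, I t -> u t x = u t (x + 2 * PI)).

Definition jointly_continuous (I : R -> Prop) (g : R -> R -> R) : Prop :=
  forall t x : R, I t ->
    filterlim (fun p : R * R => g (fst p) (snd p))
      (within (fun p : R * R => I (fst p)) (locally (t, x))) (locally (g t x)).

Definition C12 (I : R -> Prop) (u : R -> R -> R) : Prop :=
  exists ut ux uxx : R -> R -> R,
    partial_derivatives I u ut ux uxx /\
    jointly_continuous I u /\ jointly_continuous I ut /\
    jointly_continuous I ux /\ jointly_continuous I uxx.

(* "The" classical solution with initial datum u0 at time t0. Pointwise
   existence of the partial derivatives alone does not single out a solution: for
   the heat equation, the x-derivative of the periodic heat kernel, extended by 0
   at t = t0, satisfies the equation pointwise on [t0, +oo[ with zero initial
   datum. Hence uniqueness is asserted among the solutions whose derivatives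
   are jointly continuous, and u is required to be one of them. *)
Definition the_classical_solution (nu : R) (f : R -> R -> R) (t0 : R) (u0 : R -> R)
    (u : R -> R -> R) : Prop :=
  let solves (w : R -> R -> R) :=
    classical_solution (fun t => t0 <= t) nu f w /\ C12 (fun t => t0 <= t) w /\
    (forall x, w t0 x = u0 x) in
  solves u /\
  (forall w, solves w -> forall t x, t0 <= t -> w t x = u t x).

Definition cis (a : R) : C := (cos a, sin a).

Definition fourier_coeff (w : R -> R -> R) (k : Z) (t : R) : C :=
  (RtoC (/ (2 * PI)) *
   @RInt C_R_CompleteNormedModule
     (fun x => RtoC (w t x) * cis (- (IZR k * x))) 0 (2 * PI))%C.

Definition attracts_exponentially (nu : R) (f v : R -> R -> R)
    (data : (R -> R) -> Prop) : Prop :=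
  exists lambda : R, 0 < lambda /\
    forall u0 : R -> R, data u0 ->
    forall t0 : R,
    exists u : R -> R -> R,
      the_classical_solution nu f t0 u0 u /\
      exists K : R, forall t : R, t0 <= t ->
        forall k : Z,
          Cmod (fourier_coeff u k t - fourier_coeff v k t)
            <= K * exp (- lambda * (t - t0)).

Definition class_C (n : nat) (g : R -> R) : Prop :=
  (forall k x, (k <= n)%nat -> ex_derive_n g k x) /\
  (forall x, continuous (Derive_n g n) x).

Definition admissible_datum (u0 : R -> R) : Prop :=
  (forall x, u0 (x + 2 * PI) = u0 x) /\
  class_C 4 u0 /\
  RInt u0 0 (2 * PI) = PI.

Definition forcing (beta gamma : nat -> R -> R) (t x : R) : R :=
  1.6 * cos (2 * x) - 2 * sin (3 * x)
  + sum_n_m (fun k => beta k t * sin (INR k * x) + gamma k t * cos (INR k * x)) 1 3.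

Definition time_periodic (g : R -> R -> R) : Prop :=
  exists T : R, 0 < T /\ forall t x, g (t + T) x = g t x.

(* Main.v *)
(* With F_x = f and c = 1/2 the conserved mean, the Cole-Hopf substitution
   u = c - 2 nu phi_x / phi turns the equation into the linear one
     phi_t + c phi_x = nu phi_xx + V phi,   V = - F / (2 nu).
   V is a trigonometric polynomial, so in the frame x - c t this is a system for the Fourier
   coefficients of phi with a bounded finite-range coupling; Picard iteration preserves decay
   (1 + |k|)^-5, which is what a datum u0 in C^4 provides, and the minimum principle keeps phi > 0.
   Hence classical solutions are global.

   For two solutions u, v of mean c and w = u - v, the functional
     ||w||^2 exp (PI / (32 nu) (||u - c||^2 + ||v - c||^2))
   decays at the rate 2 (nu - 1) / PI^2 - PI ||F||^2 / (16 nu^2), which is positive for the given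
   forcing: attraction is a pure L2 energy estimate, and it also yields uniqueness.

   The attracting solution is the pullback limit of the solutions started from the constant c at
   time - n. L2 convergence makes log phi (normalised at a point) converge uniformly, and the
   smoothing of the linear equation upgrades this to convergence of the coefficients of phi with
   weight (1 + |k|)^6, so that the limit is again a classical solution. *)

Require Import Defs.
From Stdlib Require Import Reals ZArith.
From Coquelicot Require Import Coquelicot.
From Stdlib Require Import Lra Lia ClassicalEpsilon FunctionalExtensionality List.

Open Scope R_scope.

(** The regularity budget is exact. Sums over [Z] converge under decay [(1 + |k|)^-2], and [u_xx]
    contains [phi_xxx], so [phi] needs decay of order five; it has one derivative more than the
    datum, and [C^4] provides just that. The coefficients are real, taken in the basis
    [cos (k x) + sin (k x)], which keeps everything within real series. Functions on a half line
    [[t0, +oo[] are frozen before [t0], through [Rmax t t0]: they become continuous on the whole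
    plane and the estimates carry no time domain; the one-sided derivatives at [t0] are recovered
    only at the end.

    The numerical bottleneck is the sign of the rate. The difference [w] of two solutions dissipates
    [2 nu] times the integral of [w_x^2]; the transport terms of [u] and [v] each consume one unit
    of it, which leaves [2 (nu - 1)], divided by the Poincare constant [PI^2]. The energy of the
    data enters only the prefactor, never the rate, and this makes the rate uniform in [u0]. With
    [nu >= 2], [PI < 3.24] and an integral of [F^2] of at most [1.125 PI], the margin is about
    [0.006]. *)

(** * Dominated series: termwise limits and derivatives *)

Lemma Series_tail_lt (b : nat -> R) (eps : R) :
  ex_series b -> 0 < eps ->
  exists N, Rabs (Series (fun k => b (S N + k)%nat)) < eps.
Proof.
  intros Hb He.
  assert (H := Series_correct _ Hb).
  apply is_series_Reals in H.
  destruct (H eps He) as [N HN].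
  exists N.
  specialize (HN N (le_n _)).
  rewrite (Series_incr_n b (S N)) in HN; [|lia|exact Hb].
  unfold Rdist in HN. simpl pred in HN.
  rewrite Rabs_minus_sym in HN.
  replace (sum_f_R0 b N + Series (fun k => b (S N + k)%nat) - sum_f_R0 b N)
    with (Series (fun k => b (S N + k)%nat)) in HN by ring.
  exact HN.
Qed.

Lemma ex_series_dom (a b : nat -> R) :
  ex_series b -> (forall n, Rabs (a n) <= b n) -> ex_series a.
Proof. intros Hb H. apply (@ex_series_le _ R_CompleteNormedModule) with (2 := Hb). exact H. Qed.

Lemma Series_dom (a b : nat -> R) :
  ex_series b -> (forall n, Rabs (a n) <= b n) -> Rabs (Series a) <= Series b.
Proof.
  intros Hb H.
  eapply Rle_trans.
  - apply Series_Rabs. apply ex_series_dom with b; [exact Hb|].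
    intro n. rewrite Rabs_Rabsolu. apply H.
  - apply Series_le; [|exact Hb]. intro n. split; [apply Rabs_pos|apply H].
Qed.

Lemma filterlim_sum_f_R0 {T : Type} (F : (T -> Prop) -> Prop) {FF : Filter F}
  (f : nat -> T -> R) (l : nat -> R) (N : nat) :
  (forall n, filterlim (f n) F (locally (l n))) ->
  filterlim (fun x => sum_f_R0 (fun n => f n x) N) F (locally (sum_f_R0 l N)).
Proof.
  intro H. induction N as [|N IH]; simpl.
  - apply H.
  - eapply filterlim_comp_2; [exact IH|apply H|].
    apply (filterlim_plus (V := R_NormedModule)).
Qed.

(** Tannery's theorem. *)
Lemma filterlim_Series {T : Type} (F : (T -> Prop) -> Prop) {FF : Filter F}
  (f : nat -> T -> R) (l b : nat -> R) :
  ex_series b ->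
  (forall n, filterlim (f n) F (locally (l n))) ->
  F (fun x => forall n, Rabs (f n x) <= b n) ->
  (forall n, Rabs (l n) <= b n) ->
  filterlim (fun x => Series (fun n => f n x)) F (locally (Series l)).
Proof.
  intros Hb Hf HF Hl.
  apply filterlim_locally. intros [eps He].
  destruct (Series_tail_lt b (eps / 3) Hb) as [N HN]; [lra|].
  assert (Hb' : ex_series (fun k => b (S N + k)%nat)) by (apply ex_series_incr_n; exact Hb).
  (* The head is a finite sum; the tails of the terms and of the limits are each below [eps / 3],
     being dominated by the tail of [b]. *)
  assert (H1 := filterlim_sum_f_R0 F f l N Hf).
  assert (H2 := proj1 (filterlim_locally _ _) H1 (mkposreal (eps/3) ltac:(lra))).
  generalize (filter_and _ _ HF H2). apply filter_imp.
  intros x [Hx1 Hx2].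
  change (Rabs (Series (fun n => f n x) - Series l) < eps).
  change (Rabs (sum_f_R0 (fun n => f n x) N - sum_f_R0 l N) < eps / 3) in Hx2.
  rewrite (Series_incr_n (fun n => f n x) (S N)); [|lia|apply ex_series_dom with b; auto].
  rewrite (Series_incr_n l (S N)); [|lia|apply ex_series_dom with b; auto].
  simpl pred.
  assert (A1 := Series_dom (fun k => f (S N + k)%nat x) _ Hb' (fun k => Hx1 (S N + k)%nat)).
  assert (A2 := Series_dom (fun k => l (S N + k)%nat) _ Hb' (fun k => Hl (S N + k)%nat)).
  apply Rabs_def2 in HN. apply Rabs_def2 in Hx2.
  apply Rabs_le_between in A1. apply Rabs_le_between in A2.
  apply Rabs_def1; lra.
Qed.

Lemma is_derive_quot (f : R -> R) (x l : R) :
  is_derive f x l <->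
  filterlim (fun y => (f y - f x) / (y - x)) (locally' x) (locally l).
Proof.
  split; intro H.
  - apply is_derive_Reals in H.
    apply filterlim_locally. intros [eps He].
    destruct (H eps He) as [d Hd].
    exists d. intros y Hy Hne.
    change (Rabs ((f y - f x) / (y - x) - l) < eps).
    specialize (Hd (y - x)). rewrite Rplus_minus in Hd.
    apply Hd; [intro; apply Hne; lra|exact Hy].
  - apply is_derive_Reals. intros eps He.
    destruct (proj1 (filterlim_locally _ _) H (mkposreal eps He)) as [d Hd].
    exists d. intros h Hh Hlt.
    specialize (Hd (x + h)).
    assert (B : ball x d (x + h)).
    { change (Rabs (x + h - x) < d). rewrite Rplus_minus_l. exact Hlt. }
    assert (Hne : x + h <> x) by lra.
    specialize (Hd B Hne).
    change (Rabs ((f (x + h) - f x) / (x + h - x) - l) < eps) in Hd.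
    rewrite Rplus_minus_l in Hd. exact Hd.
Qed.

Lemma bounded_derive_Lipschitz (f df : R -> R) (a b M x y : R) :
  (forall t, a < t < b -> is_derive f t (df t)) ->
  (forall t, a < t < b -> Rabs (df t) <= M) ->
  a < x < b -> a < y < b -> Rabs (f y - f x) <= M * Rabs (y - x).
Proof.
  intros H1 H2 Hx Hy.
  assert (Hin : forall t, Rmin x y <= t <= Rmax x y -> a < t < b).
  { intros t. unfold Rmin, Rmax. destruct (Rle_dec x y); lra. }
  destruct (MVT_gen f x y df) as [c [Hc Hcf]].
  - intros t Ht. apply H1, Hin. lra.
  - intros t Ht. apply continuity_pt_filterlim.
    apply (ex_derive_continuous (V := R_NormedModule)). exists (df t). apply H1, Hin, Ht.
  - rewrite Hcf, Rabs_mult. apply Rmult_le_compat_r; [apply Rabs_pos|].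
    apply H2, Hin, Hc.
Qed.

(* Tannery's theorem applied to the difference quotients: no uniform
   convergence of the differentiated series is needed. *)
Lemma is_derive_Series (f df : nat -> R -> R) (b b' : nat -> R) (lo hi x : R) :
  lo < x < hi -> ex_series b -> ex_series b' ->
  (forall n t, lo < t < hi -> is_derive (f n) t (df n t)) ->
  (forall n t, lo < t < hi -> Rabs (f n t) <= b n) ->
  (forall n t, lo < t < hi -> Rabs (df n t) <= b' n) ->
  is_derive (fun t => Series (fun n => f n t)) x (Series (fun n => df n x)).
Proof.
  intros Hx Hb Hb' Hd Hf Hdf.
  apply is_derive_quot.
  assert (Hloc : locally x (fun y => lo < y < hi)).
  { exists (mkposreal (Rmin (x - lo) (hi - x)) ltac:(apply Rmin_pos; lra)).
    intros y Hy. change (Rabs (y - x) < Rmin (x - lo) (hi - x)) in Hy.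
    assert (A := Rmin_l (x - lo) (hi - x)). assert (A' := Rmin_r (x - lo) (hi - x)).
    apply Rabs_def2 in Hy. lra. }
  apply filterlim_ext_loc with (fun y => Series (fun n => (f n y - f n x) / (y - x))).
  - apply filter_le_within. revert Hloc. apply filter_imp. intros y Hy.
    unfold Rdiv at 2. rewrite <- Series_minus.
    + rewrite <- Series_scal_r. reflexivity.
    + apply ex_series_dom with b; auto.
    + apply ex_series_dom with b; auto.
  - apply filterlim_Series with (b := b'); [apply _|exact Hb'| | |].
    + intro n. apply is_derive_quot. apply Hd, Hx.
    + unfold locally', within. revert Hloc. apply filter_imp. intros y Hy Hne n.
      unfold Rdiv. rewrite Rabs_mult, Rabs_inv.
      assert (0 < Rabs (y - x)) by (apply Rabs_pos_lt; lra).
      apply Rmult_le_reg_r with (Rabs (y - x)); [assumption|].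
      rewrite Rmult_assoc, Rinv_l, Rmult_1_r by lra.
      (* The mean value inequality turns the bound on [df n] into a domination of the difference
         quotients. *)
      apply bounded_derive_Lipschitz with (df n) lo hi; auto.
    + intro n. auto.
Qed.

(** * Differentiation rules for real functions *)

Lemma is_derive_eq (f : R -> R) (x l l' : R) : is_derive f x l -> l = l' -> is_derive f x l'.
Proof. intros H <-. exact H. Qed.

Lemma is_derive_Rmult (f g : R -> R) (x df dg : R) :
  is_derive f x df -> is_derive g x dg -> is_derive (fun t => f t * g t) x (df * g x + f x * dg).
Proof. intros Hf Hg. apply (is_derive_mult f g x df dg Hf Hg). intros; apply Rmult_comm. Qed.

Lemma is_derive_Rcomp (f g : R -> R) (x df dg : R) :
  is_derive g x dg -> is_derive f (g x) df -> is_derive (fun t => f (g t)) x (dg * df).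
Proof. intros Hg Hf. apply (is_derive_comp f g x df dg Hf Hg). Qed.

Lemma is_derive_Rexp (x : R) : is_derive exp x (exp x).
Proof. auto_derive; [trivial|ring]. Qed.

Lemma is_derive_exp_lin (a t0 s : R) : is_derive (fun s => exp (a * (s - t0))) s (a * exp (a * (s - t0))).
Proof.
  apply (is_derive_Rcomp exp (fun s => a * (s - t0))); [|apply is_derive_Rexp].
  auto_derive; [trivial|ring].
Qed.

(* [RInt] and friends often leave equations typed in the carrier of a normed module. *)
Ltac Rring := match goal with |- @eq _ ?a ?b => change (@eq R a b) end; ring.
Ltac Rfield := match goal with |- @eq _ ?a ?b => change (@eq R a b) end; field.

Lemma is_derive_Rconst (c x : R) : is_derive (fun _ : R => c) x 0.
Proof. apply (is_derive_const (V := R_NormedModule)). Qed.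

Lemma is_derive_Rplus (f g : R -> R) (x df dg : R) :
  is_derive f x df -> is_derive g x dg -> is_derive (fun t => f t + g t) x (df + dg).
Proof. intros Hf Hg. apply (is_derive_plus (V := R_NormedModule) f g x df dg Hf Hg). Qed.

Lemma is_derive_Rminus (f g : R -> R) (x df dg : R) :
  is_derive f x df -> is_derive g x dg -> is_derive (fun t => f t - g t) x (df - dg).
Proof. intros Hf Hg. apply (is_derive_minus (V := R_NormedModule) f g x df dg Hf Hg). Qed.

Lemma is_derive_Rscal (c : R) (f : R -> R) (x df : R) :
  is_derive f x df -> is_derive (fun t => c * f t) x (c * df).
Proof. intros Hf. apply (is_derive_scal f x c df Hf). Qed.

Lemma exp_le (x y : R) : x <= y -> exp x <= exp y.
Proof. intros [H | ->]; [left; apply exp_increasing, H|right; reflexivity]. Qed.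

(** * Weighted decay of sequences indexed by [Z] *)

Definition wt (k : Z) : R := 1 + Rabs (IZR k).

Lemma wt_ge_1 k : 1 <= wt k.
Proof. unfold wt. assert (H := Rabs_pos (IZR k)). lra. Qed.

Lemma wt_opp k : wt (- k) = wt k.
Proof. unfold wt. rewrite opp_IZR, Rabs_Ropp. reflexivity. Qed.

Lemma wt_pow_pos k r : 0 < wt k ^ r.
Proof. apply pow_lt. assert (H := wt_ge_1 k). lra. Qed.

Lemma wt_0 : wt 0 = 1.
Proof. unfold wt. rewrite Rabs_R0. ring. Qed.

(** The ball of radius [A] in the sup norm with weight [(1 + |k|)^r]. The explicit radius makes
    bounds uniform in time easy to state. *)
Definition dom (r : nat) (A : R) (y : Z -> R) : Prop :=
  forall k, Rabs (y k) * wt k ^ r <= A.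

Lemma dom_abs r A y k : dom r A y -> Rabs (y k) <= A.
Proof.
  intro H. eapply Rle_trans; [|apply (H k)].
  rewrite <- (Rmult_1_r (Rabs (y k))) at 1.
  apply Rmult_le_compat_l; [apply Rabs_pos|].
  apply pow_R1_Rle, wt_ge_1.
Qed.

Lemma dom_0_iff A y : dom 0 A y <-> forall k, Rabs (y k) <= A.
Proof. unfold dom. simpl. split; intros H k; specialize (H k); lra. Qed.

Lemma dom_nonneg r A y : dom r A y -> 0 <= A.
Proof. intro H. eapply Rle_trans; [apply Rabs_pos|apply (dom_abs r A y 0%Z H)]. Qed.

Lemma dom_weaken r r' A A' y : (r' <= r)%nat -> A <= A' -> dom r A y -> dom r' A' y.
Proof.
  intros Hr HA H k. eapply Rle_trans; [|exact HA]. eapply Rle_trans; [|apply (H k)].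
  apply Rmult_le_compat_l; [apply Rabs_pos|]. apply Rle_pow; [apply wt_ge_1|exact Hr].
Qed.

Lemma dom_plus r A B y z : dom r A y -> dom r B z -> dom r (A + B) (fun k => y k + z k).
Proof.
  intros H1 H2 k. specialize (H1 k). specialize (H2 k).
  eapply Rle_trans; [|apply Rplus_le_compat; [exact H1|exact H2]].
  rewrite <- Rmult_plus_distr_r. apply Rmult_le_compat_r; [left; apply wt_pow_pos|apply Rabs_triang].
Qed.

Lemma dom_mult_bounded r A C y z : (forall k, Rabs (z k) <= C) ->
  dom r A y -> dom r (A * C) (fun k => y k * z k).
Proof.
  intros H1 H2 k. specialize (H1 k). specialize (H2 k). rewrite Rabs_mult.
  replace (Rabs (y k) * Rabs (z k) * wt k ^ r) with (Rabs (y k) * wt k ^ r * Rabs (z k)) by ring.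
  apply Rmult_le_compat; [|apply Rabs_pos|exact H2|exact H1].
  apply Rmult_le_pos; [apply Rabs_pos|left; apply wt_pow_pos].
Qed.

Lemma dom_scal r A c y : dom r A y -> dom r (A * Rabs c) (fun k => c * y k).
Proof.
  intros H k. rewrite (Rmult_comm c). revert k. apply (dom_mult_bounded r A (Rabs c) y (fun _ => c)); [|exact H].
  intros _. apply Rle_refl.
Qed.

Lemma dom_minus r A B y z : dom r A y -> dom r B z -> dom r (A + B) (fun k => y k - z k).
Proof.
  intros H1 H2. apply (dom_plus r A B y (fun k => - z k)); [exact H1|].
  intro k. rewrite Rabs_Ropp. apply H2.
Qed.

Lemma dom_div r A y k : dom r A y -> Rabs (y k) <= A / wt k ^ r.
Proof.
  intro H. apply Rmult_le_reg_r with (wt k ^ r); [apply wt_pow_pos|].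
  unfold Rdiv. rewrite Rmult_assoc, Rinv_l, Rmult_1_r; [apply H|].
  apply Rgt_not_eq, wt_pow_pos.
Qed.

(** * Sums over [Z] *)

(** The negative indices are enumerated as [- n - 1], so that [0] is counted once. *)
Definition zsum (a : Z -> R) : R :=
  Series (fun n => a (Z.of_nat n)) + Series (fun n => a (- Z.of_nat n - 1)%Z).

Definition invsq (n : nat) : R := / (INR n + 1) ^ 2.

(** Comparison with twice the telescoping series of [1 / (n + 1) - 1 / (n + 2)]. *)
Lemma ex_series_invsq : ex_series invsq.
Proof.
  assert (Hp : forall n, 0 < INR n + 1) by (intro n; assert (A := pos_INR n); lra).
  apply ex_series_dom with (fun n => 2 * (/ (INR n + 1) - / (INR n + 2))).
  - apply (ex_series_scal_l (V := R_NormedModule)).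
    exists 1. apply is_series_Reals. intros eps He.
    destruct (archimed_cor1 eps He) as [N [HN HN']].
    exists N. intros n Hn.
    assert (Hs : sum_f_R0 (fun n => / (INR n + 1) - / (INR n + 2)) n = 1 - / (INR n + 2)).
    { clear. induction n as [|n IH].
      - simpl. field.
      - rewrite tech5, IH, S_INR. assert (A := pos_INR n). field. lra. }
    rewrite Hs. unfold Rdist.
    replace (1 - / (INR n + 2) - 1) with (- / (INR n + 2)) by ring.
    rewrite Rabs_Ropp, Rabs_inv, Rabs_pos_eq; [|specialize (Hp n); lra].
    eapply Rle_lt_trans; [|exact HN].
    apply Rinv_le_contravar; [apply lt_0_INR; lia|].
    apply le_INR in Hn. lra.
  - intro n. specialize (Hp n). unfold invsq.
    rewrite Rabs_pos_eq; [|left; apply Rinv_0_lt_compat, pow_lt, Hp].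
    apply Rmult_le_reg_r with ((INR n + 1) ^ 2 * (INR n + 2)).
    + apply Rmult_lt_0_compat; [apply pow_lt; lra|lra].
    + replace (/ (INR n + 1) ^ 2 * ((INR n + 1) ^ 2 * (INR n + 2))) with (INR n + 2) by (field; lra).
      replace (2 * (/ (INR n + 1) - / (INR n + 2)) * ((INR n + 1) ^ 2 * (INR n + 2)))
        with (2 * (INR n + 1)) by (field; lra).
      assert (A := pos_INR n). lra.
Qed.

Definition zconst : R := Series invsq + Series invsq.

Lemma invsq_pos n : 0 <= invsq n.
Proof. unfold invsq. left. apply Rinv_0_lt_compat, pow_lt. assert (A := pos_INR n). lra. Qed.

Lemma dom2_pos A y n : dom 2 A y -> Rabs (y (Z.of_nat n)) <= A * invsq n.
Proof.
  intro H. assert (K := dom_div 2 A y (Z.of_nat n) H).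
  unfold invsq. unfold wt in K. rewrite <- INR_IZR_INZ in K.
  rewrite (Rabs_pos_eq (INR n)) in K by apply pos_INR.
  rewrite (Rplus_comm (INR n)). exact K.
Qed.

(** The weight at [- n - 1] is [n + 2]; the smaller [n + 1] is kept so that both halves of the sum
    share one majorant. *)
Lemma dom2_neg A y n : dom 2 A y -> Rabs (y (- Z.of_nat n - 1)%Z) <= A * invsq n.
Proof.
  intro H. assert (K := dom_div 2 A y (- Z.of_nat n - 1)%Z H).
  eapply Rle_trans; [exact K|].
  apply Rmult_le_compat_l; [apply (dom_nonneg _ _ _ H)|].
  assert (P := pos_INR n).
  apply Rinv_le_contravar; [apply pow_lt; lra|].
  apply pow_incr. split; [lra|].
  unfold wt. rewrite minus_IZR, opp_IZR, <- INR_IZR_INZ.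
  rewrite Rabs_left; lra.
Qed.

Lemma ex_series_invsq_scal A : ex_series (fun n => A * invsq n).
Proof. apply (ex_series_scal_l (V := R_NormedModule)), ex_series_invsq. Qed.

Lemma zsum_ex_pos A y : dom 2 A y -> ex_series (fun n => y (Z.of_nat n)).
Proof. intro H. apply ex_series_dom with (1 := ex_series_invsq_scal A). intro n. apply dom2_pos, H. Qed.

Lemma zsum_ex_neg A y : dom 2 A y -> ex_series (fun n => y (- Z.of_nat n - 1)%Z).
Proof. intro H. apply ex_series_dom with (1 := ex_series_invsq_scal A). intro n. apply dom2_neg, H. Qed.

Lemma zsum_ext a b : (forall k, a k = b k) -> zsum a = zsum b.
Proof. intro H. unfold zsum. f_equal; apply Series_ext; intro; apply H. Qed.

Lemma zsum_plus A B a b : dom 2 A a -> dom 2 B b ->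
  zsum (fun k => a k + b k) = zsum a + zsum b.
Proof.
  intros H1 H2. unfold zsum. rewrite !Series_plus; eauto using zsum_ex_pos, zsum_ex_neg. ring.
Qed.

Lemma zsum_scal c a : zsum (fun k => c * a k) = c * zsum a.
Proof. unfold zsum. rewrite !Series_scal_l. ring. Qed.

Lemma zsum_minus A B a b : dom 2 A a -> dom 2 B b ->
  zsum (fun k => a k - b k) = zsum a - zsum b.
Proof.
  intros H1 H2. unfold zsum. rewrite !Series_minus; eauto using zsum_ex_pos, zsum_ex_neg. ring.
Qed.

Lemma zsum_bound A a : dom 2 A a -> Rabs (zsum a) <= A * zconst.
Proof.
  intro H. unfold zsum, zconst. rewrite Rmult_plus_distr_l, <- Series_scal_l.
  eapply Rle_trans; [apply Rabs_triang|]. apply Rplus_le_compat.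
  - apply Series_dom; [apply ex_series_invsq_scal|]. intro n. apply dom2_pos, H.
  - apply Series_dom; [apply ex_series_invsq_scal|]. intro n. apply dom2_neg, H.
Qed.

Lemma zconst_pos : 0 <= zconst.
Proof.
  assert (0 <= Series invsq); [|unfold zconst; lra].
  replace 0 with (Series (fun n => 0 * invsq n)) by (rewrite Series_scal_l; ring).
  apply Series_le; [|exact ex_series_invsq]. intro n. assert (A := invsq_pos n). lra.
Qed.

Lemma zsum_opp A a : dom 2 A a -> zsum (fun k => a (- k)%Z) = zsum a.
Proof.
  intro H. unfold zsum.
  assert (H' : dom 2 A (fun k => a (- k)%Z)) by (intro k; rewrite <- wt_opp; apply H).
  rewrite (Series_incr_1 (fun n => a (- Z.of_nat n)%Z)) by apply (zsum_ex_pos A (fun k => a (- k)%Z) H').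
  rewrite (Series_incr_1 (fun n => a (Z.of_nat n))) by apply (zsum_ex_pos A _ H).
  replace (- Z.of_nat 0)%Z with (Z.of_nat 0) by reflexivity.
  rewrite (Series_ext (fun k => a (- Z.of_nat (S k))%Z) (fun n => a (- Z.of_nat n - 1)%Z)) by (intro; f_equal; lia).
  rewrite (Series_ext (fun k => a (- (- Z.of_nat k - 1))%Z) (fun k => a (Z.of_nat (S k)))) by (intro; f_equal; lia).
  ring.
Qed.

(** Submultiplicativity of [1 + |k|], the reason why frequency shifts preserve every decay class. *)
Lemma wt_triangle j k : wt k <= wt j * wt (k + j).
Proof.
  unfold wt. rewrite plus_IZR.
  assert (H := Rabs_triang (IZR k + IZR j) (- IZR j)).
  rewrite Rabs_Ropp in H.
  replace (IZR k + IZR j + - IZR j) with (IZR k) in H by ring.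
  assert (A := Rabs_pos (IZR j)). assert (B := Rabs_pos (IZR k + IZR j)). nra.
Qed.

Lemma dom_shift r A a j : dom r A a -> dom r (A * wt j ^ r) (fun k => a (k + j)%Z).
Proof.
  intros H k. specialize (H (k + j)%Z).
  apply Rle_trans with (Rabs (a (k + j)%Z) * (wt j * wt (k + j)) ^ r).
  - apply Rmult_le_compat_l; [apply Rabs_pos|]. apply pow_incr.
    split; [assert (B := wt_ge_1 k); lra|apply wt_triangle].
  - rewrite Rpow_mult_distr.
    replace (Rabs (a (k + j)%Z) * (wt j ^ r * wt (k + j) ^ r))
      with (Rabs (a (k + j)%Z) * wt (k + j) ^ r * wt j ^ r) by ring.
    apply Rmult_le_compat_r; [left; apply wt_pow_pos|exact H].
Qed.

Lemma dom_opp r A a : dom r A a -> dom r A (fun k => a (- k)%Z).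
Proof. intros H k. rewrite <- wt_opp. apply H. Qed.

Lemma zsum_shift1 A a : dom 2 A a -> zsum (fun k => a (k + 1)%Z) = zsum a.
Proof.
  intro H. unfold zsum.
  rewrite (Series_incr_1 (fun n => a (Z.of_nat n))) by apply (zsum_ex_pos A _ H).
  rewrite (Series_incr_1 (fun n => a (- Z.of_nat n - 1 + 1)%Z))
    by apply (zsum_ex_neg _ (fun k => a (k + 1)%Z) (dom_shift _ _ _ 1 H)).
  replace (- Z.of_nat 0 - 1 + 1)%Z with (Z.of_nat 0) by reflexivity.
  rewrite (Series_ext (fun k => a (Z.of_nat (S k))) (fun k => a (Z.of_nat k + 1)%Z)) by (intro; f_equal; lia).
  rewrite (Series_ext (fun k => a (- Z.of_nat (S k) - 1 + 1)%Z) (fun k => a (- Z.of_nat k - 1)%Z)) by (intro; f_equal; lia).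
  ring.
Qed.

Lemma zsum_shift A a j : dom 2 A a -> zsum (fun k => a (k + j)%Z) = zsum a.
Proof.
  intro H.
  assert (P : forall n, zsum (fun k => a (k + Z.of_nat n)%Z) = zsum a).
  { intro n. induction n as [|n IH].
    - apply zsum_ext. intro k. f_equal. lia.
    - rewrite <- IH. rewrite <- (zsum_shift1 _ _ (dom_shift _ _ _ (Z.of_nat n) H)).
      apply zsum_ext. intro k. f_equal. lia. }
  assert (Q : forall n, zsum (fun k => a (k - Z.of_nat n)%Z) = zsum a).
  { intro n. induction n as [|n IH].
    - apply zsum_ext. intro k. f_equal. lia.
    - rewrite <- IH. transitivity (zsum (fun k => a (k + - Z.of_nat (S n))%Z)).
      { apply zsum_ext. reflexivity. }
      rewrite <- (zsum_shift1 _ _ (dom_shift _ _ _ (- Z.of_nat (S n)) H)).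
      apply zsum_ext. intro k. f_equal. lia. }
  destruct (Z_le_gt_dec 0 j) as [Hj|Hj].
  - rewrite <- (P (Z.to_nat j)). apply zsum_ext. intro k. f_equal. lia.
  - rewrite <- (Q (Z.to_nat (- j))). apply zsum_ext. intro k. f_equal. lia.
Qed.

Lemma zsum_delta (c : R) (m : Z) : zsum (fun k => if Z.eq_dec k m then c else 0) = c.
Proof.
  assert (H : dom 2 (Rabs c * wt m ^ 2) (fun k => if Z.eq_dec k m then c else 0)).
  { intro k. destruct (Z.eq_dec k m) as [->|]; [apply Rle_refl|].
    rewrite Rabs_R0, Rmult_0_l. apply Rmult_le_pos; [apply Rabs_pos|left; apply wt_pow_pos]. }
  rewrite <- (zsum_shift _ _ m H).
  assert (Z0 : Series (fun _ : nat => 0) = 0).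
  { rewrite (Series_ext _ (fun n => 0 * 0)) by (intro; ring).
    rewrite Series_scal_l. ring. }
  unfold zsum. rewrite Series_incr_1.
  - rewrite (Series_ext (fun k => if Z.eq_dec (Z.of_nat (S k) + m) m then c else 0) (fun _ => 0)).
    2:{ intro n. destruct Z.eq_dec; [lia|reflexivity]. }
    rewrite (Series_ext (fun n => if Z.eq_dec (- Z.of_nat n - 1 + m) m then c else 0) (fun _ => 0)).
    2:{ intro n. destruct Z.eq_dec; [lia|reflexivity]. }
    rewrite Z0. destruct Z.eq_dec; [ring|simpl in *; lia].
  - apply (zsum_ex_pos _ (fun k => if Z.eq_dec (k + m) m then c else 0) (dom_shift _ _ _ m H)).
Qed.

Lemma filterlim_zsum {T : Type} (F : (T -> Prop) -> Prop) {FF : Filter F}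
  (f : Z -> T -> R) (l : Z -> R) (A : R) :
  (forall k, filterlim (f k) F (locally (l k))) ->
  F (fun x => dom 2 A (fun k => f k x)) -> dom 2 A l ->
  filterlim (fun x => zsum (fun k => f k x)) F (locally (zsum l)).
Proof.
  intros Hf HF Hl. unfold zsum.
  eapply filterlim_comp_2; [| |apply (filterlim_plus (V := R_NormedModule))].
  - apply filterlim_Series with (b := fun n => A * invsq n); [apply _|apply ex_series_invsq_scal| | |].
    + intro; apply Hf.
    + revert HF. apply filter_imp. intros x Hx n. apply (dom2_pos _ (fun k => f k x)), Hx.
    + intro n. apply dom2_pos, Hl.
  - apply filterlim_Series with (b := fun n => A * invsq n); [apply _|apply ex_series_invsq_scal| | |].
    + intro n; apply (Hf (- Z.of_nat n - 1)%Z).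
    + revert HF. apply filter_imp. intros x Hx n. apply (dom2_neg _ (fun k => f k x)), Hx.
    + intro n. apply (dom2_neg _ l), Hl.
Qed.

Lemma is_derive_zsum (f df : Z -> R -> R) (A A' lo hi x : R) :
  lo < x < hi ->
  (forall k t, lo < t < hi -> is_derive (f k) t (df k t)) ->
  (forall t, lo < t < hi -> dom 2 A (fun k => f k t)) ->
  (forall t, lo < t < hi -> dom 2 A' (fun k => df k t)) ->
  is_derive (fun t => zsum (fun k => f k t)) x (zsum (fun k => df k x)).
Proof.
  intros Hx Hd Hf Hdf. unfold zsum.
  apply (is_derive_plus (V := R_NormedModule)).
  - apply is_derive_Series with (b := fun n => A * invsq n) (b' := fun n => A' * invsq n) (lo := lo) (hi := hi)
      (f := fun n => f (Z.of_nat n)) (df := fun n => df (Z.of_nat n));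
      auto using ex_series_invsq_scal.
    + intros n t Ht. apply (dom2_pos _ (fun k => f k t)); auto.
    + intros n t Ht. apply (dom2_pos _ (fun k => df k t)); auto.
  - apply is_derive_Series with (b := fun n => A * invsq n) (b' := fun n => A' * invsq n) (lo := lo) (hi := hi)
      (f := fun n => f (- Z.of_nat n - 1)%Z) (df := fun n => df (- Z.of_nat n - 1)%Z);
      auto using ex_series_invsq_scal.
    + intros n t Ht. apply (dom2_neg _ (fun k => f k t)); auto.
    + intros n t Ht. apply (dom2_neg _ (fun k => df k t)); auto.
Qed.

(* Hartley's kernel: the functions [cas (k x)], [k] in [Z], form a real orthogonal basis,
   and [cas (k x)]' = [k cas (- k x)]. *)
Definition cas (x : R) : R := cos x + sin x.

Lemma cas_bound x : Rabs (cas x) <= 2.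
Proof.
  unfold cas. assert (A := COS_bound x). assert (B := SIN_bound x).
  apply Rabs_le. lra.
Qed.

Lemma is_derive_cas x : is_derive cas x (cas (- x)).
Proof.
  unfold cas. auto_derive; [trivial|]. rewrite cos_neg, sin_neg. ring.
Qed.

Lemma continuous_cas x : continuous cas x.
Proof. apply (ex_derive_continuous (V := R_NormedModule)). eexists. apply is_derive_cas. Qed.

Lemma cas_cos a b : cas a * cos b = / 2 * (cas (a + b) + cas (a - b)).
Proof. unfold cas. rewrite cos_plus, sin_plus, cos_minus, sin_minus. field. Qed.

Lemma cas_sin a b : cas a * sin b = / 2 * (cas (b - a) - cas (- a - b)).
Proof.
  unfold cas. replace (- a - b) with (- (a + b)) by ring. rewrite cos_neg, sin_neg.
  rewrite cos_plus, sin_plus, cos_minus, sin_minus. field.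
Qed.

Lemma cas_mult a b : cas a * cas b = cos (a - b) + sin (a + b).
Proof. unfold cas. rewrite cos_minus, sin_plus. ring. Qed.

(** * Hartley series: derivatives and multiplication by [cos] and [sin] *)

Definition synth (y : Z -> R) (z : R) : R := zsum (fun k => y k * cas (IZR k * z)).

Lemma dom_cas r A y (u : Z -> R) : dom r A y -> dom r (A * 2) (fun k => y k * cas (u k)).
Proof. apply dom_mult_bounded. intro; apply cas_bound. Qed.

Lemma synth_ext y y' z : (forall k, y k = y' k) -> synth y z = synth y' z.
Proof. intro H. apply zsum_ext. intro k. rewrite H. reflexivity. Qed.

Lemma synth_plus A B y y' z : dom 2 A y -> dom 2 B y' ->
  synth (fun k => y k + y' k) z = synth y z + synth y' z.
Proof.
  intros H1 H2. unfold synth.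
  rewrite <- (zsum_plus _ _ _ _ (dom_cas _ _ _ (fun k => IZR k * z) H1) (dom_cas _ _ _ (fun k => IZR k * z) H2)).
  apply zsum_ext. intro; ring.
Qed.

Lemma synth_scal c y z : synth (fun k => c * y k) z = c * synth y z.
Proof.
  unfold synth. rewrite <- zsum_scal. apply zsum_ext. intro; ring.
Qed.

Lemma synth_minus A B y y' z : dom 2 A y -> dom 2 B y' ->
  synth (fun k => y k - y' k) z = synth y z - synth y' z.
Proof.
  intros H1 H2. unfold synth.
  rewrite <- (zsum_minus _ _ _ _ (dom_cas _ _ _ (fun k => IZR k * z) H1) (dom_cas _ _ _ (fun k => IZR k * z) H2)).
  apply zsum_ext. intro; ring.
Qed.

Lemma synth_bound A y z : dom 2 A y -> Rabs (synth y z) <= A * 2 * zconst.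
Proof. intro H. apply zsum_bound, (dom_cas _ _ _ (fun k => IZR k * z)), H. Qed.

Lemma cas_period k x : cas (IZR k * (x + 2 * PI)) = cas (IZR k * x).
Proof.
  assert (P : forall (n : nat) a, cas (a + 2 * INR n * PI) = cas a).
  { intros n a. unfold cas. rewrite cos_period, sin_period. reflexivity. }
  destruct (Z_le_gt_dec 0 k) as [Hk|Hk].
  - rewrite <- (P (Z.to_nat k) (IZR k * x)). f_equal.
    rewrite INR_IZR_INZ, Z2Nat.id by lia. ring.
  - rewrite <- (P (Z.to_nat (- k)) (IZR k * (x + 2 * PI))). f_equal.
    rewrite INR_IZR_INZ, Z2Nat.id by lia. rewrite opp_IZR. ring.
Qed.

Lemma synth_period y z : synth y (z + 2 * PI) = synth y z.
Proof. apply zsum_ext. intro k. rewrite cas_period. reflexivity. Qed.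

Lemma filterlim_synth {T : Type} (F : (T -> Prop) -> Prop) {FF : Filter F}
  (y : Z -> T -> R) (z : T -> R) (ly : Z -> R) (lz A : R) :
  (forall k, filterlim (y k) F (locally (ly k))) -> filterlim z F (locally lz) ->
  F (fun x => dom 2 A (fun k => y k x)) -> dom 2 A ly ->
  filterlim (fun x => synth (fun k => y k x) (z x)) F (locally (synth ly lz)).
Proof.
  intros Hy Hz HF Hl. unfold synth.
  apply (filterlim_zsum F (fun k x => y k x * cas (IZR k * z x)) (fun k => ly k * cas (IZR k * lz)) (A * 2)).
  - intro k. eapply filterlim_comp_2; [apply Hy| |apply (filterlim_mult (K := R_AbsRing))].
    eapply filterlim_comp; [|apply continuous_cas].
    eapply filterlim_comp; [exact Hz|].
    apply (continuous_scal_r (K := R_AbsRing) (V := R_NormedModule) (IZR k) (fun x => x)). apply continuous_id.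
  - revert HF. apply filter_imp. intros x Hx.
    apply (dom_cas _ _ (fun k => y k x) (fun k => IZR k * z x)), Hx.
  - apply (dom_cas _ _ _ (fun k => IZR k * lz)), Hl.
Qed.

(* The coefficients of the derivative of [synth y]. *)
Definition dseq (y : Z -> R) (k : Z) : R := - IZR k * y (- k)%Z.

(** The reflection of the frequency cancels in second derivatives, so the heat operator is diagonal
    in this basis. *)
Lemma dseq_dseq y k : dseq (dseq y) k = - IZR k ^ 2 * y k.
Proof. unfold dseq. rewrite opp_IZR, Z.opp_involutive. ring. Qed.

Lemma dom_IZR r A y : dom (S r) A y -> dom r A (fun k => IZR k * y k).
Proof.
  intros H k. eapply Rle_trans; [|apply (H k)].
  rewrite Rabs_mult. simpl.
  replace (Rabs (IZR k) * Rabs (y k) * wt k ^ r) with (Rabs (y k) * (Rabs (IZR k) * wt k ^ r)) by ring.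
  apply Rmult_le_compat_l; [apply Rabs_pos|].
  apply Rmult_le_compat_r; [left; apply wt_pow_pos|]. unfold wt. lra.
Qed.

Lemma dom_dseq r A y : dom (S r) A y -> dom r A (dseq y).
Proof.
  intro H. assert (H' := dom_opp _ _ _ (dom_IZR _ _ _ H)).
  intro k. specialize (H' k). cbv beta in H'. rewrite opp_IZR in H'. exact H'.
Qed.

Lemma zsum_reflect_cas A y z : dom 2 A y ->
  zsum (fun k => y (- k)%Z * cas (IZR k * z)) = zsum (fun k => y k * cas (- (IZR k * z))).
Proof.
  intro H.
  rewrite <- (zsum_opp _ _ (dom_cas _ _ _ (fun k => - (IZR k * z)) H)).
  apply zsum_ext. intro k. rewrite opp_IZR. do 2 f_equal. ring.
Qed.

Lemma synth_dseq A y z : dom 3 A y ->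
  synth (dseq y) z = zsum (fun k => y k * (IZR k * cas (- (IZR k * z)))).
Proof.
  intro H. unfold synth, dseq.
  transitivity (zsum (fun k => (IZR k * y k) * cas (- (IZR k * z)))); [|apply zsum_ext; intro; ring].
  rewrite <- (zsum_reflect_cas A (fun k => IZR k * y k)); [|apply dom_IZR, H].
  apply zsum_ext. intro k. rewrite opp_IZR. reflexivity.
Qed.

(** Order three, because the differentiated terms lose one order and must stay summable. *)
Lemma is_derive_synth A y z : dom 3 A y -> is_derive (synth y) z (synth (dseq y) z).
Proof.
  intro H. rewrite (synth_dseq _ _ _ H).
  apply is_derive_zsum with (f := fun k z => y k * cas (IZR k * z))
    (df := fun k z => y k * (IZR k * cas (- (IZR k * z)))) (lo := z - 1) (hi := z + 1) (A := A * 2) (A' := A * 2).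
  - lra.
  - intros k t _. apply (is_derive_scal (fun z => cas (IZR k * z))).
    apply (is_derive_comp cas (fun z => IZR k * z)); [apply is_derive_cas|].
    auto_derive; [trivial|ring].
  - intros t _. apply (dom_cas _ _ _ (fun k => IZR k * t)). revert H. apply dom_weaken; [lia|lra].
  - intros t _. intro k.
    replace (y k * (IZR k * cas (- (IZR k * t)))) with ((IZR k * y k) * cas (- (IZR k * t))) by ring.
    revert k. apply (dom_cas _ _ (fun k => IZR k * y k) (fun k => - (IZR k * t))), dom_IZR, H.
Qed.

(* In a frame moving with velocity [c], time also enters through [x - c t]. *)
Lemma is_derive_synth_time (y y' : Z -> R -> R) (c x A A' lo hi t : R) :
  lo < t < hi ->
  (forall k s, lo < s < hi -> is_derive (y k) s (y' k s)) ->
  (forall s, lo < s < hi -> dom 3 A (fun k => y k s)) ->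
  (forall s, lo < s < hi -> dom 2 A' (fun k => y' k s)) ->
  is_derive (fun s => synth (fun k => y k s) (x - c * s)) t
    (synth (fun k => y' k t) (x - c * t) - c * synth (dseq (fun k => y k t)) (x - c * t)).
Proof.
  intros Ht Hd Hy Hy'.
  rewrite (synth_dseq A) by auto. unfold synth at 2.
  assert (D1 : forall s, lo < s < hi -> dom 2 (A * 2) (fun k => y k s * (IZR k * cas (- (IZR k * (x - c * s)))))).
  { intros s Hs k.
    replace (y k s * (IZR k * cas (- (IZR k * (x - c * s)))))
      with ((IZR k * y k s) * cas (- (IZR k * (x - c * s)))) by ring.
    revert k. apply (dom_cas _ _ (fun k => IZR k * y k s) (fun k => - (IZR k * (x - c * s)))).
    apply (dom_IZR _ _ (fun k => y k s)), Hy, Hs. }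
  assert (D2 : forall s, lo < s < hi -> dom 2 (A' * 2) (fun k => y' k s * cas (IZR k * (x - c * s)))).
  { intros s Hs. apply (dom_cas _ _ (fun k => y' k s) (fun k => IZR k * (x - c * s))), Hy', Hs. }
  rewrite <- zsum_scal.
  rewrite <- (zsum_minus (A' * 2) (A * 2 * Rabs c)); [|auto|apply (dom_scal _ _ c _ (D1 t Ht))].
  apply is_derive_zsum with (f := fun k s => y k s * cas (IZR k * (x - c * s)))
    (df := fun k s => y' k s * cas (IZR k * (x - c * s)) - c * (y k s * (IZR k * cas (- (IZR k * (x - c * s))))))
    (lo := lo) (hi := hi) (A := A * 2) (A' := A' * 2 + A * 2 * Rabs c).
  - exact Ht.
  - intros k s Hs.
    assert (E : is_derive (fun s => cas (IZR k * (x - c * s))) s (- (IZR k * c) * cas (- (IZR k * (x - c * s))))).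
    { apply (is_derive_comp cas (fun s => IZR k * (x - c * s))); [apply is_derive_cas|].
      auto_derive; [trivial|ring]. }
    eapply is_derive_eq; [apply (is_derive_Rmult _ _ _ _ _ (Hd k s Hs) E)|ring].
  - intros s Hs. apply (dom_cas _ _ (fun k => y k s) (fun k => IZR k * (x - c * s))).
    specialize (Hy s Hs). revert Hy. apply dom_weaken; [lia|lra].
  - intros s Hs. apply dom_minus; [apply D2, Hs|apply (dom_scal _ _ c _ (D1 s Hs))].
Qed.

(** Product-to-sum formula, then reindexing of the two sums: multiplication by [cos (j z)] averages
    the shifts by [j] and [- j]. *)
Lemma synth_shift_cos A y j z : dom 2 A y ->
  synth y z * cos (IZR j * z) = / 2 * (synth (fun k => y (k - j)%Z) z + synth (fun k => y (k + j)%Z) z).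
Proof.
  intro H.
  assert (D := dom_cas _ _ _ (fun k => (IZR k + IZR j) * z) H).
  assert (D' := dom_cas _ _ _ (fun k => (IZR k - IZR j) * z) H).
  assert (E1 : synth (fun k => y (k - j)%Z) z = zsum (fun k => y k * cas ((IZR k + IZR j) * z))).
  { rewrite <- (zsum_shift _ _ (- j) D). apply zsum_ext. intro k.
    rewrite plus_IZR, opp_IZR. unfold Z.sub. do 2 f_equal. ring. }
  assert (E2 : synth (fun k => y (k + j)%Z) z = zsum (fun k => y k * cas ((IZR k - IZR j) * z))).
  { rewrite <- (zsum_shift _ _ j D'). apply zsum_ext. intro k.
    rewrite plus_IZR. do 2 f_equal. ring. }
  rewrite E1, E2, <- (zsum_plus _ _ _ _ D D'), <- zsum_scal.
  unfold synth. rewrite Rmult_comm, <- zsum_scal. apply zsum_ext. intro k.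
  rewrite Rmult_comm, Rmult_assoc, cas_cos.
  replace ((IZR k + IZR j) * z) with (IZR k * z + IZR j * z) by ring.
  replace ((IZR k - IZR j) * z) with (IZR k * z - IZR j * z) by ring. ring.
Qed.

(** For the sine, the product-to-sum formula reverses the frequency; hence the reflected indices,
    obtained by a shift followed by [k |-> - k]. *)
Lemma synth_shift_sin A y j z : dom 2 A y ->
  synth y z * sin (IZR j * z) = / 2 * (synth (fun k => y (j - k)%Z) z - synth (fun k => y (- j - k)%Z) z).
Proof.
  intro H.
  assert (D := dom_cas _ _ _ (fun k => (IZR j - IZR k) * z) H).
  assert (D' := dom_cas _ _ _ (fun k => (- IZR k - IZR j) * z) H).
  assert (E1 : synth (fun k => y (j - k)%Z) z = zsum (fun k => y k * cas ((IZR j - IZR k) * z))).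
  { rewrite <- (zsum_shift _ _ j D).
    rewrite <- (zsum_opp _ _ (dom_shift _ _ _ j D)). apply zsum_ext. intro k.
    replace (- k + j)%Z with (j - k)%Z by ring. rewrite minus_IZR. do 2 f_equal. ring. }
  assert (E2 : synth (fun k => y (- j - k)%Z) z = zsum (fun k => y k * cas ((- IZR k - IZR j) * z))).
  { rewrite <- (zsum_shift _ _ (- j) D').
    rewrite <- (zsum_opp _ _ (dom_shift _ _ _ (- j) D')). apply zsum_ext. intro k.
    replace (- k + - j)%Z with (- j - k)%Z by ring. rewrite minus_IZR, opp_IZR. do 2 f_equal. ring. }
  rewrite E1, E2, <- (zsum_minus _ _ _ _ D D'), <- zsum_scal.
  unfold synth. rewrite Rmult_comm, <- zsum_scal. apply zsum_ext. intro k.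
  rewrite Rmult_comm, Rmult_assoc, cas_sin.
  replace ((IZR j - IZR k) * z) with (IZR j * z - IZR k * z) by ring.
  replace ((- IZR k - IZR j) * z) with (- (IZR k * z) - IZR j * z) by ring. ring.
Qed.

(* Bounded finite-range operators on sequences, encoding multiplication by a
   trigonometric polynomial with time-dependent coefficients. *)
Definition Bop (l : list ((R -> R) * (Z -> Z))) (t : R) (y : Z -> R) (k : Z) : R :=
  fold_right (fun cs acc => fst cs t * y (snd cs k) + acc) 0 l.

(** The factor [4] is [wt 3]: the potential has frequencies up to 3, and a shift by that much
    changes the weight by at most this factor. *)
Definition finite_range (l : list ((R -> R) * (Z -> Z))) : Prop :=
  List.Forall (fun cs => (forall t, continuous (fst cs) t) /\ (forall t, Rabs (fst cs t) <= 1) /\ (forall k, wt k <= 4 * wt (snd cs k))) l.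

Lemma Bop_dom r A l t y : finite_range l -> dom r A y -> dom r (INR (length l) * 4 ^ r * A) (Bop l t y).
Proof.
  intros Hl Hy. assert (HA := dom_nonneg _ _ _ Hy).
  induction Hl as [|[c s] l (_ & Hc & Hs) Hl IH].
  - intro k. simpl. rewrite Rabs_R0. lra.
  - intro k. simpl fst in *. simpl snd in *.
    assert (K : dom r (4 ^ r * A) (fun k => c t * y (s k))).
    { intro j. rewrite Rabs_mult.
      apply Rle_trans with (Rabs (y (s j)) * (4 * wt (s j)) ^ r).
      - apply Rmult_le_compat.
        + apply Rmult_le_pos; apply Rabs_pos.
        + left; apply wt_pow_pos.
        + rewrite <- (Rmult_1_l (Rabs (y (s j)))) at 2.
          apply Rmult_le_compat_r; [apply Rabs_pos|apply Hc].
        + apply pow_incr. split; [assert (B := wt_ge_1 j); lra|apply Hs].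
      - rewrite Rpow_mult_distr.
        replace (Rabs (y (s j)) * (4 ^ r * wt (s j) ^ r)) with (4 ^ r * (Rabs (y (s j)) * wt (s j) ^ r)) by ring.
        apply Rmult_le_compat_l; [apply pow_le; lra|apply Hy]. }
    assert (P : Rabs (c t * y (s k) + Bop l t y k) * wt k ^ r <= 4 ^ r * A + INR (length l) * 4 ^ r * A)
      by apply (dom_plus _ _ _ _ _ K IH k).
    change (length ((c, s) :: l)) with (S (length l)). rewrite S_INR.
    eapply Rle_trans; [exact P|]. apply Req_le. ring.
Qed.

Lemma Bop_continuous l (y : Z -> R -> R) k t : finite_range l ->
  (forall j, continuous (y j) t) -> continuous (fun s => Bop l s (fun j => y j s) k) t.
Proof.
  intros Hl Hy. induction Hl as [|[c s] l (Hc & _) Hl IH].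
  - apply continuous_const.
  - apply (continuous_plus (V := R_NormedModule)); [|exact IH].
    apply (continuous_mult (K := R_AbsRing)); [apply Hc|apply Hy].
Qed.

Lemma Bop_minus l t y z k : Bop l t (fun j => y j - z j) k = Bop l t y k - Bop l t z k.
Proof. induction l as [|[c s] l IH]; simpl; [ring|]. rewrite IH. ring. Qed.

Lemma Bop_scal l t a y k : Bop l t (fun j => a * y j) k = a * Bop l t y k.
Proof. induction l as [|[c s] l IH]; simpl; [ring|]. rewrite IH. ring. Qed.

Lemma Bop_Series l t (y : nat -> Z -> R) k : (forall j, ex_series (fun n => y n j)) ->
  Bop l t (fun j => Series (fun n => y n j)) k = Series (fun n => Bop l t (y n) k) /\ ex_series (fun n => Bop l t (y n) k).
Proof.
  intro H. induction l as [|[c s] l [IH IH']]; simpl.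
  - assert (is_series (fun _ : nat => 0) 0).
    { apply is_series_Reals. intros e He. exists O. intros n _.
      replace (sum_f_R0 (fun _ => 0) n) with 0 by (induction n; simpl; lra).
      unfold Rdist. replace (0 - 0) with 0 by ring. rewrite Rabs_R0. exact He. }
    split; [symmetry; apply is_series_unique; assumption|exists 0; assumption].
  - assert (E : ex_series (fun n => c t * y n (s k))) by apply (ex_series_scal_l (V := R_NormedModule)), H.
    split.
    + rewrite IH, <- Series_scal_l, <- Series_plus by assumption. reflexivity.
    + apply (ex_series_plus (V := R_NormedModule)); assumption.
Qed.

(** * Joint continuity in time and space *)

Definition cont2 (f : R -> R -> R) : Prop :=
  forall p : R * R, continuous (fun q : R * R => f (fst q) (snd q)) p.

Lemma cont2_const c : cont2 (fun _ _ => c).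
Proof. intro p. apply continuous_const. Qed.

Lemma cont2_plus f g : cont2 f -> cont2 g -> cont2 (fun t x => f t x + g t x).
Proof. intros Hf Hg p. apply (continuous_plus (V := R_NormedModule)); auto. Qed.

Lemma cont2_minus f g : cont2 f -> cont2 g -> cont2 (fun t x => f t x - g t x).
Proof. intros Hf Hg p. apply (continuous_minus (V := R_NormedModule)); auto. Qed.

Lemma cont2_opp f : cont2 f -> cont2 (fun t x => - f t x).
Proof. intros Hf p. apply (continuous_opp (V := R_NormedModule)); auto. Qed.

Lemma cont2_mult f g : cont2 f -> cont2 g -> cont2 (fun t x => f t x * g t x).
Proof. intros Hf Hg p. apply (continuous_mult (K := R_AbsRing)); auto. Qed.

Lemma cont2_comp (h : R -> R) f : (forall y, continuous h y) -> cont2 f -> cont2 (fun t x => h (f t x)).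
Proof. intros Hh Hf p. apply (continuous_comp (fun q : R * R => f (fst q) (snd q)) h); auto. Qed.

Lemma cont2_pow f n : cont2 f -> cont2 (fun t x => f t x ^ n).
Proof.
  intro Hf. induction n as [|n IH]; simpl; [apply cont2_const|]. apply cont2_mult; assumption.
Qed.

Lemma continuous_Rinv (x : R) : x <> 0 -> continuous Rinv x.
Proof.
  intro H. apply (ex_derive_continuous (V := R_NormedModule)). auto_derive. exact H.
Qed.

Lemma cont2_div f g : cont2 f -> cont2 g -> (forall t x, g t x <> 0) -> cont2 (fun t x => f t x / g t x).
Proof.
  intros Hf Hg Hne p. apply (continuous_mult (K := R_AbsRing)); [apply Hf|].
  apply (continuous_comp (fun q : R * R => g (fst q) (snd q)) Rinv); [apply Hg|].
  apply continuous_Rinv, Hne.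
Qed.

Lemma cont2_fst (g : R -> R) : (forall t, continuous g t) -> cont2 (fun t _ => g t).
Proof.
  intros Hg p. apply (continuous_comp fst g); [apply continuous_fst|apply Hg].
Qed.

Lemma cont2_snd (g : R -> R) : (forall t, continuous g t) -> cont2 (fun _ x => g x).
Proof.
  intros Hg p. apply (continuous_comp snd g); [apply continuous_snd|apply Hg].
Qed.

Lemma cont2_reparam (f a b : R -> R -> R) : cont2 f -> cont2 a -> cont2 b -> cont2 (fun t x => f (a t x) (b t x)).
Proof.
  intros Hf Ha Hb p.
  apply (continuous_comp_2 (fun q : R * R => a (fst q) (snd q)) (fun q : R * R => b (fst q) (snd q)) f); [apply Ha|apply Hb|].
  apply Hf.
Qed.

Lemma cont2_slice_x f t x : cont2 f -> continuous (f t) x.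
Proof.
  intro Hf. apply (continuous_comp_2 (fun _ : R => t) (fun y : R => y) f x).
  - apply continuous_const.
  - apply continuous_id.
  - apply (Hf (t, x)).
Qed.

Lemma cont2_slice_t f t x : cont2 f -> continuous (fun s => f s x) t.
Proof.
  intro Hf. apply (continuous_comp_2 (fun y : R => y) (fun _ : R => x) f t).
  - apply continuous_id.
  - apply continuous_const.
  - apply (Hf (t, x)).
Qed.

Lemma cont2_continuity_2d f x y : cont2 f -> continuity_2d_pt f x y.
Proof. intro Hf. apply continuity_2d_pt_filterlim. apply (Hf (x, y)). Qed.

Lemma cont2_swap f : cont2 f -> cont2 (fun x t => f t x).
Proof.
  intros Hf p. apply (continuous_comp_2 snd fst f p); [apply continuous_snd|apply continuous_fst|].
  apply Hf.
Qed.

Lemma continuous_Rmax_r (t0 t : R) : continuous (fun s => Rmax s t0) t.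
Proof.
  apply continuous_ext with (fun s => (s + t0 + Rabs (s - t0)) / 2).
  - intro s. unfold Rmax, Rabs. destruct Rle_dec; destruct Rcase_abs; lra.
  - apply (continuous_mult (K := R_AbsRing)); [|apply continuous_const].
    apply (continuous_plus (V := R_NormedModule)).
    + apply (continuous_plus (V := R_NormedModule)); [apply continuous_id|apply continuous_const].
    + apply (continuous_comp (fun s => s - t0) Rabs); [|apply continuous_Rabs].
      apply (continuous_minus (V := R_NormedModule)); [apply continuous_id|apply continuous_const].
Qed.

(** * Integrals of continuous functions and their dependence on time *)

Lemma cont_ex_RInt (f : R -> R) a b : (forall x, continuous f x) -> ex_RInt f a b.
Proof. intro H. apply (ex_RInt_continuous (V := R_CompleteNormedModule)). intros; apply H. Qed.

Lemma RInt_Rmult_l (f : R -> R) a b c : (forall x, continuous f x) ->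
  RInt (fun x => c * f x) a b = c * RInt f a b.
Proof. intro H. apply (RInt_scal (V := R_CompleteNormedModule)). apply cont_ex_RInt, H. Qed.

Lemma RInt_Rplus (f g : R -> R) a b : (forall x, continuous f x) -> (forall x, continuous g x) ->
  RInt (fun x => f x + g x) a b = RInt f a b + RInt g a b.
Proof. intros Hf Hg. apply (RInt_plus (V := R_CompleteNormedModule)); apply cont_ex_RInt; assumption. Qed.

Lemma RInt_Rminus (f g : R -> R) a b : (forall x, continuous f x) -> (forall x, continuous g x) ->
  RInt (fun x => f x - g x) a b = RInt f a b - RInt g a b.
Proof. intros Hf Hg. apply (RInt_minus (V := R_CompleteNormedModule)); apply cont_ex_RInt; assumption. Qed.

Lemma RInt_eq (f g : R -> R) a b : (forall x, f x = g x) -> RInt f a b = RInt g a b.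
Proof. intro H. apply RInt_ext. intros; apply H. Qed.

Lemma RInt_FTC (G g : R -> R) a b :
  (forall x, is_derive G x (g x)) -> (forall x, continuous g x) -> RInt g a b = G b - G a.
Proof.
  intros H1 H2. apply is_RInt_unique. apply (is_RInt_derive (V := R_CompleteNormedModule)); intros; auto.
Qed.

Lemma RInt_mono (f g : R -> R) a b : a <= b -> (forall x, continuous f x) -> (forall x, continuous g x) ->
  (forall x, a <= x <= b -> f x <= g x) -> RInt f a b <= RInt g a b.
Proof.
  intros Hab Hf Hg H. apply RInt_le; [exact Hab|apply cont_ex_RInt, Hf|apply cont_ex_RInt, Hg|].
  intros; apply H; lra.
Qed.

Lemma RInt_constR (c a b : R) : RInt (fun _ => c) a b = (b - a) * c.
Proof. apply (RInt_const (V := R_CompleteNormedModule)). Qed.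

Lemma RInt_nonneg (f : R -> R) a b : a <= b -> (forall x, continuous f x) ->
  (forall x, a <= x <= b -> 0 <= f x) -> 0 <= RInt f a b.
Proof.
  intros Hab Hf H. replace 0 with (RInt (fun _ => 0) a b).
  - apply RInt_mono; auto. intro; apply continuous_const.
  - rewrite RInt_constR. apply Rmult_0_r.
Qed.

Lemma RInt_Chasles_cont (f : R -> R) a b c : (forall x, continuous f x) ->
  RInt f a b + RInt f b c = RInt f a c.
Proof.
  intro H. apply (RInt_Chasles (V := R_CompleteNormedModule)); apply cont_ex_RInt, H.
Qed.

Lemma is_derive_primitive (f : R -> R) a x : (forall x, continuous f x) ->
  is_derive (fun y => RInt f a y) x (f x).
Proof.
  intro H. apply (is_derive_RInt (V := R_NormedModule) f (fun y => RInt f a y) a x); [|apply H].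
  apply filter_forall. intro y. apply (RInt_correct (V := R_CompleteNormedModule)), cont_ex_RInt, H.
Qed.

Ltac cont1 :=
  cbv beta; first [ solve [auto] |
  lazymatch goal with
  | |- continuous (fun _ => ?c) _ => apply continuous_const
  | |- continuous (fun y => y) _ => apply continuous_id
  | |- continuous (fun y => _ + _) _ => apply (continuous_plus (V := R_NormedModule)); cont1
  | |- continuous (fun y => _ - _) _ => apply (continuous_minus (V := R_NormedModule)); cont1
  | |- continuous (fun y => - _) _ => apply (continuous_opp (V := R_NormedModule)); cont1
  | |- continuous (fun y => _ * _) _ => apply (continuous_mult (K := R_AbsRing)); cont1
  | _ => idtac
  end ].

Lemma continuous_pow (f : R -> R) n x : continuous f x -> continuous (fun y => f y ^ n) x.
Proof.
  intro H. induction n as [|n IH]; simpl; [apply continuous_const|].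
  apply (continuous_mult (K := R_AbsRing)); assumption.
Qed.

(** The quadratic form [(p, q) |-> int (p f + q g)^2] is nonnegative; evaluation at [(B, - M)] gives
    the discriminant inequality. *)
Lemma Cauchy_Schwarz_RInt (f g : R -> R) a b : a <= b ->
  (forall x, continuous f x) -> (forall x, continuous g x) ->
  RInt (fun x => f x * g x) a b ^ 2 <= RInt (fun x => f x ^ 2) a b * RInt (fun x => g x ^ 2) a b.
Proof.
  intros Hab Hf Hg.
  assert (Hfg : forall x, continuous (fun x => f x * g x) x) by (intro; cont1; auto).
  assert (Hff : forall x, continuous (fun x => f x ^ 2) x) by (intro; apply continuous_pow; auto).
  assert (Hgg : forall x, continuous (fun x => g x ^ 2) x) by (intro; apply continuous_pow; auto).
  set (A := RInt (fun x => f x ^ 2) a b). set (B := RInt (fun x => g x ^ 2) a b).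
  set (M := RInt (fun x => f x * g x) a b).
  assert (Q : forall p q : R, 0 <= p ^ 2 * A + 2 * p * q * M + q ^ 2 * B).
  { intros p q.
    replace (p ^ 2 * A + 2 * p * q * M + q ^ 2 * B) with (RInt (fun x => (p * f x + q * g x) ^ 2) a b).
    - apply RInt_nonneg; [exact Hab| |intros; apply pow2_ge_0].
      intro x. apply continuous_pow. cont1; auto.
    - unfold A, B, M.
      rewrite <- !RInt_Rmult_l by auto.
      rewrite <- !RInt_Rplus by (intro; cont1; auto).
      apply RInt_eq. intro; ring. }
  assert (HA : 0 <= A) by (apply RInt_nonneg; auto; intros; apply pow2_ge_0).
  assert (HB : 0 <= B) by (apply RInt_nonneg; auto; intros; apply pow2_ge_0).
  destruct (Rle_lt_or_eq_dec _ _ HB) as [HB'|HB'].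
  - assert (K := Q B (- M)).
    assert (0 <= B * (A * B - M ^ 2)) by nra. nra.
  - rewrite <- HB' in *. rewrite Rmult_0_r.
    destruct (Req_dec M 0) as [->|HM]; [simpl; lra|].
    (* With [B = 0] and [M <> 0] the form is affine in [q]; this [q] gives it the value
       [- A - 2]. *)
    exfalso. assert (K := Q 1 (- (A + 1) / M)).
    replace (1 ^ 2 * A + 2 * 1 * (- (A + 1) / M) * M + (- (A + 1) / M) ^ 2 * 0) with (- A - 2) in K by (field; exact HM).
    lra.
Qed.

Lemma RInt_zero_pointwise (g : R -> R) a b : a < b -> (forall x, continuous g x) ->
  (forall x, a <= x <= b -> 0 <= g x) -> RInt g a b <= 0 -> forall x, a <= x <= b -> g x = 0.
Proof.
  intros Hab Hc Hp HI x Hx.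
  destruct (Rle_lt_or_eq_dec _ _ (Hp x Hx)) as [H|H]; [exfalso|auto].
  destruct (proj1 (filterlim_locally _ _) (Hc x) (mkposreal (g x / 2) ltac:(lra))) as [[d Hd] HH].
  simpl in HH.
  (* The neighbourhood is cut down to [[a, b]], since [x] may be an endpoint; it keeps a positive
     length because [a < b]. *)
  set (p := Rmax a (x - d / 2)). set (q := Rmin b (x + d / 2)).
  assert (Hpq : a <= p /\ p < q /\ q <= b /\ x - d / 2 <= p /\ q <= x + d / 2).
  { unfold p, q, Rmax, Rmin. destruct Rle_dec; destruct Rle_dec; lra. }
  assert (E : 0 < RInt g p q).
  { apply Rlt_le_trans with (RInt (fun _ => g x / 2) p q).
    - rewrite RInt_constR. apply Rmult_lt_0_compat; lra.
    - apply RInt_mono; [lra|intro; apply continuous_const|exact Hc|].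
      intros y Hy. assert (B : ball x d y).
      { change (Rabs (y - x) < d). apply Rabs_def1; lra. }
      specialize (HH y B). change (Rabs (g y - g x) < g x / 2) in HH.
      apply Rabs_def2 in HH. lra. }
  assert (E1 : 0 <= RInt g a p) by (apply RInt_nonneg; auto; [lra|intros; apply Hp; lra]).
  assert (E2 : 0 <= RInt g q b) by (apply RInt_nonneg; auto; [lra|intros; apply Hp; lra]).
  assert (C1 := RInt_Chasles_cont g a p b Hc). assert (C2 := RInt_Chasles_cont g p q b Hc). lra.
Qed.

Lemma continuous_RInt_param (g : R -> R -> R) a b t : a <= b -> cont2 g ->
  continuous (fun s => RInt (g s) a b) t.
Proof.
  intros Hab Hg.
  apply filterlim_locally. intros [eps He].
  (* The [+ 1] keeps the divisor positive when [a = b]. *)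
  set (e := eps / (b - a + 1)).
  assert (He' : 0 < e) by (apply Rdiv_lt_0_compat; lra).
  destruct (uniform_continuity_2d_1d (fun x t => g t x) a b t) with (eps := mkposreal e He') as [d Hd].
  { intros x _. apply cont2_continuity_2d, cont2_swap, Hg. }
  exists d. intros s Hs.
  change (Rabs (s - t) < d) in Hs.
  change (Rabs (RInt (g s) a b - RInt (g t) a b) < eps).
  assert (Hc : forall r x, continuous (g r) x) by (intros; apply cont2_slice_x, Hg).
  rewrite <- RInt_Rminus by auto.
  apply Rle_lt_trans with ((b - a) * e).
  - apply abs_RInt_le_const; [exact Hab|apply cont_ex_RInt; intro; cont1; auto|].
    intros x Hx. left. apply (Hd x t x s); auto.
    + assert (H := cond_pos d). lra.
    + apply Rabs_def2 in Hs. lra.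
    + rewrite Rminus_eq_0, Rabs_R0. apply cond_pos.
  - unfold e. apply Rmult_lt_reg_r with (b - a + 1); [lra|].
    field_simplify; nra.
Qed.

Lemma is_derive_RInt_time (g gt : R -> R -> R) a b t0 t :
  cont2 g -> cont2 gt -> t0 < t ->
  (forall s x, t0 < s -> is_derive (fun s => g s x) s (gt s x)) ->
  is_derive (fun s => RInt (g s) a b) t (RInt (gt t) a b).
Proof.
  intros Hg Hgt Ht Hd.
  assert (L : locally t (fun s => t0 < s)) by apply (open_gt t0 t Ht).
  replace (RInt (gt t) a b) with (RInt (fun x => Derive (fun s => g s x) t) a b).
  - apply is_derive_RInt_param.
    + revert L. apply filter_imp. intros s Hs x _. exists (gt s x). apply Hd, Hs.
    + intros x _. apply continuity_2d_pt_ext_loc with gt.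
      * destruct L as [d Hd']. exists d. intros u v Hu _. symmetry. apply is_derive_unique, Hd.
        apply Hd'. exact Hu.
      * apply cont2_continuity_2d, Hgt.
    + apply filter_forall. intro s. apply cont_ex_RInt. intro x. apply cont2_slice_x, Hg.
  - apply RInt_eq. intro x. apply is_derive_unique, Hd, Ht.
Qed.

(** * Differential inequalities *)

Lemma decreasing_of_derive_nonpos (f df : R -> R) (t0 t : R) :
  (forall s, continuous f s) -> (forall s, t0 < s < t -> is_derive f s (df s)) ->
  (forall s, t0 < s < t -> df s <= 0) -> t0 <= t -> f t <= f t0.
Proof.
  intros Hc Hd Hn Ht.
  destruct (Rle_lt_or_eq_dec _ _ Ht) as [H|<-]; [|lra].
  (* The mean value point may be an endpoint, where nothing is known of [df]; the derivative
     receives the default value 0 there. *)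
  destruct (MVT_gen f t0 t (fun s => if Rle_dec s t0 then 0 else if Rle_dec t s then 0 else df s)) as [c [Hc1 Hc2]].
  - intros s Hs. rewrite Rmin_left, Rmax_right in Hs by lra.
    destruct Rle_dec; [lra|]. destruct Rle_dec; [lra|]. apply Hd. lra.
  - intros s Hs. apply continuity_pt_filterlim, Hc.
  - destruct Rle_dec; [nra|]. destruct Rle_dec; [nra|]. assert (K := Hn c ltac:(lra)). nra.
Qed.

(** Integrating factor: [f s exp (- k (s - t0))] is nonincreasing. The sign of [k] is free, so both
    growth and decay are covered. *)
Lemma Gronwall (f df : R -> R) (k t0 t : R) :
  (forall s, continuous f s) -> (forall s, t0 < s < t -> is_derive f s (df s)) ->
  (forall s, t0 < s < t -> df s <= k * f s) -> t0 <= t -> f t <= f t0 * exp (k * (t - t0)).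
Proof.
  intros Hc Hd Hn Ht.
  assert (D : forall s, is_derive (fun s => exp (- k * (s - t0))) s (- k * exp (- k * (s - t0)))).
  { intro s. apply is_derive_exp_lin. }
  assert (K : f t * exp (- k * (t - t0)) <= f t0 * exp (- k * (t0 - t0))).
  { apply (decreasing_of_derive_nonpos (fun s => f s * exp (- k * (s - t0)))
      (fun s => df s * exp (- k * (s - t0)) + f s * (- k * exp (- k * (s - t0))))); auto.
    - intro s. cont1. apply (ex_derive_continuous (V := R_NormedModule)). eexists; apply D.
    - intros s Hs. apply (is_derive_Rmult f (fun s => exp (- k * (s - t0))));  [apply Hd, Hs|apply D].
    - intros s Hs. assert (E := exp_pos (- k * (s - t0))). specialize (Hn s Hs). nra. }
  replace (- k * (t0 - t0)) with 0 in K by ring. rewrite exp_0, Rmult_1_r in K.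
  apply Rmult_le_reg_r with (exp (- k * (t - t0))); [apply exp_pos|].
  rewrite Rmult_assoc, <- exp_plus. replace (k * (t - t0) + - k * (t - t0)) with 0 by ring.
  rewrite exp_0, Rmult_1_r. exact K.
Qed.

(** * Reduction to one period *)

Lemma period_reduce (x : R) : exists k : Z, 0 <= x - 2 * PI * IZR k <= 2 * PI.
Proof.
  assert (P := PI_RGT_0).
  destruct (archimed (x / (2 * PI))) as [A B].
  exists (up (x / (2 * PI)) - 1)%Z. rewrite minus_IZR.
  set (u := IZR (up (x / (2 * PI)))) in *.
  assert (E : x = 2 * PI * (x / (2 * PI))) by (field; lra).
  set (r := x / (2 * PI)) in *. nra.
Qed.

Lemma periodic_Z (g : R -> R) : (forall x, g (x + 2 * PI) = g x) ->
  forall k x, g (x - 2 * PI * IZR k) = g x.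
Proof.
  intro H.
  assert (P : forall (n : nat) x, g (x + 2 * PI * INR n) = g x).
  { intros n. induction n as [|n IH]; intro x.
    - simpl. f_equal. ring.
    - rewrite S_INR, <- (IH x), <- (H (x + 2 * PI * INR n)). f_equal. ring. }
  intros k x. destruct (Z_le_gt_dec 0 k) as [Hk|Hk].
  - rewrite <- (P (Z.to_nat k)). f_equal. rewrite INR_IZR_INZ, Z2Nat.id by lia. ring.
  - rewrite <- (P (Z.to_nat (- k)) x). f_equal. rewrite INR_IZR_INZ, Z2Nat.id by lia. rewrite opp_IZR. ring.
Qed.

Lemma periodic_forall (g : R -> R) (P : R -> Prop) : (forall x, g (x + 2 * PI) = g x) ->
  (forall x, 0 <= x <= 2 * PI -> P (g x)) -> forall x, P (g x).
Proof.
  intros Hg H x. destruct (period_reduce x) as [k Hk].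
  rewrite <- (periodic_Z g Hg k x). apply H, Hk.
Qed.

Ltac cont2_tac :=
  cbv beta;
  lazymatch goal with
  | |- cont2 (fun _ _ => ?c) => apply cont2_const
  | |- cont2 (fun _ _ => _ + _) => apply cont2_plus; cont2_tac
  | |- cont2 (fun _ _ => _ - _) => apply cont2_minus; cont2_tac
  | |- cont2 (fun _ _ => - _) => apply cont2_opp; cont2_tac
  | |- cont2 (fun _ _ => _ * _) => apply cont2_mult; cont2_tac
  | |- cont2 (fun _ _ => _ ^ _) => apply cont2_pow; cont2_tac
  | _ => try assumption
  end.

Lemma is_derive_continuous (f : R -> R) (x l : R) : is_derive f x l -> continuous f x.
Proof. intro H. apply (ex_derive_continuous (V := R_NormedModule)). exists l. exact H. Qed.

(** * Orthogonality of the [cas] functions *)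

Lemma is_derive_cas_lin (a b x : R) : is_derive (fun x => cas (a * (x - b))) x (a * cas (- (a * (x - b)))).
Proof.
  apply (is_derive_Rcomp cas (fun x => a * (x - b))); [|apply is_derive_cas].
  auto_derive; [trivial|Rring].
Qed.

Lemma continuous_cas_lin (a b x : R) : continuous (fun x => cas (a * (x - b))) x.
Proof. eapply is_derive_continuous, is_derive_cas_lin. Qed.

Lemma cas_shift_period (m : Z) a : cas (IZR m * (2 * PI - a)) = cas (IZR m * (0 - a)).
Proof. rewrite <- (cas_period m (0 - a)). do 2 f_equal. Rring. Qed.

Lemma RInt_cas (m : Z) a :
  RInt (fun x => cas (IZR m * (x - a))) 0 (2 * PI) = if Z.eq_dec m 0 then 2 * PI else 0.
Proof.
  destruct (Z.eq_dec m 0) as [->|Hm].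
  - rewrite (RInt_eq _ (fun _ => 1)).
    + rewrite RInt_constR. Rring.
    + intro x. rewrite Rmult_0_l. unfold cas. rewrite cos_0, sin_0. Rring.
  - assert (Hm' : IZR m <> 0) by (apply not_0_IZR; exact Hm).
    rewrite (RInt_FTC (fun x => - / IZR m * cas (IZR (- m) * (x - a)))).
    + rewrite (cas_shift_period (- m)). Rring.
    + intro x. eapply is_derive_eq.
      * apply (is_derive_scal (fun x => cas (IZR (- m) * (x - a)))), is_derive_cas_lin.
      * rewrite opp_IZR. unfold scal; simpl; unfold mult; simpl.
        replace (- (- IZR m * (x - a))) with (IZR m * (x - a)) by Rring. Rfield. exact Hm'.
    + intro x. apply continuous_cas_lin.
Qed.

(** [cos] and [sin] are the even and odd parts of [cas], so the product is again a combination of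
    [cas] functions of integer frequency, each integrated by [RInt_cas]. *)
Lemma cas_cas_expand j k z :
  cas (IZR j * z) * cas (IZR k * z) =
  / 2 * (cas (IZR (j - k) * z) + cas (IZR (k - j) * z)) + / 2 * (cas (IZR (j + k) * z) - cas (IZR (- j - k) * z)).
Proof.
  rewrite cas_mult. rewrite !minus_IZR, opp_IZR, plus_IZR.
  replace ((IZR k - IZR j) * z) with (- ((IZR j - IZR k) * z)) by Rring.
  replace ((- IZR j - IZR k) * z) with (- ((IZR j + IZR k) * z)) by Rring.
  unfold cas. rewrite !cos_neg, !sin_neg.
  replace (IZR j * z - IZR k * z) with ((IZR j - IZR k) * z) by Rring.
  replace (IZR j * z + IZR k * z) with ((IZR j + IZR k) * z) by Rring. Rfield.
Qed.

Lemma RInt_cas_cas j k a :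
  RInt (fun x => cas (IZR j * (x - a)) * cas (IZR k * (x - a))) 0 (2 * PI) = if Z.eq_dec j k then 2 * PI else 0.
Proof.
  rewrite (RInt_eq _ (fun x => / 2 * (cas (IZR (j - k) * (x - a)) + cas (IZR (k - j) * (x - a)))
    + / 2 * (cas (IZR (j + k) * (x - a)) - cas (IZR (- j - k) * (x - a))))) by (intro; apply cas_cas_expand).
  assert (C := fun m x => continuous_cas_lin (IZR m) a x).
  rewrite RInt_Rplus, !RInt_Rmult_l, RInt_Rplus, RInt_Rminus, !RInt_cas by (intro; cont1).
  repeat destruct Z.eq_dec; try lia; Rfield.
Qed.

Lemma continuous_synth A y a x : dom 2 A y -> continuous (fun x => synth y (x - a)) x.
Proof.
  intro H. apply (filterlim_synth (locally x) (fun k _ => y k) (fun x => x - a) y (x - a) A); auto.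
  - intro k. apply filterlim_const.
  - apply (continuous_minus (V := R_NormedModule) (fun x => x) (fun _ => a)); [apply continuous_id|apply continuous_const].
  - apply filter_forall. auto.
Qed.

(** Termwise integration comes from termwise differentiation: the series of the primitives has the
    integrand as its derivative. *)
Lemma RInt_synth_cas A y m a : dom 2 A y ->
  RInt (fun x => synth y (x - a) * cas (IZR m * (x - a))) 0 (2 * PI) = 2 * PI * y m.
Proof.
  intro H. assert (Hpi := PI_4). assert (Hpi' := PI_RGT_0).
  set (g := fun j x => y j * (cas (IZR j * (x - a)) * cas (IZR m * (x - a)))).
  assert (Hg : forall j x, continuous (g j) x).
  { intros j x. unfold g. cont1; apply continuous_cas_lin. }
  assert (Dg : forall x, dom 2 (A * 4) (fun j => g j x)).
  { intro x. apply dom_mult_bounded; [|exact H]. intro j. rewrite Rabs_mult.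
    assert (B1 := cas_bound (IZR j * (x - a))). assert (B2 := cas_bound (IZR m * (x - a))).
    assert (P1 := Rabs_pos (cas (IZR j * (x - a)))). assert (P2 := Rabs_pos (cas (IZR m * (x - a)))). nra. }
  rewrite (RInt_FTC (fun x => zsum (fun j => RInt (g j) 0 x))).
  - rewrite (zsum_ext (fun j => RInt (g j) 0 0) (fun j => 0 * 0)).
    2:{ intro j. rewrite RInt_point. unfold zero; simpl. Rring. }
    rewrite zsum_scal.
    rewrite (zsum_ext _ (fun j => if Z.eq_dec j m then 2 * PI * y m else 0)).
    + rewrite zsum_delta. Rring.
    + intro j. unfold g. rewrite RInt_Rmult_l by (intro; cont1; apply continuous_cas_lin).
      rewrite RInt_cas_cas. destruct Z.eq_dec as [->|]; Rring.
  - intro x.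
    replace (synth y (x - a) * cas (IZR m * (x - a))) with (zsum (fun j => g j x)).
    2:{ unfold synth, g. rewrite (Rmult_comm (zsum _)), <- zsum_scal. apply zsum_ext. intro; Rring. }
    apply is_derive_zsum with (f := fun j x => RInt (g j) 0 x) (df := g) (A := (A * 4) * (Rabs x + 2))
      (A' := A * 4) (lo := Rmin 0 x - 1) (hi := Rmax 0 x + 1).
    + assert (Q := Rmin_r 0 x). assert (Q' := Rmax_r 0 x). lra.
    + intros j t _. apply is_derive_primitive, Hg.
    + intros t Ht j.
      assert (Q := Rmin_l 0 x). assert (Q' := Rmax_l 0 x).
      (* The primitives inherit the decay of the integrands, up to the distance from 0. *)
      assert (E : Rabs (RInt (g j) 0 t - RInt (g j) 0 0) <= (A * 4 / wt j ^ 2) * Rabs (t - 0)).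
      { apply (bounded_derive_Lipschitz (fun t => RInt (g j) 0 t) (g j) (Rmin 0 x - 1) (Rmax 0 x + 1)); auto; [| |lra].
        - intros s _. apply is_derive_primitive, Hg.
        - intros s _. apply (dom_div 2 (A * 4) (fun j => g j s)), Dg. }
      rewrite RInt_point in E. change (@zero R_CompleteNormedModule) with 0 in E. rewrite !Rminus_0_r in E.
      assert (Ht' : Rabs t <= Rabs x + 2).
      { revert Ht. unfold Rmin, Rmax, Rabs. destruct Rle_dec; repeat destruct Rcase_abs; lra. }
      assert (W := wt_pow_pos j 2). assert (HA := dom_nonneg _ _ _ (Dg 0)).
      apply Rle_trans with ((A * 4 / wt j ^ 2 * Rabs t) * wt j ^ 2).
      * apply Rmult_le_compat_r; [lra|exact E].
      * replace (A * 4 / wt j ^ 2 * Rabs t * wt j ^ 2) with (A * 4 * Rabs t) by (Rfield; assert (Q2 := wt_ge_1 j); lra).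
        apply Rmult_le_compat_l; assumption.
    + intros t _. apply Dg.
  - intro x. cont1; [apply (continuous_synth A), H|apply continuous_cas_lin].
Qed.

(** * Fourier inversion *)

Definition fcoef (g : R -> R) (m : Z) : R := / (2 * PI) * RInt (fun x => g x * cas (IZR m * x)) 0 (2 * PI).

Lemma continuous_cas_freq m x : continuous (fun x => cas (IZR m * x)) x.
Proof.
  apply continuous_ext with (fun x => cas (IZR m * (x - 0))); [|apply continuous_cas_lin].
  intro. rewrite Rminus_0_r. reflexivity.
Qed.

(* Test against the powers of the trigonometric polynomial [1 + cos (x - x0) - cos d],
   which exceeds 1 exactly near [x0]. *)
Lemma trig_complete_nonpos (h : R -> R) : (forall x, continuous h x) ->
  (forall m, RInt (fun x => h x * cas (IZR m * x)) 0 (2 * PI) = 0) ->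
  forall x0, 0 < x0 < 2 * PI -> h x0 <= 0.
Proof.
  intros Hc H0 x0 Hx0. apply Rnot_lt_le. intro Hpos.
  assert (Hpi := PI_RGT_0).
  destruct (proj1 (filterlim_locally _ _) (Hc x0) (mkposreal (h x0 / 2) ltac:(lra))) as [[d0 Hd0] HH].
  simpl in HH.
  (* [d < d0] keeps [h] above half of [h x0] on the arc; [d < x0] and [d < 2 PI - x0] put every
     point of the period off the arc at a distance between [d] and [2 PI - d] from [x0], where the
     cosine is at most [cos d]. *)
  set (d := Rmin (d0 / 2) (Rmin (x0 / 2) (Rmin ((2 * PI - x0) / 2) (PI / 2)))).
  assert (Hd : 0 < d /\ d < d0 /\ d < x0 /\ d < 2 * PI - x0 /\ d <= PI / 2).
  { unfold d, Rmin. repeat destruct Rle_dec; lra. }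
  set (T := fun x => 1 - cos d + cos (x - x0)).
  set (e := h x0 / 2).
  assert (HT : forall x, continuous T x).
  { intro x. unfold T. cont1. apply (continuous_comp (fun x => x - x0) cos); [cont1|apply continuous_cos]. }
  assert (HTn : forall n x, continuous (fun x => T x ^ n) x) by (intros; apply continuous_pow, HT).
  (* Multiplication by [T] turns a [cas] function into a combination of [cas] functions, so
     orthogonality to all of them survives each power. *)
  assert (Orth : forall n m, RInt (fun x => h x * T x ^ n * cas (IZR m * x)) 0 (2 * PI) = 0).
  { induction n as [|n IH]; intro m.
    - etransitivity; [|apply (H0 m)]. apply RInt_eq. intro; simpl; Rring.
    - assert (C : forall j x, continuous (fun x => h x * T x ^ n * cas (IZR j * x)) x).
      { intros j x. cont1; apply continuous_cas_freq. }
      rewrite (RInt_eq _ (fun x => (1 - cos d) * (h x * T x ^ n * cas (IZR m * x))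
        + (cos x0 * / 2) * (h x * T x ^ n * cas (IZR (m + 1) * x) + h x * T x ^ n * cas (IZR (m - 1) * x))
        + (sin x0 * / 2) * (h x * T x ^ n * cas (IZR (1 - m) * x) - h x * T x ^ n * cas (IZR (- m - 1) * x)))).
      + rewrite !RInt_Rplus, !RInt_Rmult_l, RInt_Rplus, RInt_Rminus, !IH by (intro; cont1). Rring.
      + intro x. rewrite <- tech_pow_Rmult. unfold T at 1. rewrite cos_minus.
        rewrite plus_IZR, !minus_IZR, opp_IZR.
        assert (E1 := cas_cos (IZR m * x) x). assert (E2 := cas_sin (IZR m * x) x).
        replace ((IZR m + 1) * x) with (IZR m * x + x) by Rring.
        replace ((IZR m - 1) * x) with (IZR m * x - x) by Rring.
        replace ((1 - IZR m) * x) with (x - IZR m * x) by Rring.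
        replace ((- IZR m - 1) * x) with (- (IZR m * x) - x) by Rring.
        set (q := h x * T x ^ n) in *.
        replace (h x * ((1 - cos d + (cos x * cos x0 + sin x * sin x0)) * T x ^ n) * cas (IZR m * x))
          with (q * ((1 - cos d) * cas (IZR m * x) + cos x0 * (cas (IZR m * x) * cos x) + sin x0 * (cas (IZR m * x) * sin x)))
          by (unfold q; Rring).
        rewrite E1, E2. Rring. }
  assert (Hcos : cos d < cos (d / 2)) by (apply cos_decreasing_1; lra).
  assert (Hcosd : 0 <= cos d) by (apply cos_ge_0; lra).
  set (r := 1 - cos d + cos (d / 2)).
  assert (Hr : 1 < r) by (unfold r; lra).
  assert (Cabs : forall x, continuous (fun x => Rabs (h x)) x).
  { intro x. apply (continuous_comp h Rabs); [apply Hc|apply continuous_Rabs]. }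
  set (M := RInt (fun x => Rabs (h x)) 0 (2 * PI)).
  assert (Hout : forall x, 0 <= x <= 2 * PI -> Rabs (x - x0) >= d -> -1 <= T x <= 1).
  { intros x Hx Hxd. unfold T. assert (B := COS_bound (x - x0)). assert (B2 := COS_bound d). split; [lra|].
    assert (cos (x - x0) <= cos d); [|lra].
    assert (E : cos (x - x0) = cos (Rabs (x - x0))).
    { unfold Rabs. destruct Rcase_abs; [rewrite cos_neg|]; reflexivity. }
    rewrite E. assert (Rabs (x - x0) <= 2 * PI - d) by (unfold Rabs in *; destruct Rcase_abs; lra).
    destruct (Rle_lt_dec (Rabs (x - x0)) PI).
    - apply cos_decr_1; lra.
    - replace (cos (Rabs (x - x0))) with (cos (2 * PI - Rabs (x - x0))).
      + apply cos_decr_1; lra.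
      + rewrite cos_minus, cos_2PI, sin_2PI. Rring. }
  assert (Hin : forall x, Rabs (x - x0) < d -> 1 <= T x /\ e <= h x).
  { intros x Hx. split.
    - unfold T. assert (cos d <= cos (x - x0)); [|lra].
      replace (cos (x - x0)) with (cos (Rabs (x - x0))).
      2:{ unfold Rabs. destruct Rcase_abs; [rewrite cos_neg|]; reflexivity. }
      apply cos_decr_1; try lra. apply Rabs_pos.
    - assert (B : ball x0 d0 x) by (change (Rabs (x - x0) < d0); lra).
      specialize (HH x B). change (Rabs (h x - h x0) < h x0 / 2) in HH.
      apply Rabs_def2 in HH. unfold e. lra. }
  (* On the arc both factors are nonnegative, off it [T] has modulus at most 1; adding [Rabs (h x)]
     thus makes the integrand nonnegative. *)
  assert (Low : forall n x, 0 <= x <= 2 * PI -> - Rabs (h x) <= h x * T x ^ n).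
  { intros n x Hx. destruct (Rlt_le_dec (Rabs (x - x0)) d) as [Hl|Hl].
    - destruct (Hin x Hl) as [A B]. assert (0 <= T x ^ n) by (apply pow_le; lra).
      assert (0 < e) by (unfold e; lra). assert (Q := Rabs_pos (h x)). nra.
    - assert (Q : Rabs (h x * T x ^ n) <= Rabs (h x)).
      { rewrite Rabs_mult. rewrite <- (Rmult_1_r (Rabs (h x))) at 2.
        apply Rmult_le_compat_l; [apply Rabs_pos|].
        rewrite <- RPow_abs. rewrite <- (pow1 n). apply pow_incr. split; [apply Rabs_pos|].
        apply Rabs_le. apply Hout; lra. }
      apply Rabs_le_between in Q. lra. }
  (* The integral of [h T^n] vanishes, so the completed integrand has total [M], while the inner
     half of the arc alone contributes [d e r^n] with [r > 1]. *)
  assert (Key : forall n, d * (e * r ^ n) <= M).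
  { intro n.
    assert (Ch : forall x, continuous (fun x => h x * T x ^ n) x) by (intro; cont1; apply HTn).
    assert (Cp : forall x, continuous (fun x => h x * T x ^ n + Rabs (h x)) x) by (intro; cont1; apply HTn).
    assert (E : RInt (fun x => h x * T x ^ n + Rabs (h x)) 0 (2 * PI) = M).
    { rewrite RInt_Rplus by auto. rewrite (RInt_eq _ (fun x => h x * T x ^ n * cas (IZR 0 * x))).
      - rewrite Orth. unfold M. Rring.
      - intro x. rewrite Rmult_0_l. unfold cas. rewrite cos_0, sin_0. Rring. }
    rewrite <- E.
    rewrite <- (RInt_Chasles_cont _ 0 (x0 - d / 2)) by auto.
    rewrite <- (RInt_Chasles_cont _ (x0 - d / 2) (x0 + d / 2) (2 * PI)) by auto.
    assert (P1 : 0 <= RInt (fun x => h x * T x ^ n + Rabs (h x)) 0 (x0 - d / 2)).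
    { apply RInt_nonneg; [lra|auto|]. intros x Hx. assert (L := Low n x ltac:(lra)). lra. }
    assert (P2 : 0 <= RInt (fun x => h x * T x ^ n + Rabs (h x)) (x0 + d / 2) (2 * PI)).
    { apply RInt_nonneg; [lra|auto|]. intros x Hx. assert (L := Low n x ltac:(lra)). lra. }
    assert (P3 : d * (e * r ^ n) <= RInt (fun x => h x * T x ^ n + Rabs (h x)) (x0 - d / 2) (x0 + d / 2)).
    { apply Rle_trans with (RInt (fun _ => e * r ^ n) (x0 - d / 2) (x0 + d / 2)).
      - rewrite RInt_constR. apply Req_le. Rfield.
      - apply RInt_mono; [lra|intro; apply continuous_const|auto|].
        intros x Hx. assert (Hxd : Rabs (x - x0) <= d / 2) by (apply Rabs_le; lra).
        destruct (Hin x ltac:(lra)) as [_ B].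
        assert (HTr : r <= T x).
        { unfold T, r. assert (cos (d / 2) <= cos (x - x0)); [|lra].
          replace (cos (x - x0)) with (cos (Rabs (x - x0))).
          2:{ unfold Rabs. destruct Rcase_abs; [rewrite cos_neg|]; reflexivity. }
          apply cos_decr_1; try lra. apply Rabs_pos. }
        assert (HP : r ^ n <= T x ^ n) by (apply pow_incr; lra).
        assert (HP' : 0 <= r ^ n) by (apply pow_le; lra).
        assert (0 < e) by (unfold e; lra). assert (Q := Rabs_pos (h x)). nra. }
    lra. }
  destruct (Pow_x_infinity r) with (b := (M + 1) / (d * e)) as [N HN].
  { rewrite Rabs_pos_eq; lra. }
  specialize (HN N (le_n _)). specialize (Key N).
  rewrite Rabs_pos_eq in HN by (apply pow_le; lra).
  assert (He0 : 0 < e) by (unfold e; lra).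
  assert (0 < d * e) by (apply Rmult_lt_0_compat; lra).
  apply Rge_le in HN. apply (Rmult_le_compat_l (d * e)) in HN; [|lra].
  replace (d * e * ((M + 1) / (d * e))) with (M + 1) in HN by (Rfield; lra). lra.
Qed.

Lemma trig_complete (h : R -> R) : (forall x, continuous h x) -> (forall x, h (x + 2 * PI) = h x) ->
  (forall m, RInt (fun x => h x * cas (IZR m * x)) 0 (2 * PI) = 0) -> forall x, h x = 0.
Proof.
  intros Hc Hp H0. assert (Hpi := PI_RGT_0).
  assert (In : forall x, 0 < x < 2 * PI -> h x = 0).
  { intros x Hx. apply Rle_antisym.
    - apply trig_complete_nonpos; assumption.
    - apply Ropp_le_cancel. rewrite Ropp_0.
      apply (trig_complete_nonpos (fun x => - h x)); [intro; cont1| |exact Hx].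
      intro m. rewrite (RInt_eq _ (fun x => -1 * (h x * cas (IZR m * x)))) by (intro; Rring).
      rewrite RInt_Rmult_l, H0; [Rring|]. intro; cont1. apply continuous_cas_freq. }
  apply (periodic_forall h (fun y => y = 0) Hp).
  (* The endpoints of the period are reached through the vanishing integral of [h^2]. *)
  intros x Hx. assert (E : h x ^ 2 = 0).
  { apply (RInt_zero_pointwise (fun x => h x ^ 2) 0 (2 * PI)); [lra|intro; apply continuous_pow, Hc|intros; apply pow2_ge_0| |exact Hx].
    rewrite (RInt_ext _ (fun _ => 0)).
    - rewrite RInt_constR. lra.
    - intros y Hy. rewrite Rmin_left, Rmax_right in Hy by lra. rewrite In by exact Hy. simpl. Rring. }
  nra.
Qed.

Lemma Fourier_inversion (g : R -> R) A : (forall x, continuous g x) -> (forall x, g (x + 2 * PI) = g x) ->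
  dom 2 A (fcoef g) -> forall x, synth (fcoef g) x = g x.
Proof.
  intros Hc Hp HA x. assert (Hpi := PI_RGT_0).
  assert (Cs : forall x, continuous (synth (fcoef g)) x).
  { intro y. apply continuous_ext with (fun x => synth (fcoef g) (x - 0)); [|apply (continuous_synth A), HA].
    intro. rewrite Rminus_0_r. reflexivity. }
  apply Rminus_diag_uniq.
  apply (trig_complete (fun x => synth (fcoef g) x - g x)).
  - intro; cont1.
  - intro y. rewrite synth_period, Hp. reflexivity.
  - intro m. rewrite (RInt_eq _ (fun x => synth (fcoef g) x * cas (IZR m * x) - g x * cas (IZR m * x))) by (intro; Rring).
    rewrite RInt_Rminus by (intro; cont1; apply continuous_cas_freq).
    rewrite (RInt_eq _ (fun x => synth (fcoef g) (x - 0) * cas (IZR m * (x - 0)))) by (intro; rewrite Rminus_0_r; reflexivity).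
    rewrite (RInt_synth_cas A) by exact HA. unfold fcoef. Rfield. lra.
Qed.

(** * Decay of Fourier coefficients *)

(** The derivative is an existential witness rather than [Derive], so that sums and products go by
    plain induction on [n]. *)
Fixpoint Ck (n : nat) (g : R -> R) : Prop :=
  match n with
  | O => forall x, continuous g x
  | S n => exists g', (forall x, is_derive g x (g' x)) /\ Ck n g'
  end.

Lemma Ck_continuous n g : Ck n g -> forall x, continuous g x.
Proof.
  destruct n as [|n]; [auto|]. intros [g' [H _]] x. eapply is_derive_continuous, H.
Qed.

Lemma Ck_pred n g : Ck (S n) g -> Ck n g.
Proof.
  revert g. induction n as [|n IH]; intros g H.
  - exact (Ck_continuous 1 g H).
  - destruct H as [g' [H1 H2]]. exists g'. split; [exact H1|]. apply IH, H2.
Qed.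

Lemma Ck_plus n f g : Ck n f -> Ck n g -> Ck n (fun x => f x + g x).
Proof.
  revert f g. induction n as [|n IH]; simpl; intros f g Hf Hg.
  - intro; cont1.
  - destruct Hf as [f' [Hf Hf']], Hg as [g' [Hg Hg']].
    exists (fun x => f' x + g' x). split; [|apply IH; assumption].
    intro x. apply (is_derive_plus (V := R_NormedModule)); auto.
Qed.

Lemma Ck_mult n f g : Ck n f -> Ck n g -> Ck n (fun x => f x * g x).
Proof.
  revert f g. induction n as [|n IH]; intros f g Hf Hg.
  - simpl in *. intro; cont1.
  - assert (Hf0 := Ck_pred _ _ Hf). assert (Hg0 := Ck_pred _ _ Hg).
    destruct Hf as [f' [Hf Hf']], Hg as [g' [Hg Hg']].
    exists (fun x => f' x * g x + f x * g' x). split.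
    + intro x. apply is_derive_Rmult; auto.
    + apply Ck_plus; apply IH; assumption.
Qed.

Lemma Ck_const n c : Ck n (fun _ => c).
Proof.
  revert c. induction n as [|n IH]; intro c; simpl.
  - intro; apply continuous_const.
  - exists (fun _ => 0). split; [intro; apply (is_derive_const (V := R_NormedModule))|apply IH].
Qed.

(** Integration by parts over a period, where the boundary terms cancel; the reflection of [m] comes
    from the derivative of [cas]. *)
Lemma fcoef_derive g g' m : (forall x, is_derive g x (g' x)) -> (forall x, continuous g' x) ->
  (forall x, g (x + 2 * PI) = g x) -> IZR m * fcoef g m = fcoef g' (- m).
Proof.
  intros Hd Hc Hp. assert (Hpi := PI_RGT_0).
  assert (Hg : forall x, continuous g x) by (intro; eapply is_derive_continuous, Hd).
  assert (C := continuous_cas_freq).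
  assert (E : RInt (fun x => g' x * cas (IZR (- m) * x) + g x * (IZR (- m) * cas (IZR m * x))) 0 (2 * PI) = 0).
  { rewrite (RInt_FTC (fun x => g x * cas (IZR (- m) * x))).
    - assert (P := cas_period (- m) 0). rewrite Rplus_0_l in P. rewrite P.
      assert (P' := Hp 0). rewrite Rplus_0_l in P'. rewrite P'. Rring.
    - intro x. apply (is_derive_Rmult g (fun x => cas (IZR (- m) * x))); [apply Hd|].
      eapply is_derive_ext; [|eapply is_derive_eq; [apply (is_derive_cas_lin (IZR (- m)) 0)|]].
      + intro; cbv beta. rewrite Rminus_0_r. reflexivity.
      + rewrite Rminus_0_r. do 2 f_equal. rewrite opp_IZR. Rring.
    - intro x; cont1. }
  rewrite RInt_Rplus in E by (intro; cont1).
  rewrite (RInt_eq (fun x => g x * (IZR (- m) * cas (IZR m * x))) (fun x => IZR (- m) * (g x * cas (IZR m * x)))) in E by (intro; Rring).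
  rewrite RInt_Rmult_l in E by (intro; cont1).
  unfold fcoef.
  set (I1 := RInt (fun x => g' x * cas (IZR (- m) * x)) 0 (2 * PI)) in *.
  set (I2 := RInt (fun x => g x * cas (IZR m * x)) 0 (2 * PI)) in *.
  rewrite opp_IZR in E. clearbody I1 I2.
  assert (E' : I1 = IZR m * I2) by lra. rewrite E'. Rring.
Qed.

Lemma derive_periodic (g g' : R -> R) : (forall x, is_derive g x (g' x)) ->
  (forall x, g (x + 2 * PI) = g x) -> forall x, g' (x + 2 * PI) = g' x.
Proof.
  intros Hd Hp x.
  assert (D : is_derive (fun x => g (x + 2 * PI)) x (1 * g' (x + 2 * PI))).
  { apply (is_derive_Rcomp g (fun x => x + 2 * PI)); [auto_derive; [trivial|Rring]|apply Hd]. }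
  apply is_derive_unique in D.
  rewrite (Derive_ext _ g) in D by exact Hp. rewrite (is_derive_unique _ _ _ (Hd x)) in D. lra.
Qed.

Lemma fcoef_bounded g C m : (forall x, continuous g x) -> (forall x, 0 <= x <= 2 * PI -> Rabs (g x) <= C) ->
  Rabs (fcoef g m) <= 2 * C.
Proof.
  intros Hc HC. assert (Hpi := PI_RGT_0). unfold fcoef.
  rewrite Rabs_mult, (Rabs_pos_eq (/ (2 * PI))) by (left; apply Rinv_0_lt_compat; lra).
  apply Rmult_le_reg_l with (2 * PI); [lra|]. rewrite <- Rmult_assoc, Rinv_r, Rmult_1_l by lra.
  replace (2 * PI * (2 * C)) with ((2 * PI - 0) * (C * 2)) by Rring.
  apply abs_RInt_le_const; [lra| |].
  - apply cont_ex_RInt. intro; cont1. apply continuous_cas_freq.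
  - intros t Ht. rewrite Rabs_mult. apply Rmult_le_compat; try apply Rabs_pos; [apply HC, Ht|apply cas_bound].
Qed.

Lemma continuous_bounded (g : R -> R) a b : a <= b -> (forall x, continuous g x) ->
  exists C, forall x, a <= x <= b -> Rabs (g x) <= C.
Proof.
  intros Hab Hc.
  destruct (continuity_ab_maj (fun x => Rabs (g x)) a b Hab) as [M [HM _]].
  - intros c _. apply continuity_pt_filterlim. apply (continuous_comp g Rabs); [apply Hc|apply continuous_Rabs].
  - exists (Rabs (g M)). exact HM.
Qed.

(** The additional factor [1 + |m|] splits: the [1] is handled by the bound at order [n] for [g],
    and [m] times the coefficient is a coefficient of [g'], at frequency [- m]. *)
Lemma fcoef_decay n g : Ck n g -> (forall x, g (x + 2 * PI) = g x) -> exists A, dom n A (fcoef g).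
Proof.
  assert (Hpi := PI_RGT_0).
  revert g. induction n as [|n IH]; intros g Hk Hp.
  - destruct (continuous_bounded g 0 (2 * PI)) as [C HC]; [lra|exact Hk|].
    exists (2 * C). apply dom_0_iff. intro k. apply fcoef_bounded; assumption.
  - destruct (IH g (Ck_pred _ _ Hk) Hp) as [A HA].
    destruct Hk as [g' [Hd Hk]].
    destruct (IH g' Hk (derive_periodic g g' Hd Hp)) as [B HB].
    exists (A + B). intro m.
    replace (Rabs (fcoef g m) * wt m ^ S n)
      with (Rabs (fcoef g m) * wt m ^ n + Rabs (IZR m * fcoef g m) * wt (- m) ^ n).
    + rewrite (fcoef_derive g g') by (auto; apply (Ck_continuous _ _ Hk)).
      apply Rplus_le_compat; [apply HA|apply HB].
    + rewrite Rabs_mult, wt_opp. simpl. unfold wt. Rring.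
Qed.

(** * Mean-zero periodic functions *)

Lemma RInt_zero_exists_zero (w : R -> R) a b : a < b -> (forall x, continuous w x) -> RInt w a b = 0 ->
  exists c, a <= c <= b /\ w c = 0.
Proof.
  intros Hab Hc H0.
  destruct (MVT_gen (fun x => RInt w a x) a b w) as [c [Hc1 Hc2]].
  - intros x _. apply is_derive_primitive, Hc.
  - intros x _. apply continuity_pt_filterlim. eapply is_derive_continuous, is_derive_primitive, Hc.
  - rewrite Rmin_left, Rmax_right in Hc1 by lra. exists c. split; [exact Hc1|].
    rewrite RInt_point, H0 in Hc2. change (@zero R_CompleteNormedModule) with 0 in Hc2.
    apply Rmult_eq_reg_r with (b - a); lra.
Qed.

(* The two arcs joining a zero of [w] to [x] have lengths adding up to [2 PI]; apply
   Cauchy-Schwarz on each of them. *)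
Lemma sup_bound_derive (w w' : R -> R) : (forall x, is_derive w x (w' x)) -> (forall x, continuous w' x) ->
  w (2 * PI) = w 0 -> RInt w 0 (2 * PI) = 0 ->
  forall x, 0 <= x <= 2 * PI -> w x ^ 2 <= PI / 2 * RInt (fun x => w' x ^ 2) 0 (2 * PI).
Proof.
  intros Hd Hc Hper H0. assert (Hpi := PI_RGT_0).
  assert (Hw : forall x, continuous w x) by (intro; eapply is_derive_continuous, Hd).
  destruct (RInt_zero_exists_zero w 0 (2 * PI)) as [c [Hc0 Hwc]]; [lra|assumption|assumption|].
  assert (C2 : forall x, continuous (fun x => w' x ^ 2) x) by (intro; apply continuous_pow, Hc).
  assert (CS : forall a b, a <= b -> (w b - w a) ^ 2 <= (b - a) * RInt (fun x => w' x ^ 2) a b).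
  { intros a b Hab. assert (K := Cauchy_Schwarz_RInt (fun _ => 1) w' a b Hab ltac:(intro; apply continuous_const) Hc).
    rewrite (RInt_eq (fun x => 1 * w' x) w') in K by (intro; Rring).
    rewrite (RInt_FTC w w') in K by assumption.
    rewrite (RInt_eq (fun x => 1 ^ 2) (fun _ => 1)) in K by (intro; Rring).
    rewrite RInt_constR in K. lra. }
  set (J := fun a b => RInt (fun x => w' x ^ 2) a b).
  assert (Jpos : forall a b, a <= b -> 0 <= J a b).
  { intros a b Hab. apply RInt_nonneg; auto. intros; apply pow2_ge_0. }
  assert (JC : forall a b c, J a b + J b c = J a c) by (intros; apply RInt_Chasles_cont, C2).
  assert (Key : forall p q, 0 <= p -> p <= q -> q <= 2 * PI -> (w q - w p) ^ 2 <= PI / 2 * J 0 (2 * PI)).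
  { intros p q H1 H2 H3.
    assert (A := CS p q H2). fold (J p q) in A.
    assert (B := CS 0 p H1). fold (J 0 p) in B.
    assert (C := CS q (2 * PI) H3). fold (J q (2 * PI)) in C. rewrite Hper in C.
    assert (E1 := JC 0 p q). assert (E2 := JC 0 q (2 * PI)).
    assert (P1 := Jpos 0 p H1). assert (P2 := Jpos p q H2). assert (P3 := Jpos q (2 * PI) H3).
    set (D := w q - w p) in *. set (d := q - p) in *.
    set (u := w p - w 0) in *. set (v := w 0 - w q) in *.
    assert (HD : D = - (u + v)) by (unfold D, u, v; Rring).
    (* The complementary arc passes through the junction of [2 PI] and [0]:
       [(u + v)^2 / (a + b) <= u^2 / a + v^2 / b], the cases [a = 0] and [b = 0] being separate. *)
    assert (B' : D ^ 2 <= (2 * PI - d) * (J 0 p + J q (2 * PI))).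
    { destruct (Rle_lt_or_eq_dec 0 (p - 0)) as [Hp|Hp]; [lra| |].
      - destruct (Rle_lt_or_eq_dec 0 (2 * PI - q)) as [Hq|Hq]; [lra| |].
        + set (a := p - 0) in *. set (b := 2 * PI - q) in *.
          replace (2 * PI - d) with (a + b) by (unfold a, b, d; Rring).
          rewrite HD.
          assert (X1 : 0 <= (b * u - a * v) ^ 2) by apply pow2_ge_0.
          assert (X2 : b * u ^ 2 <= b * (a * J 0 p)) by (apply Rmult_le_compat_l; lra).
          assert (X3 : a * v ^ 2 <= a * (b * J q (2 * PI))) by (apply Rmult_le_compat_l; lra).
          assert (X4 : a * b * (- (u + v)) ^ 2 <= (a + b) * (b * u ^ 2 + a * v ^ 2)) by nra.
          apply Rmult_le_reg_l with (a * b); [nra|].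
          eapply Rle_trans; [exact X4|].
          replace (a * b * ((a + b) * (J 0 p + J q (2 * PI)))) with ((a + b) * (b * (a * J 0 p) + a * (b * J q (2 * PI)))) by Rring.
          apply Rmult_le_compat_l; lra.
        + assert (v = 0). { rewrite <- Hq in C. rewrite Rmult_0_l in C. nra. }
          rewrite HD, H. replace (2 * PI - d) with (p - 0) by (unfold d; lra).
          assert (0 <= (p - 0) * J q (2 * PI)) by (apply Rmult_le_pos; lra). nra.
      - assert (u = 0). { rewrite <- Hp in B. rewrite Rmult_0_l in B. nra. }
        rewrite HD, H. replace (2 * PI - d) with (2 * PI - q) by (unfold d; lra).
        assert (0 <= (2 * PI - q) * J 0 p) by (apply Rmult_le_pos; lra). nra. }
    assert (Hd0 : 0 <= d <= 2 * PI) by (unfold d; lra).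
    assert (Y1 : (2 * PI - d) * D ^ 2 <= (2 * PI - d) * (d * J p q)) by (apply Rmult_le_compat_l; lra).
    assert (Y2 : d * D ^ 2 <= d * ((2 * PI - d) * (J 0 p + J q (2 * PI)))) by (apply Rmult_le_compat_l; lra).
    (* Each arc bound is weighted by the length of the other arc; then [d (2 PI - d) <= PI^2]. *)
    assert (Y3 : 2 * PI * D ^ 2 <= d * (2 * PI - d) * J 0 (2 * PI)).
    { rewrite <- E2, <- E1. nra. }
    assert (Y4 : d * (2 * PI - d) * J 0 (2 * PI) <= PI * PI * J 0 (2 * PI)).
    { apply Rmult_le_compat_r; [apply Jpos; lra|]. assert (0 <= (d - PI) ^ 2) by apply pow2_ge_0. nra. }
    apply Rmult_le_reg_l with (2 * PI); [lra|]. nra. }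
  intros x Hx. fold (J 0 (2 * PI)).
  destruct (Rle_lt_dec c x).
  - assert (K := Key c x ltac:(lra) ltac:(lra) ltac:(lra)). rewrite Hwc, Rminus_0_r in K. exact K.
  - assert (K := Key x c ltac:(lra) ltac:(lra) ltac:(lra)). rewrite Hwc in K.
    replace (w x ^ 2) with ((0 - w x) ^ 2) by Rring. exact K.
Qed.

(** The sup bound integrated over the period. The constant [PI^2] is larger than the optimal 1, but
    small enough for a positive rate. *)
Lemma Poincare (w w' : R -> R) : (forall x, is_derive w x (w' x)) -> (forall x, continuous w' x) ->
  w (2 * PI) = w 0 -> RInt w 0 (2 * PI) = 0 ->
  RInt (fun x => w x ^ 2) 0 (2 * PI) <= PI ^ 2 * RInt (fun x => w' x ^ 2) 0 (2 * PI).
Proof.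
  intros Hd Hc Hper H0. assert (Hpi := PI_RGT_0).
  assert (Hw : forall x, continuous w x) by (intro; eapply is_derive_continuous, Hd).
  set (J := RInt (fun x => w' x ^ 2) 0 (2 * PI)).
  apply Rle_trans with (RInt (fun _ => PI / 2 * J) 0 (2 * PI)).
  - apply RInt_mono; [lra|intro; apply continuous_pow, Hw|intro; apply continuous_const|].
    apply sup_bound_derive; assumption.
  - rewrite RInt_constR. apply Req_le. Rfield.
Qed.

(** * The linear heat equation in Fourier space *)

(** The damping can only help: for [sg = 1] or [-1], the quantity [sg y - (G - G t0) - |y t0|] times
    [exp (a (s - t0))] is nonincreasing. The bound on the source is given through a primitive [G],
    so no integral has to be computed. *)
Lemma dissipative_growth (a t0 t : R) (y r G G' : R -> R) :
  0 <= a -> t0 <= t ->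
  (forall s, continuous y s) -> (forall s, t0 < s < t -> is_derive y s (- a * y s + r s)) ->
  (forall s, is_derive G s (G' s)) ->
  (forall s, t0 < s < t -> Rabs (r s) <= G' s) ->
  Rabs (y t) <= Rabs (y t0) + (G t - G t0).
Proof.
  intros Ha Ht Hy Hd HG Hr.
  assert (HGc : forall s, continuous G s) by (intro; eapply is_derive_continuous, HG).
  assert (Gmono : forall s, t0 <= s <= t -> G t0 <= G s).
  { intros s Hs. apply Ropp_le_cancel.
    apply (decreasing_of_derive_nonpos (fun s => - G s) (fun s => - G' s)); [intro; cont1| | |lra].
    - intros u _. apply (is_derive_opp (V := R_NormedModule)), HG.
    - intros u Hu. assert (K := Hr u ltac:(lra)). assert (Q := Rabs_pos (r u)). lra. }
  assert (One : forall sg : R, (sg = 1 \/ sg = -1) -> sg * y t <= Rabs (y t0) + (G t - G t0)).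
  { intros sg Hsg.
    set (E := fun s => exp (a * (s - t0))).
    assert (DE : forall s, is_derive E s (a * E s)) by (intro; apply is_derive_exp_lin).
    assert (K : E t * (sg * y t - (G t - G t0) - Rabs (y t0)) <= E t0 * (sg * y t0 - (G t0 - G t0) - Rabs (y t0))).
    { apply (decreasing_of_derive_nonpos (fun s => E s * (sg * y s - (G s - G t0) - Rabs (y t0)))
        (fun s => a * E s * (sg * y s - (G s - G t0) - Rabs (y t0)) + E s * (sg * (- a * y s + r s) - G' s))); [| | |lra].
      - intro s. assert (continuous E s) by (eapply is_derive_continuous, DE). cont1.
      - intros s Hs. apply (is_derive_Rmult E (fun s => sg * y s - (G s - G t0) - Rabs (y t0))); [apply DE|].
        eapply is_derive_eq.
        + apply (is_derive_Rminus (fun s => sg * y s - (G s - G t0)) (fun _ => Rabs (y t0))); [|apply is_derive_Rconst].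
          apply (is_derive_Rminus (fun s => sg * y s) (fun s => G s - G t0)); [apply is_derive_Rscal, Hd, Hs|].
          apply (is_derive_Rminus G (fun _ => G t0)); [apply HG|apply is_derive_Rconst].
        + ring.
      - intros s Hs. assert (Q := exp_pos (a * (s - t0))). fold (E s) in Q.
        assert (Gm := Gmono s ltac:(lra)). assert (R1 := Hr s Hs). apply Rabs_le_between in R1.
        assert (R2 := Rabs_pos (y t0)).
        replace (a * E s * (sg * y s - (G s - G t0) - Rabs (y t0)) + E s * (sg * (- a * y s + r s) - G' s))
          with (E s * ((sg * r s - G' s) - a * ((G s - G t0) + Rabs (y t0)))) by ring.
        assert (sg * r s - G' s <= 0) by (destruct Hsg as [-> | ->]; lra).
        assert (0 <= a * ((G s - G t0) + Rabs (y t0))) by (apply Rmult_le_pos; lra).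
        assert (0 <= E s * (- ((sg * r s - G' s) - a * ((G s - G t0) + Rabs (y t0))))) by (apply Rmult_le_pos; lra).
        lra. }
    assert (Q := exp_pos (a * (t - t0))). fold (E t) in Q.
    assert (Q0 := exp_pos (a * (t0 - t0))). fold (E t0) in Q0.
    assert (R3 : sg * y t0 <= Rabs (y t0)).
    { destruct Hsg as [-> | ->]; unfold Rabs; destruct Rcase_abs; lra. }
    assert (E t * (sg * y t - (G t - G t0) - Rabs (y t0)) <= 0) by nra.
    nra. }
  assert (P := One 1 ltac:(auto)). assert (N := One (-1) ltac:(auto)).
  apply Rabs_le. lra.
Qed.

(** [rho / a] is the equilibrium of the bounding equation. With [a] of order [k^2], this division is
    the source of the smoothing. *)
Lemma dissipative_decay (a t0 t rho : R) (y r : R -> R) :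
  0 < a -> t0 <= t ->
  (forall s, continuous y s) -> (forall s, t0 < s < t -> is_derive y s (- a * y s + r s)) ->
  (forall s, t0 < s < t -> Rabs (r s) <= rho) -> 0 <= rho ->
  Rabs (y t) <= Rabs (y t0) * exp (- a * (t - t0)) + rho / a.
Proof.
  intros Ha Ht Hy Hd Hr Hrho.
  assert (One : forall sg : R, (sg = 1 \/ sg = -1) -> sg * y t <= Rabs (y t0) * exp (- a * (t - t0)) + rho / a).
  { intros sg Hsg.
    assert (K : sg * y t - rho / a <= (sg * y t0 - rho / a) * exp (- a * (t - t0))).
    { apply (Gronwall (fun s => sg * y s - rho / a) (fun s => sg * (- a * y s + r s))); [| | |lra].
      - intro s. cont1.
      - intros s Hs. eapply is_derive_eq.
        + apply (is_derive_Rminus (fun s => sg * y s) (fun _ => rho / a)); [apply is_derive_Rscal, Hd, Hs|apply is_derive_Rconst].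
        + ring.
      - intros s Hs. assert (R1 := Hr s Hs). apply Rabs_le_between in R1.
        replace (- a * (sg * y s - rho / a)) with (- a * (sg * y s) + rho) by (field; lra).
        destruct Hsg as [-> | ->]; lra. }
    assert (Q := exp_pos (- a * (t - t0))).
    assert (R3 : sg * y t0 <= Rabs (y t0)).
    { destruct Hsg as [-> | ->]; unfold Rabs; destruct Rcase_abs; lra. }
    assert (0 <= rho / a) by (apply Rmult_le_pos; [lra|left; apply Rinv_0_lt_compat; lra]).
    nra. }
  assert (P := One 1 ltac:(auto)). assert (N := One (-1) ltac:(auto)).
  apply Rabs_le. lra.
Qed.

(** The linear system for the coefficients. The bounds include the times before [t0], where the
    constructed solutions are frozen, so passing to a later initial time costs nothing. *)
Definition lin_sol (l : list ((R -> R) * (Z -> Z))) (nu t0 : R) (y : Z -> R -> R) : Prop :=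
  (forall k s, continuous (y k) s) /\
  (forall k s, t0 < s -> is_derive (y k) s (- (nu * IZR k ^ 2) * y k s + Bop l s (fun j => y j s) k)) /\
  (forall T, exists A, forall s, s <= T -> dom 5 A (fun k => y k s)).

Lemma lin_sol_later l nu t0 t1 y : t0 <= t1 -> lin_sol l nu t0 y -> lin_sol l nu t1 y.
Proof.
  intros Ht (H1 & H2 & H3). split; [|split]; auto. intros; apply H2; lra.
Qed.

Lemma lin_sol_scal l nu t0 c y : lin_sol l nu t0 y -> lin_sol l nu t0 (fun k s => c * y k s).
Proof.
  intros (H1 & H2 & H3). split; [|split].
  - intros; cont1.
  - intros k s Hs. rewrite Bop_scal.
    eapply is_derive_eq; [apply (is_derive_Rscal c (y k)), H2, Hs|]. ring.
  - intro T. destruct (H3 T) as [A HA]. exists (A * Rabs c). intros s Hs.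
    apply (dom_scal 5 A c (fun k => y k s)), HA, Hs.
Qed.

Lemma lin_sol_minus l nu t0 y z : lin_sol l nu t0 y -> lin_sol l nu t0 z ->
  lin_sol l nu t0 (fun k s => y k s - z k s).
Proof.
  intros (H1 & H2 & H3) (K1 & K2 & K3). split; [|split].
  - intros; cont1.
  - intros k s Hs. rewrite Bop_minus.
    eapply is_derive_eq; [apply (is_derive_Rminus (y k) (z k)); [apply H2, Hs|apply K2, Hs]|]. ring.
  - intro T. destruct (H3 T) as [A HA]. destruct (K3 T) as [B HB]. exists (A + B). intros s Hs.
    apply (dom_minus 5 A B (fun k => y k s) (fun k => z k s)); auto.
Qed.

(** * Solution of the coupled system by Duhamel's formula and Picard iteration *)

Definition duhamel (a : R) (r : R -> R) (y0 t0 t : R) : R :=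
  exp (- a * (t - t0)) * (y0 + RInt (fun s => exp (a * (s - t0)) * r s) t0 t).

Lemma is_derive_duhamel a r y0 t0 t : (forall s, continuous r s) ->
  is_derive (duhamel a r y0 t0) t (- a * duhamel a r y0 t0 t + r t).
Proof.
  intro Hr. unfold duhamel.
  assert (C : forall s, continuous (fun s => exp (a * (s - t0)) * r s) s).
  { intro s. assert (continuous (fun s => exp (a * (s - t0))) s) by (eapply is_derive_continuous, is_derive_exp_lin). cont1. }
  assert (D := is_derive_primitive _ t0 t C).
  eapply is_derive_eq.
  - apply (is_derive_Rmult (fun t => exp (- a * (t - t0)))
      (fun t => y0 + RInt (fun s => exp (a * (s - t0)) * r s) t0 t)); [apply is_derive_exp_lin|].
    apply (is_derive_Rplus (fun _ => y0)); [apply is_derive_Rconst|exact D].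
  -     assert (E : exp (- a * (t - t0)) * exp (a * (t - t0)) = 1).
    { rewrite <- exp_plus. replace (- a * (t - t0) + a * (t - t0)) with 0 by ring. apply exp_0. }
    set (I := RInt _ _ _). set (e1 := exp (- a * (t - t0))) in *. set (e2 := exp (a * (t - t0))) in *.
    replace (- a * e1 * (y0 + I) + e1 * (0 + e2 * r t)) with (- a * (e1 * (y0 + I)) + (e1 * e2) * r t) by Rring.
    rewrite E. Rring.
Qed.

Lemma duhamel_t0 a r y0 t0 : duhamel a r y0 t0 t0 = y0.
Proof.
  unfold duhamel. rewrite RInt_point. change (@zero R_CompleteNormedModule) with 0.
  replace (- a * (t0 - t0)) with 0 by ring. rewrite exp_0. Rring.
Qed.

Lemma ex_series_pow_fact (A x : R) : ex_series (fun n => A * (x ^ n / INR (fact n))).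
Proof.
  apply (ex_series_scal_l (V := R_NormedModule)). exists (exp x).
  apply is_series_ext with (2 := is_exp_Reals x). intro n.
  rewrite pow_n_pow. reflexivity.
Qed.

Lemma is_derive_pow_fact (A M t0 : R) n s :
  is_derive (fun s => A * ((M * (s - t0)) ^ S n / INR (fact (S n)))) s (M * (A * ((M * (s - t0)) ^ n / INR (fact n)))).
Proof.
  apply is_derive_ext with (fun s => (A / INR (fact (S n))) * (M * (s - t0)) ^ S n).
  { intro. unfold Rdiv. Rring. }
  assert (F := INR_fact_neq_0 n). assert (F' : INR (S n) <> 0) by (apply not_0_INR; lia).
  eapply is_derive_eq.
  - apply (is_derive_Rscal _ (fun s => (M * (s - t0)) ^ S n)).
    apply (is_derive_pow (fun s => M * (s - t0)) (S n) s M). auto_derive; [trivial|ring].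
  - rewrite fact_simpl, mult_INR. simpl pred. field. split; assumption.
Qed.

Section Picard.

Variables (l : list ((R -> R) * (Z -> Z))) (nu t0 : R) (g : Z -> R).
Hypothesis Hl : finite_range l.
Hypothesis Hnu : 0 < nu.

Let rate (k : Z) : R := nu * IZR k ^ 2.

Let rate_pos k : 0 <= rate k.
Proof. apply Rmult_le_pos; [lra|apply pow2_ge_0]. Qed.

(** The terms of the Picard series, not its partial sums: the free flow carries the datum at
    [n = 0], each later term starts from 0 and is driven by the preceding one, and the solution is
    their sum. *)
Fixpoint picard (n : nat) : Z -> R -> R :=
  match n with
  | O => fun k => duhamel (rate k) (fun _ => 0) (g k) t0
  | S n => fun k => duhamel (rate k) (fun s => Bop l s (fun j => picard n j s) k) 0 t0
  end.

Definition picard_source (n : nat) (k : Z) (s : R) : R :=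
  match n with O => 0 | S n => Bop l s (fun j => picard n j s) k end.

Lemma picard_continuous n k s : continuous (picard n k) s.
Proof.
  revert k s. induction n as [|n IH]; intros k s; simpl; eapply is_derive_continuous, is_derive_duhamel.
  - intro; apply continuous_const.
  - intro u. apply Bop_continuous; auto.
Qed.

Lemma picard_derive n k s : is_derive (picard n k) s (- rate k * picard n k s + picard_source n k s).
Proof.
  destruct n as [|n]; simpl.
  - apply (is_derive_duhamel (rate k) (fun _ => 0)). intro; apply continuous_const.
  - apply (is_derive_duhamel (rate k) (fun s => Bop l s (fun j => picard n j s) k)).
    intro u. apply Bop_continuous; auto. intro; apply picard_continuous.
Qed.

Let M := INR (length l) * 4 ^ 5.

Let M_pos : 0 <= M.
Proof. apply Rmult_le_pos; [apply pos_INR|apply pow_le; lra]. Qed.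

(** Since the diagonal part is dissipative, each term costs one time integration of the coupling,
    whose norm on weight five is at most [M]; this reproduces the terms of the exponential
    series. *)
Lemma picard_bound A n t : dom 5 A g -> t0 <= t ->
  dom 5 (A * ((M * (t - t0)) ^ n / INR (fact n))) (fun k => picard n k t).
Proof.
  intros Hg. revert t. induction n as [|n IH]; intros t Ht k.
  - simpl. replace (A * (1 / 1)) with A by field. eapply Rle_trans; [|apply (Hg k)].
    apply Rmult_le_compat_r; [left; apply (wt_pow_pos k 5)|].
    assert (K := dissipative_growth (rate k) t0 t (picard 0 k) (fun _ => 0) (fun _ => 0) (fun _ => 0) (rate_pos k) Ht).
    simpl in K. rewrite duhamel_t0 in K. rewrite Rminus_0_r, Rplus_0_r in K. apply K.
    + intro s. apply (picard_continuous 0 k s).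
    + intros s _. apply (picard_derive 0 k s).
    + intro s. apply (is_derive_const (V := R_NormedModule)).
    + intros; rewrite Rabs_R0; lra.
  - assert (W := wt_pow_pos k 5).
    assert (K := dissipative_growth (rate k) t0 t (picard (S n) k) (picard_source (S n) k)
      (fun s => A / wt k ^ 5 * ((M * (s - t0)) ^ S n / INR (fact (S n))))
      (fun s => M * (A / wt k ^ 5 * ((M * (s - t0)) ^ n / INR (fact n)))) (rate_pos k) Ht).
    assert (K' : Rabs (picard (S n) k t) <= A / wt k ^ 5 * ((M * (t - t0)) ^ S n / INR (fact (S n)))).
    { eapply Rle_trans; [apply K|].
      - apply picard_continuous.
      - intros; apply picard_derive.
      - intro; apply is_derive_pow_fact.
      - intros s Hs. assert (B := Bop_dom 5 _ l s _ Hl (IH s ltac:(lra)) k).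
        unfold picard_source. apply Rmult_le_reg_r with (wt k ^ 5); [exact W|].
        eapply Rle_trans; [exact B|]. apply Req_le. fold M. Rfield.
        split; [apply INR_fact_neq_0|]. assert (Q := wt_ge_1 k). lra.
      - simpl picard. rewrite duhamel_t0, Rabs_R0.
        replace (M * (t0 - t0)) with 0 by ring. rewrite pow_i by lia. apply Req_le. unfold Rdiv. ring. }
    apply Rle_trans with ((A / wt k ^ 5 * ((M * (t - t0)) ^ S n / INR (fact (S n)))) * wt k ^ 5).
    + apply Rmult_le_compat_r; [lra|exact K'].
    + apply Req_le. Rfield. split; [apply INR_fact_neq_0|]. assert (Q := wt_ge_1 k). lra.
Qed.

Lemma pow_fact_mono A n s T : 0 <= A -> t0 <= s <= T ->
  A * ((M * (s - t0)) ^ n / INR (fact n)) <= A * ((M * (T - t0)) ^ n / INR (fact n)).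
Proof.
  intros HA Hs. apply Rmult_le_compat_l; [exact HA|].
  apply Rmult_le_compat_r; [left; apply Rinv_0_lt_compat, INR_fact_lt_0|].
  apply pow_incr. split; [apply Rmult_le_pos; lra|]. apply Rmult_le_compat_l; lra.
Qed.

Lemma picard_bound_unif A n T t : dom 5 A g -> t0 <= t <= T ->
  dom 5 (A * ((M * (T - t0)) ^ n / INR (fact n))) (fun k => picard n k t).
Proof.
  intros Hg Ht. eapply dom_weaken; [apply le_n| |apply (picard_bound A n t Hg); lra].
  apply pow_fact_mono; [apply (dom_nonneg _ _ _ Hg)|exact Ht].
Qed.

Lemma picard_source_bound A n T t k : dom 5 A g -> t0 <= t <= T ->
  Rabs (picard_source n k t) <=
  match n with O => 0 | S n => M * (A * ((M * (T - t0)) ^ n / INR (fact n))) end.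
Proof.
  intros Hg Ht. destruct n as [|n]; simpl picard_source.
  - rewrite Rabs_R0. lra.
  - apply (dom_abs 5 _ (Bop l t (fun j => picard n j t)) k).
    apply Bop_dom; [exact Hl|]. apply (picard_bound_unif A n T t Hg Ht).
Qed.

Lemma lin_sol_exists A : dom 5 A g -> exists y, lin_sol l nu t0 y /\ forall k, y k t0 = g k.
Proof.
  intro Hg. assert (HA := dom_nonneg _ _ _ Hg).
  exists (fun k s => Series (fun n => picard n k (Rmax s t0))).
  assert (B : forall T n k s, t0 <= s <= T -> Rabs (picard n k s) <= A * ((M * (T - t0)) ^ n / INR (fact n))).
  { intros T n k s Hs. apply (dom_abs 5 _ (fun k => picard n k s) k), picard_bound_unif; assumption. }
  assert (Hex : forall s k, t0 <= s -> ex_series (fun n => picard n k s)).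
  { intros s k Hs. apply ex_series_dom with (1 := ex_series_pow_fact A (M * (s - t0))).
    intro n. apply B. lra. }
  split; [split; [|split]|].
  - intros k s.
    set (T := Rmax s t0 + 1).
    apply (filterlim_Series (locally s) (fun n s => picard n k (Rmax s t0)) (fun n => picard n k (Rmax s t0))
      (fun n => A * ((M * (T - t0)) ^ n / INR (fact n)))).
    + apply ex_series_pow_fact.
    + intro n. apply (continuous_comp (fun s => Rmax s t0) (picard n k)); [apply continuous_Rmax_r|apply picard_continuous].
    + exists (mkposreal 1 Rlt_0_1). intros u Hu n. apply B.
      change (Rabs (u - s) < 1) in Hu. apply Rabs_def2 in Hu. unfold T, Rmax. repeat destruct Rle_dec; lra.
    + intro n. apply B. unfold T, Rmax. destruct Rle_dec; lra.
  - intros k s Hs.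
    apply is_derive_ext_loc with (fun s => Series (fun n => picard n k s)).
    { generalize (open_gt t0 s Hs). apply filter_imp. intros u Hu. rewrite Rmax_left by (apply Rlt_le, Hu). reflexivity. }
    set (T := s + 1).
    set (b := fun n => A * ((M * (T - t0)) ^ n / INR (fact n))).
    (* Majorant of the sources: term [n] is driven by term [n - 1], and term 0 by nothing. *)
    set (bs := fun n => match n with O => 0 | S n => M * b n end).
    assert (Hb : ex_series b) by apply ex_series_pow_fact.
    assert (Hbs : ex_series bs).
    { apply ex_series_incr_1. apply (ex_series_scal_l (V := R_NormedModule)). exact Hb. }
    assert (Hsrc : forall n t, t0 < t < T -> Rabs (picard_source n k t) <= bs n).
    { intros n t Ht. apply (picard_source_bound A n T t k Hg). lra. }
    assert (Hsrc' : ex_series (fun n => picard_source n k s)).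
    { apply ex_series_dom with bs; [exact Hbs|]. intro n. apply Hsrc. unfold T. lra. }
    eapply is_derive_eq.
    + apply is_derive_Series with (f := fun n => picard n k)
        (df := fun n s => - rate k * picard n k s + picard_source n k s)
        (b := b) (b' := fun n => rate k * b n + bs n) (lo := t0) (hi := T).
      * unfold T; lra.
      * exact Hb.
      * apply (ex_series_plus (V := R_NormedModule)); [apply (ex_series_scal_l (V := R_NormedModule))|]; assumption.
      * intros n t _. apply picard_derive.
      * intros n t Ht. apply B. lra.
      * intros n t Ht. eapply Rle_trans; [apply Rabs_triang|]. apply Rplus_le_compat; [|apply Hsrc, Ht].
        rewrite Rabs_mult, Rabs_Ropp, (Rabs_pos_eq (rate k)) by apply rate_pos.
        apply Rmult_le_compat_l; [apply rate_pos|]. apply B. lra.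
    + rewrite Series_plus; [|apply (ex_series_scal_l (V := R_NormedModule)), Hex; lra|exact Hsrc'].
      rewrite Series_scal_l, (Rmax_left s t0) by lra. f_equal.
      rewrite Series_incr_1 by exact Hsrc'. simpl picard_source. rewrite Rplus_0_l.
      symmetry. apply (Bop_Series l s (fun n j => picard n j s) k). intro j. apply Hex. lra.
  - intro T.
    set (T' := Rmax T t0). exists (Series (fun n => A * ((M * (T' - t0)) ^ n / INR (fact n)))).
    intros s Hs k. rewrite Rmult_comm. rewrite <- (Rabs_pos_eq (wt k ^ 5)) by (left; apply wt_pow_pos).
    rewrite <- Rabs_mult, <- Series_scal_l.
    apply Series_dom; [apply ex_series_pow_fact|]. intro n.
    rewrite Rabs_mult, (Rabs_pos_eq (wt k ^ 5)) by (left; apply wt_pow_pos). rewrite Rmult_comm.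
    apply (picard_bound_unif A n T' (Rmax s t0) Hg). unfold T', Rmax. repeat destruct Rle_dec; lra.
  - intro k. rewrite Rmax_left by lra. rewrite Series_incr_1 by (apply Hex; lra).
    simpl picard. rewrite duhamel_t0.
    rewrite (Series_ext _ (fun n => 0 * 0)).
    + rewrite Series_scal_l. ring.
    + intro n. rewrite duhamel_t0. ring.
Qed.

End Picard.

(** The a priori bound [A] is fed back [n] times into the equation, which leaves it multiplied by
    [(M (s - t0))^n / n!]; as [n] grows it disappears, and only the initial sup norm [N] remains. *)
Lemma lin_sol_sup_bound l nu t0 y N t k : finite_range l -> 0 < nu -> lin_sol l nu t0 y ->
  (forall k, Rabs (y k t0) <= N) -> t0 <= t -> Rabs (y k t) <= N * exp (INR (length l) * (t - t0)).
Proof.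
  intros Hl Hnu (H1 & H2 & H3) HN Ht.
  set (M := INR (length l)). assert (HM : 0 <= M) by apply pos_INR.
  destruct (H3 t) as [A HA].
  assert (HA0 := dom_nonneg _ _ _ (HA t (Rle_refl t))).
  assert (P : forall n s k, t0 <= s <= t -> Rabs (y k s) <= N * exp (M * (s - t0)) + A * ((M * (s - t0)) ^ n / INR (fact n))).
  { induction n as [|n IH]; intros s j Hs.
    - simpl. assert (Q := exp_pos (M * (s - t0))). assert (0 <= N) by (eapply Rle_trans; [apply Rabs_pos|apply (HN 0%Z)]).
      assert (K := dom_abs _ _ _ j (HA s ltac:(lra))). simpl in K. nra.
    - eapply Rle_trans.
      + apply (dissipative_growth (nu * IZR j ^ 2) t0 s (y j) (fun s => Bop l s (fun j => y j s) j)
          (fun s => N * exp (M * (s - t0)) + A * ((M * (s - t0)) ^ S n / INR (fact (S n))))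
          (fun s => N * (M * exp (M * (s - t0))) + M * (A * ((M * (s - t0)) ^ n / INR (fact n))))).
        * apply Rmult_le_pos; [lra|apply pow2_ge_0].
        * lra.
        * apply H1.
        * intros u Hu. apply H2. lra.
        * intro u. apply (is_derive_Rplus (fun s => N * exp (M * (s - t0)))); [|apply is_derive_pow_fact].
          apply (is_derive_Rscal N (fun s => exp (M * (s - t0)))), is_derive_exp_lin.
        * intros u Hu.
          assert (D : dom 0 (N * exp (M * (u - t0)) + A * ((M * (u - t0)) ^ n / INR (fact n))) (fun k => y k u)).
          { apply dom_0_iff. intro i. apply IH. lra. }
          assert (B := dom_abs _ _ _ j (Bop_dom 0 _ l u _ Hl D)). fold M in B. eapply Rle_trans; [exact B|].
          apply Req_le. simpl. ring.
      + assert (HNj := HN j). replace (M * (t0 - t0)) with 0 by ring. rewrite exp_0, pow_i by lia.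
        unfold Rdiv. lra. }
  apply le_epsilon. intros eps He.
  assert (L := ex_series_lim_0 _ (ex_series_pow_fact A (M * (t - t0)))).
  apply is_lim_seq_spec in L. destruct (L (mkposreal eps He)) as [n Hn].
  specialize (Hn n (le_n n)). simpl in Hn. rewrite Rminus_0_r in Hn. apply Rabs_def2 in Hn.
  specialize (P n t k ltac:(lra)). lra.
Qed.

Lemma exp_neg_le_inv x : 0 < x -> exp (- x) <= / x.
Proof.
  intro Hx. rewrite exp_Ropp. apply Rinv_le_contravar; [exact Hx|].
  assert (K := exp_ineq1_le x). lra.
Qed.

(** After a delay [d] the old values are damped by [exp (- nu k^2 d) <= 1 / (nu k^2 d)], and the
    source is divided by [nu k^2]: both gain two orders. The [4] comes from [wt k ^ 2 <= 4 k^2] for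
    [k <> 0], and the [1 +] covers [k = 0]. *)
Lemma lin_sol_smoothing l nu t0 y m A a b d : finite_range l -> 0 < nu -> lin_sol l nu t0 y ->
  t0 <= a -> 0 < d -> (forall s, a <= s <= b -> dom m A (fun k => y k s)) ->
  forall s, a + d <= s <= b -> dom (m + 2) (A * (1 + 4 * (/ d + INR (length l) * 4 ^ m) / nu)) (fun k => y k s).
Proof.
  intros Hl Hnu (H1 & H2 & H3) Ha Hd HA s Hs k.
  assert (HA0 := dom_nonneg _ _ _ (HA s ltac:(lra))).
  set (M := INR (length l) * 4 ^ m).
  assert (HM : 0 <= M) by (apply Rmult_le_pos; [apply pos_INR|apply pow_le; lra]).
  assert (Hdi : 0 < / d) by (apply Rinv_0_lt_compat; lra).
  assert (Hni : 0 < / nu) by (apply Rinv_0_lt_compat; lra).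
  assert (Pc : 0 <= 4 * (/ d + M) / nu) by (apply Rmult_le_pos; lra).
  destruct (Z.eq_dec k 0) as [->|Hk].
  - rewrite wt_0, pow1, Rmult_1_r.
    assert (K := dom_abs _ _ _ 0%Z (HA s ltac:(lra))). simpl in K. nra.
  - assert (W := wt_pow_pos k m).
    assert (Hk1 : 1 <= Rabs (IZR k)).
    { rewrite <- abs_IZR. apply IZR_le. lia. }
    assert (Hk2 : IZR k ^ 2 = Rabs (IZR k) ^ 2) by (rewrite pow2_abs; reflexivity).
    assert (Hk3 : 1 <= IZR k ^ 2) by (rewrite Hk2; nra).
    set (r := nu * IZR k ^ 2). assert (Hr : 0 < r) by (unfold r; nra).
    assert (K : Rabs (y k s) <= Rabs (y k a) * exp (- r * (s - a)) + (M * A / wt k ^ m) / r).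
    { apply (dissipative_decay r a s (M * A / wt k ^ m) (y k) (fun s => Bop l s (fun j => y j s) k)).
      - exact Hr.
      - lra.
      - apply H1.
      - intros u Hu. apply H2. lra.
      - intros u Hu. apply (dom_div m (M * A) (Bop l u (fun j => y j u)) k).
        apply Bop_dom; [exact Hl|apply HA; lra].
      - apply Rmult_le_pos; [nra|left; apply Rinv_0_lt_compat, W]. }
    assert (K1 := dom_div _ _ _ k (HA a ltac:(lra))). cbv beta in K1.
    assert (K2 : exp (- r * (s - a)) <= / d / r).
    { replace (- r * (s - a)) with (- (r * (s - a))) by ring.
      eapply Rle_trans; [apply exp_neg_le_inv; nra|].
      unfold Rdiv. rewrite <- Rinv_mult. apply Rinv_le_contravar; nra. }
    assert (K3 : Rabs (y k s) <= A / wt k ^ m * ((/ d + M) / r)).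
    { eapply Rle_trans; [exact K|].
      replace (A / wt k ^ m * ((/ d + M) / r)) with (A / wt k ^ m * (/ d / r) + M * A / wt k ^ m / r) by (unfold Rdiv; ring).
      apply Rplus_le_compat_r. apply Rmult_le_compat; [apply Rabs_pos|left; apply exp_pos|exact K1|exact K2]. }
    assert (W2 : wt k ^ 2 <= 4 * IZR k ^ 2) by (rewrite Hk2; unfold wt; nra).
    rewrite pow_add.
    apply Rle_trans with (A / wt k ^ m * ((/ d + M) / r) * (wt k ^ m * wt k ^ 2)).
    { apply Rmult_le_compat_r; [|exact K3]. apply Rmult_le_pos; left; [exact W|apply wt_pow_pos]. }
    replace (A / wt k ^ m * ((/ d + M) / r) * (wt k ^ m * wt k ^ 2)) with (A * ((/ d + M) / r * wt k ^ 2)) by (field; lra).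
    apply Rmult_le_compat_l; [exact HA0|].
    apply Rle_trans with (4 * (/ d + M) / nu); [|fold M; lra].
    replace (4 * (/ d + M) / nu) with ((/ d + M) / r * (4 * IZR k ^ 2)) by (unfold r; field; repeat split; lra || (intro Q; rewrite Q in Hk3; lra)).
    apply Rmult_le_compat_l; [|exact W2].
    apply Rmult_le_pos; [lra|left; apply Rinv_0_lt_compat, Hr].
Qed.

(** * The linear equation in physical space *)

(** Made for functions frozen before [t0]: space derivatives exist at all times, whereas [gt] is the
    time derivative only after [t0] but is continuous everywhere. *)
Definition regular (t0 : R) (g gt gx gxx : R -> R -> R) : Prop :=
  (cont2 g /\ cont2 gt /\ cont2 gx /\ cont2 gxx) /\
  (forall t x, g t (x + 2 * PI) = g t x) /\
  (forall t x, is_derive (g t) x (gx t x)) /\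
  (forall t x, is_derive (gx t) x (gxx t x)) /\
  (forall t x, t0 < t -> is_derive (fun s => g s x) t (gt t x)).

(** From the second power on, the kink of the negative part at 0 does not affect the first
    derivative. *)
Lemma is_derive_negpart_pow (n : nat) (y : R) :
  is_derive (fun y => Rmin y 0 ^ S (S n)) y (INR (S (S n)) * Rmin y 0 ^ S n).
Proof.
  destruct (Rtotal_order y 0) as [Hy|[->|Hy]].
  - apply is_derive_ext_loc with (fun y => y ^ S (S n)).
    + generalize (open_lt 0 y Hy). apply filter_imp. intros z Hz. rewrite Rmin_left by (apply Rlt_le, Hz). reflexivity.
    + rewrite Rmin_left by lra. eapply is_derive_eq.
      * apply (is_derive_pow (fun y => y) (S (S n)) y 1). apply (is_derive_id (K := R_AbsRing)).
      * simpl pred. ring.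
  - rewrite Rmin_left by lra. rewrite pow_i by lia. rewrite Rmult_0_r.
    apply is_derive_Reals. intros eps He. exists (mkposreal (Rmin 1 eps) ltac:(apply Rmin_pos; lra)).
    intros h Hh Hlt. simpl in Hlt. rewrite Rplus_0_l, (Rmin_left 0 0) by lra.
    rewrite (pow_i (S (S n))) by lia. rewrite !Rminus_0_r.
    assert (L1 := Rmin_l 1 eps). assert (L2 := Rmin_r 1 eps).
    assert (A : Rabs (Rmin h 0) <= Rabs h).
    { unfold Rmin. destruct Rle_dec; [lra|]. rewrite Rabs_R0. apply Rabs_pos. }
    assert (P := Rabs_pos (Rmin h 0)). assert (Q : 0 < Rabs h) by (apply Rabs_pos_lt, Hh).
    assert (B : Rabs (Rmin h 0) ^ n <= 1) by (rewrite <- (pow1 n); apply pow_incr; lra).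
    assert (B' : 0 <= Rabs (Rmin h 0) ^ n) by (apply pow_le; lra).
    unfold Rdiv. rewrite Rabs_mult, Rabs_inv, <- RPow_abs. simpl pow.
    set (a := Rabs (Rmin h 0)) in *. set (b := a ^ n) in *.
    apply Rle_lt_trans with (Rabs h * (Rabs h * 1) * / Rabs h).
    + apply Rmult_le_compat_r; [left; apply Rinv_0_lt_compat, Q|].
      apply Rmult_le_compat; [exact P|apply Rmult_le_pos; lra|exact A|].
      apply Rmult_le_compat; lra.
    + replace (Rabs h * (Rabs h * 1) * / Rabs h) with (Rabs h) by (field; lra). lra.
  - apply is_derive_ext_loc with (fun y => 0).
    + generalize (open_gt 0 y Hy). apply filter_imp. intros z Hz.
      rewrite Rmin_right by (apply Rlt_le, Hz). rewrite pow_i by lia. reflexivity.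
    + rewrite Rmin_right by lra. rewrite pow_i by lia. rewrite Rmult_0_r. apply is_derive_Rconst.
Qed.

Lemma continuous_negpart y : continuous (fun y => Rmin y 0) y.
Proof.
  apply continuous_ext with (fun s => - Rmax (- s) 0).
  - intro s. unfold Rmin, Rmax. repeat destruct Rle_dec; lra.
  - apply (continuous_opp (V := R_NormedModule)).
    apply (continuous_comp (fun s => - s) (fun s => Rmax s 0)); [|apply continuous_Rmax_r].
    apply (continuous_opp (V := R_NormedModule) (fun s => s)), continuous_id.
Qed.

Lemma RInt_derive_periodic (G g : R -> R) :
  (forall x, is_derive G x (g x)) -> (forall x, continuous g x) -> (forall x, G (x + 2 * PI) = G x) ->
  RInt g 0 (2 * PI) = 0.
Proof.
  intros H1 H2 H3. rewrite (RInt_FTC G) by assumption.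
  assert (E := H3 0). rewrite Rplus_0_l in E. rewrite E. Rring.
Qed.

(* The integral of the fourth power of the negative part obeys a linear differential
   inequality. *)
Lemma minimum_principle (nu c B t0 : R) (g gt gx gxx V : R -> R -> R) :
  0 < nu -> regular t0 g gt gx gxx -> (forall t x, Rabs (V t x) <= B) ->
  (forall t x, t0 < t -> nu * gxx t x - c * gx t x + V t x * g t x <= gt t x) ->
  (forall x, 0 <= g t0 x) -> forall t x, t0 <= t -> 0 <= g t x.
Proof.
  intros Hnu ((Cg & Cgt & Cgx & Cgxx) & Hp & Hx & Hxx & Ht) HV Hineq H0 t x Htt.
  assert (Hpi := PI_RGT_0).
  (* With the fourth power the test function is a multiple of [m^3], still differentiable, as the
     integration by parts requires. *)
  set (m := fun t x => Rmin (g t x) 0).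
  assert (Cm : cont2 m) by (apply (cont2_comp (fun y => Rmin y 0)); [apply continuous_negpart|exact Cg]).
  assert (Hm : forall t x, m t x <= 0) by (intros; apply Rmin_r).
  assert (Cm4 := cont2_pow m 4 Cm). assert (Cm3 := cont2_pow m 3 Cm). assert (Cm2 := cont2_pow m 2 Cm).
  assert (Cd : cont2 (fun t x => gt t x * (4 * m t x ^ 3))) by (apply cont2_mult; [exact Cgt|apply cont2_mult; [apply cont2_const|exact Cm3]]).
  assert (J : RInt (fun x => m t x ^ 4) 0 (2 * PI) <= RInt (fun x => m t0 x ^ 4) 0 (2 * PI) * exp (4 * B * (t - t0))).
  { apply (Gronwall (fun t => RInt (fun x => m t x ^ 4) 0 (2 * PI)) (fun t => RInt (fun x => gt t x * (4 * m t x ^ 3)) 0 (2 * PI))).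
    - intro s. apply (continuous_RInt_param (fun t x => m t x ^ 4)); [lra|exact Cm4].
    - intros s Hs. apply (is_derive_RInt_time (fun t x => m t x ^ 4) (fun t x => gt t x * (4 * m t x ^ 3)) 0 (2 * PI) t0); [exact Cm4|exact Cd|lra|].
      intros u z Hu. eapply is_derive_eq.
      + apply (is_derive_Rcomp (fun y => Rmin y 0 ^ 4) (fun s => g s z)); [apply Ht, Hu|apply is_derive_negpart_pow].
      + simpl INR. fold (m u z). Rring.
    - intros s Hs.
      (* The integration by parts is stated as the vanishing integral of an exact derivative; added
         to the right-hand side, it reduces the inequality to a pointwise one. *)
      assert (IBP : RInt (fun x => nu * (12 * m s x ^ 2 * gx s x ^ 2 + 4 * m s x ^ 3 * gxx s x) - c * (4 * m s x ^ 3 * gx s x)) 0 (2 * PI) = 0).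
      { apply RInt_derive_periodic with (fun x => nu * (4 * m s x ^ 3 * gx s x) - c * m s x ^ 4).
        - intro z.
          assert (D4 : is_derive (fun x => m s x ^ 4) z (4 * m s z ^ 3 * gx s z)).
          { eapply is_derive_eq; [apply (is_derive_Rcomp (fun y => Rmin y 0 ^ 4) (g s)); [apply Hx|apply is_derive_negpart_pow]|].
            simpl INR. fold (m s z). Rring. }
          assert (D3 : is_derive (fun x => m s x ^ 3) z (3 * m s z ^ 2 * gx s z)).
          { eapply is_derive_eq; [apply (is_derive_Rcomp (fun y => Rmin y 0 ^ 3) (g s)); [apply Hx|apply is_derive_negpart_pow]|].
            simpl INR. fold (m s z). Rring. }
          eapply is_derive_eq.
          + apply (is_derive_Rminus (fun x => nu * (4 * m s x ^ 3 * gx s x)) (fun x => c * m s x ^ 4)).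
            * apply is_derive_Rscal. apply (is_derive_Rmult (fun x => 4 * m s x ^ 3) (gx s)); [apply is_derive_Rscal, D3|apply Hxx].
            * apply is_derive_Rscal, D4.
          + Rring.
        - intro z. apply (cont2_slice_x (fun s x => nu * (12 * m s x ^ 2 * gx s x ^ 2 + 4 * m s x ^ 3 * gxx s x) - c * (4 * m s x ^ 3 * gx s x)) s).
          cont2_tac.
        - intro z. unfold m. rewrite Hp, (derive_periodic (g s) (gx s)); [reflexivity|apply Hx|apply Hp]. }
      assert (Ca : forall z, continuous (fun x => nu * (12 * m s x ^ 2 * gx s x ^ 2 + 4 * m s x ^ 3 * gxx s x) - c * (4 * m s x ^ 3 * gx s x)) z).
      { intro z. apply (cont2_slice_x (fun s x => nu * (12 * m s x ^ 2 * gx s x ^ 2 + 4 * m s x ^ 3 * gxx s x) - c * (4 * m s x ^ 3 * gx s x)) s).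
        cont2_tac. }
      assert (Cb : forall z, continuous (fun x => m s x ^ 4) z) by (intro; apply (cont2_slice_x (fun t x => m t x ^ 4)), Cm4).
      rewrite <- RInt_Rmult_l by exact Cb.
      eapply Rle_trans; [|apply Req_le; etransitivity; [|apply Rplus_0_l]; apply Rplus_eq_compat_r, IBP].
      rewrite <- RInt_Rplus; [|exact Ca|intro; cont1].
      apply RInt_mono; [lra|intro; apply (cont2_slice_x (fun t x => gt t x * (4 * m t x ^ 3))), Cd|intro; cont1|].
      intros z _.
      assert (I := Hineq s z ltac:(lra)). assert (M := Hm s z).
      assert (Mg : m s z ^ 3 * g s z = m s z ^ 4).
      { unfold m, Rmin. destruct Rle_dec; ring. }
      assert (M3 : m s z ^ 3 <= 0).
      { replace (m s z ^ 3) with (m s z ^ 2 * m s z) by ring. assert (Q := pow2_ge_0 (m s z)). nra. }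
      assert (HVs := HV s z). apply Rabs_le_between in HVs.
      assert (M4 : 0 <= m s z ^ 4) by (replace (m s z ^ 4) with ((m s z ^ 2) ^ 2) by ring; apply pow2_ge_0).
      assert (S1 : m s z ^ 3 * gt s z <= m s z ^ 3 * (nu * gxx s z - c * gx s z + V s z * g s z)) by nra.
      assert (S2 : m s z ^ 3 * (V s z * g s z) <= B * m s z ^ 4).
      { replace (m s z ^ 3 * (V s z * g s z)) with (V s z * (m s z ^ 3 * g s z)) by ring. rewrite Mg. nra. }
      assert (S3 : 0 <= nu * (12 * m s z ^ 2 * gx s z ^ 2)).
      { apply Rmult_le_pos; [lra|]. apply Rmult_le_pos; [|apply pow2_ge_0]. assert (Q := pow2_ge_0 (m s z)). lra. }
      replace (m s z ^ 3 * (nu * gxx s z - c * gx s z + V s z * g s z)) with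
        (m s z ^ 3 * (nu * gxx s z - c * gx s z) + m s z ^ 3 * (V s z * g s z)) in S1 by ring.
      nra.
    - exact Htt. }
  rewrite (RInt_eq (fun x => m t0 x ^ 4) (fun _ => 0)) in J.
  2:{ intro z. unfold m. rewrite Rmin_right by apply H0. simpl. Rring. }
  rewrite RInt_constR, Rmult_0_r, Rmult_0_l in J.
  apply (periodic_forall (g t) (fun y => 0 <= y) (Hp t)).
  intros z Hz.
  assert (Z : m t z ^ 4 = 0).
  { apply (RInt_zero_pointwise (fun x => m t x ^ 4) 0 (2 * PI)); auto; [lra| |].
    - intro; apply (cont2_slice_x (fun t x => m t x ^ 4)), Cm4.
    - intros y _. replace (m t y ^ 4) with ((m t y ^ 2) ^ 2) by ring. apply pow2_ge_0. }
  apply Rnot_lt_le. intro Hneg. unfold m in Z. rewrite Rmin_left in Z by lra.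
  apply (pow_nonzero (g t z) 4) in Z; [exact Z|lra].
Qed.

(** * The potential as a coupling of Fourier coefficients *)

(** Multiplication by [P cos (j z) + Q sin (j z)] on coefficients, as read off from
    [synth_shift_cos] and [synth_shift_sin]. *)
Definition freq_block (j : Z) (P Q : R -> R) : list ((R -> R) * (Z -> Z)) :=
  (fun t => / 2 * P t, fun k => (k - j)%Z) :: (fun t => / 2 * P t, fun k => (k + j)%Z) ::
  (fun t => / 2 * Q t, fun k => (j - k)%Z) :: (fun t => - / 2 * Q t, fun k => (- j - k)%Z) :: nil.

Lemma freq_block_finite_range j P Q : (Z.abs j <= 3)%Z ->
  (forall t, continuous P t) -> (forall t, continuous Q t) ->
  (forall t, Rabs (P t) <= 2) -> (forall t, Rabs (Q t) <= 2) -> finite_range (freq_block j P Q).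
Proof.
  intros Hj CP CQ HP HQ.
  assert (Hw : forall i, (Z.abs i <= 3)%Z -> wt i <= 4).
  { intros i Hi. unfold wt. rewrite <- abs_IZR. apply IZR_le in Hi. lra. }
  assert (W : forall i k, (Z.abs i <= 3)%Z -> wt k <= 4 * wt (k + i)).
  { intros i k Hi. eapply Rle_trans; [apply (wt_triangle i)|].
    apply Rmult_le_compat_r; [assert (Q1 := wt_ge_1 (k + i)); lra|apply Hw, Hi]. }
  unfold freq_block, finite_range. repeat apply List.Forall_cons; [..|apply List.Forall_nil]; simpl;
    (split; [intro; cont1|split; [intro t; rewrite Rabs_mult|intro k]]).
  - rewrite (Rabs_pos_eq (/ 2)) by lra. specialize (HP t). lra.
  - apply (W (- j)%Z). lia.
  - rewrite (Rabs_pos_eq (/ 2)) by lra. specialize (HP t). lra.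
  - apply (W j). lia.
  - rewrite (Rabs_pos_eq (/ 2)) by lra. specialize (HQ t). lra.
  - rewrite <- (wt_opp (j - k)). replace (- (j - k))%Z with (k + - j)%Z by ring. apply W. lia.
  - rewrite Rabs_left by lra. specialize (HQ t). lra.
  - rewrite <- (wt_opp (- j - k)). replace (- (- j - k))%Z with (k + j)%Z by ring. apply W. lia.
Qed.

Lemma synth_freq_block j P Q t y z A : dom 2 A y ->
  synth (Bop (freq_block j P Q) t y) z =
  (P t * cos (IZR j * z) + Q t * sin (IZR j * z)) * synth y z /\
  exists B, dom 2 B (Bop (freq_block j P Q) t y).
Proof.
  intro H.
  assert (D1 := dom_shift _ _ _ (- j) H : dom 2 _ (fun k => y (k - j)%Z)).
  assert (D2 := dom_shift _ _ _ j H).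
  assert (D3 : dom 2 (A * wt j ^ 2) (fun k => y (j - k)%Z)).
  { intro k. assert (K := dom_opp _ _ _ (dom_shift _ _ _ j H) k). cbv beta in K.
    replace (- k + j)%Z with (j - k)%Z in K by ring. exact K. }
  assert (D4 : dom 2 (A * wt (- j) ^ 2) (fun k => y (- j - k)%Z)).
  { intro k. assert (K := dom_opp _ _ _ (dom_shift _ _ _ (- j) H) k). cbv beta in K.
    replace (- k + - j)%Z with (- j - k)%Z in K by ring. exact K. }
  assert (E1 := dom_scal _ _ (/ 2 * P t) _ (dom_plus _ _ _ _ _ D1 D2)).
  assert (E2 := dom_scal _ _ (/ 2 * Q t) _ (dom_minus _ _ _ _ _ D3 D4)).
  assert (EE : forall k, Bop (freq_block j P Q) t y k =
    / 2 * P t * (y (k - j)%Z + y (k + j)%Z) + / 2 * Q t * (y (j - k)%Z - y (- j - k)%Z)).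
  { intro k. simpl. ring. }
  split.
  - rewrite (synth_ext _ _ z EE).
    rewrite (synth_plus _ _ _ _ _ E1 E2), !synth_scal, (synth_plus _ _ _ _ _ D1 D2), (synth_minus _ _ _ _ _ D3 D4).
    rewrite Rmult_plus_distr_r.
    replace (P t * cos (IZR j * z) * synth y z) with (P t * (synth y z * cos (IZR j * z))) by ring.
    replace (Q t * sin (IZR j * z) * synth y z) with (Q t * (synth y z * sin (IZR j * z))) by ring.
    rewrite (synth_shift_cos _ _ j z H), (synth_shift_sin _ _ j z H). ring.
  - eexists. intro k. rewrite EE. revert k. exact (dom_plus _ _ _ _ _ E1 E2).
Qed.

Lemma Bop_app l1 l2 t y k : Bop (l1 ++ l2) t y k = Bop l1 t y k + Bop l2 t y k.
Proof. induction l1 as [|[c s] l1 IH]; simpl; [ring|]. rewrite IH. ring. Qed.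

(** [rot_cos] and [rot_sin] are the coefficients of the potential in the moving variable, by the
    addition formulas for [j (z + c t)]. *)
Definition rot_cos (c : R) (p q : nat -> R -> R) (j : nat) (t : R) : R :=
  p j t * cos (INR j * (c * t)) + q j t * sin (INR j * (c * t)).

Definition rot_sin (c : R) (p q : nat -> R -> R) (j : nat) (t : R) : R :=
  - p j t * sin (INR j * (c * t)) + q j t * cos (INR j * (c * t)).

Definition pot_term (p q : nat -> R -> R) (j : nat) (t x : R) : R :=
  p j t * cos (INR j * x) + q j t * sin (INR j * x).

Definition pot (p q : nat -> R -> R) (t x : R) : R :=
  pot_term p q 1 t x + pot_term p q 2 t x + pot_term p q 3 t x.

Definition pot_term_x (p q : nat -> R -> R) (j : nat) (t x : R) : R :=
  INR j * (- p j t * sin (INR j * x) + q j t * cos (INR j * x)).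

Definition pot_x (p q : nat -> R -> R) (t x : R) : R :=
  pot_term_x p q 1 t x + pot_term_x p q 2 t x + pot_term_x p q 3 t x.

(* Multiplication by [pot p q] in the frame [z = x - c t]. *)
Definition coupling (c : R) (p q : nat -> R -> R) : list ((R -> R) * (Z -> Z)) :=
  freq_block 1 (rot_cos c p q 1) (rot_sin c p q 1) ++
  (freq_block 2 (rot_cos c p q 2) (rot_sin c p q 2) ++
   freq_block 3 (rot_cos c p q 3) (rot_sin c p q 3)).

Definition good_coefs (p q : nat -> R -> R) : Prop :=
  forall j, (1 <= j <= 3)%nat ->
    (forall t, continuous (p j) t) /\ (forall t, continuous (q j) t) /\
    (forall t, Rabs (p j t) <= 1) /\ (forall t, Rabs (q j t) <= 1).

Lemma continuous_cos_lin a t : continuous (fun t => cos (a * t)) t.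
Proof. apply (ex_derive_continuous (V := R_NormedModule)). auto_derive. trivial. Qed.

Lemma continuous_sin_lin a t : continuous (fun t => sin (a * t)) t.
Proof. apply (ex_derive_continuous (V := R_NormedModule)). auto_derive. trivial. Qed.

Lemma coupling_finite_range c p q : good_coefs p q -> finite_range (coupling c p q).
Proof.
  intro H.
  assert (K : forall j, (1 <= j <= 3)%nat -> finite_range (freq_block (Z.of_nat j) (rot_cos c p q j) (rot_sin c p q j))).
  { intros j Hj. destruct (H j Hj) as (Hp & Hq & Bp & Bq).
    assert (Cc : forall t, continuous (fun t => cos (INR j * (c * t))) t).
    { intro t. apply continuous_ext with (fun t => cos (INR j * c * t)); [intro; f_equal; ring|apply continuous_cos_lin]. }
    assert (Cs : forall t, continuous (fun t => sin (INR j * (c * t))) t).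
    { intro t. apply continuous_ext with (fun t => sin (INR j * c * t)); [intro; f_equal; ring|apply continuous_sin_lin]. }
    assert (B : forall a b u, Rabs a <= 1 -> Rabs b <= 1 -> Rabs (a * cos u + b * sin u) <= 2).
    { intros a b u Ha Hb. eapply Rle_trans; [apply Rabs_triang|]. rewrite !Rabs_mult.
      assert (A1 : Rabs (cos u) <= 1) by (apply Rabs_le, COS_bound).
      assert (A2 : Rabs (sin u) <= 1) by (apply Rabs_le, SIN_bound).
      assert (P1 := Rabs_pos a). assert (P2 := Rabs_pos b). assert (P3 := Rabs_pos (cos u)). assert (P4 := Rabs_pos (sin u)). nra. }
    apply freq_block_finite_range.
    - lia.
    - intro t. unfold rot_cos. cont1.
    - intro t. unfold rot_sin. cont1.
    - intro t. apply B; auto.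
    - intro t. unfold rot_sin. rewrite Rplus_comm. apply B; [auto|rewrite Rabs_Ropp; auto]. }
  unfold coupling, finite_range. apply List.Forall_app. split; [apply (K 1%nat); lia|].
  apply List.Forall_app. split; [apply (K 2%nat)|apply (K 3%nat)]; lia.
Qed.

Lemma synth_coupling c p q t x y A : dom 2 A y ->
  synth (Bop (coupling c p q) t y) (x - c * t) = pot p q t x * synth y (x - c * t).
Proof.
  intro H. set (z := x - c * t).
  destruct (synth_freq_block 1 (rot_cos c p q 1) (rot_sin c p q 1) t y z A H) as [E1 [B1 D1]].
  destruct (synth_freq_block 2 (rot_cos c p q 2) (rot_sin c p q 2) t y z A H) as [E2 [B2 D2]].
  destruct (synth_freq_block 3 (rot_cos c p q 3) (rot_sin c p q 3) t y z A H) as [E3 [B3 D3]].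
  unfold coupling.
  rewrite (synth_ext _ _ z (Bop_app _ _ t y)).
  assert (D23 : dom 2 (B2 + B3) (Bop (freq_block 2 (rot_cos c p q 2) (rot_sin c p q 2) ++ freq_block 3 (rot_cos c p q 3) (rot_sin c p q 3)) t y)).
  { intro k. rewrite Bop_app. revert k. apply dom_plus; assumption. }
  rewrite (synth_plus _ _ _ _ _ D1 D23), (synth_ext _ _ z (Bop_app _ _ t y)), (synth_plus _ _ _ _ _ D2 D3).
  rewrite E1, E2, E3.
  assert (T : forall j, rot_cos c p q j t * cos (INR j * z) + rot_sin c p q j t * sin (INR j * z) = pot_term p q j t x).
  { intro j. unfold rot_cos, rot_sin, pot_term. replace (INR j * x) with (INR j * z + INR j * (c * t)) by (unfold z; ring).
    rewrite cos_plus, sin_plus. ring. }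
  unfold pot. rewrite <- !T. simpl INR. replace (1 + 1) with 2 by ring. replace (2 + 1) with 3 by ring. ring.
Qed.

Lemma is_derive_pot p q t x : is_derive (pot p q t) x (pot_x p q t x).
Proof.
  assert (K : forall j, is_derive (pot_term p q j t) x (pot_term_x p q j t x)).
  { intro j. unfold pot_term, pot_term_x. auto_derive; [trivial|ring]. }
  unfold pot, pot_x. apply (is_derive_Rplus (fun x => pot_term p q 1 t x + pot_term p q 2 t x)); [|apply K].
  apply (is_derive_Rplus (pot_term p q 1 t)); apply K.
Qed.

Lemma cont2_pot p q : good_coefs p q -> cont2 (pot p q) /\ cont2 (pot_x p q).
Proof.
  intro H.
  assert (K : forall j, (1 <= j <= 3)%nat -> cont2 (pot_term p q j) /\ cont2 (pot_term_x p q j)).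
  { intros j Hj. destruct (H j Hj) as (Hp & Hq & _).
    assert (A1 := cont2_fst (p j) Hp). assert (A2 := cont2_fst (q j) Hq).
    assert (A3 := cont2_snd (fun x => cos (INR j * x)) (continuous_cos_lin (INR j))).
    assert (A4 := cont2_snd (fun x => sin (INR j * x)) (continuous_sin_lin (INR j))).
    split; unfold pot_term, pot_term_x;
    cont2_tac. }
  split; unfold pot, pot_x; (apply cont2_plus; [apply cont2_plus|]); apply K; lia.
Qed.

Lemma pot_bound p q t x : good_coefs p q -> Rabs (pot p q t x) <= 6.
Proof.
  intro H.
  assert (K : forall j, (1 <= j <= 3)%nat -> Rabs (pot_term p q j t x) <= 2).
  { intros j Hj. destruct (H j Hj) as (_ & _ & Hp & Hq). specialize (Hp t). specialize (Hq t).
    unfold pot_term. eapply Rle_trans; [apply Rabs_triang|]. rewrite !Rabs_mult.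
    assert (A1 : Rabs (cos (INR j * x)) <= 1) by (apply Rabs_le, COS_bound).
    assert (A2 : Rabs (sin (INR j * x)) <= 1) by (apply Rabs_le, SIN_bound).
    assert (P1 := Rabs_pos (p j t)). assert (P2 := Rabs_pos (q j t)).
    assert (P3 := Rabs_pos (cos (INR j * x))). assert (P4 := Rabs_pos (sin (INR j * x))). nra. }
  unfold pot. assert (K1 := K 1%nat ltac:(lia)). assert (K2 := K 2%nat ltac:(lia)). assert (K3 := K 3%nat ltac:(lia)).
  eapply Rle_trans; [apply Rabs_triang|]. eapply Rle_trans; [apply Rplus_le_compat_r, Rabs_triang|]. lra.
Qed.

(** * The solution of the linear equation and its derivatives *)

Definition diter (j : nat) (y : Z -> R) : Z -> R := Nat.iter j dseq y.

Lemma diter_S j y k : diter (S j) y k = - IZR k * diter j y (- k)%Z.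
Proof. reflexivity. Qed.

Lemma diter_dom j r A y : dom (j + r) A y -> dom r A (diter j y).
Proof.
  revert r. induction j as [|j IH]; intros r H; [exact H|].
  apply dom_dseq. apply IH. replace (j + S r)%nat with (S j + r)%nat by lia. exact H.
Qed.

Lemma diter_ext j y z k : (forall k, y k = z k) -> diter j y k = diter j z k.
Proof.
  intro H. revert k. induction j as [|j IH]; intro k; [apply H|].
  rewrite !diter_S, IH. reflexivity.
Qed.

Lemma diter_lin j a y z k : diter j (fun k => a * y k + z k) k = a * diter j y k + diter j z k.
Proof.
  revert k. induction j as [|j IH]; intro k; [reflexivity|].
  rewrite !diter_S, IH. ring.
Qed.

Lemma diter_filterlim {T : Type} (F : (T -> Prop) -> Prop) {FF : Filter F} j (y : Z -> T -> R) (l : Z -> R) k :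
  (forall k, filterlim (y k) F (locally (l k))) ->
  filterlim (fun s => diter j (fun k => y k s) k) F (locally (diter j l k)).
Proof.
  intro H. revert k. induction j as [|j IH]; intro k; [apply H|].
  apply (filterlim_comp_2 (fun _ => - IZR k) (fun s => diter j (fun k => y k s) (- k)%Z) Rmult
    (G := locally (- IZR k)) (H := locally (diter j l (- k)%Z))).
  - apply filterlim_const.
  - apply IH.
  - apply (filterlim_mult (K := R_AbsRing)).
Qed.

Lemma diter_is_derive j (y : Z -> R -> R) (y' : Z -> R) s k :
  (forall k, is_derive (y k) s (y' k)) ->
  is_derive (fun s => diter j (fun k => y k s) k) s (diter j y' k).
Proof.
  intro H. revert k. induction j as [|j IH]; intro k; [apply H|].
  apply (is_derive_Rscal (- IZR k) (fun s => diter j (fun k => y k s) (- k)%Z)), IH.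
Qed.

(* The [j]-th space derivative of the solution with Fourier coefficients [y], frozen for [t <= t0]. *)
Definition phi (c t0 : R) (y : Z -> R -> R) (j : nat) (t x : R) : R :=
  synth (diter j (fun k => y k (Rmax t t0))) (x - c * Rmax t t0).

Section Phi.

Variables (nu c t0 : R) (p q : nat -> R -> R) (y : Z -> R -> R).
Hypothesis Hnu : 0 < nu.
Hypothesis Hpq : good_coefs p q.
Hypothesis Hy : lin_sol (coupling c p q) nu t0 y.

Let V := pot p q.

Lemma phi_cont2 j : (j <= 3)%nat -> cont2 (phi c t0 y j).
Proof.
  intros Hj [t x].
  destruct Hy as (H1 & H2 & H3). destruct (H3 (Rmax t t0 + 1)) as [A HA].
  assert (HA' : forall s, s <= Rmax t t0 + 1 -> dom 2 A (diter j (fun k => y k s))).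
  { intros s Hs. apply diter_dom. apply (dom_weaken 5 _ A); [lia|lra|apply HA, Hs]. }
  assert (Cm : continuous (fun q : R * R => Rmax (fst q) t0) (t, x)).
  { apply (continuous_comp fst (fun t => Rmax t t0)); [apply continuous_fst|apply continuous_Rmax_r]. }
  apply (filterlim_synth (locally (t, x)) (fun k (q : R * R) => diter j (fun k => y k (Rmax (fst q) t0)) k)
    (fun q : R * R => snd q - c * Rmax (fst q) t0) _ _ A).
  - intro k. apply (diter_filterlim (locally (t, x)) j (fun k (q : R * R) => y k (Rmax (fst q) t0)) (fun k => y k (Rmax t t0))).
    intro i.
    apply (continuous_comp (fun q : R * R => Rmax (fst q) t0) (y i)); [exact Cm|apply H1].
  - apply (continuous_minus (V := R_NormedModule) (fun q : R * R => snd q) (fun q => c * Rmax (fst q) t0)).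
    + apply continuous_snd.
    + apply (continuous_mult (K := R_AbsRing) (fun _ => c)); [apply continuous_const|exact Cm].
  - exists (mkposreal 1 Rlt_0_1). intros [t' x'] [Hb _]. apply HA'. simpl in Hb |- *.
    change (Rabs (t' - t) < 1) in Hb. apply Rabs_def2 in Hb. unfold Rmax. repeat destruct Rle_dec; lra.
  - apply HA'. simpl. lra.
Qed.

Lemma phi_period j t x : phi c t0 y j t (x + 2 * PI) = phi c t0 y j t x.
Proof.
  unfold phi. replace (x + 2 * PI - c * Rmax t t0) with (x - c * Rmax t t0 + 2 * PI) by ring.
  apply synth_period.
Qed.

Lemma phi_derive_x j t x : (j <= 2)%nat -> is_derive (phi c t0 y j t) x (phi c t0 y (S j) t x).
Proof.
  intro Hj. destruct Hy as (H1 & H2 & H3). destruct (H3 (Rmax t t0)) as [A HA].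
  unfold phi. eapply is_derive_eq.
  - apply (is_derive_Rcomp (synth (diter j (fun k => y k (Rmax t t0)))) (fun x => x - c * Rmax t t0)).
    + auto_derive; [trivial|reflexivity].
    + apply (is_derive_synth A). apply diter_dom. apply (dom_weaken 5 _ A); [lia|lra|apply HA; lra].
  - rewrite Rmult_1_l. reflexivity.
Qed.

(** The time derivative of the coefficients contains two space derivatives and keeps order three;
    summation takes two, so at most one further space derivative is affordable. The term with [c]
    comes from the motion of the frame. *)
Lemma phi_derive_t_aux j t x : (j <= 1)%nat -> t0 < t ->
  is_derive (fun s => phi c t0 y j s x) t
    (nu * phi c t0 y (S (S j)) t x + synth (diter j (Bop (coupling c p q) t (fun k => y k t))) (x - c * t)
     - c * phi c t0 y (S j) t x).
Proof.
  intros Hj Ht. assert (Hl := coupling_finite_range c p q Hpq).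
  destruct Hy as (H1 & H2 & H3). destruct (H3 (t + 1)) as [A HA].
  set (y' := fun k s => nu * dseq (dseq (fun k => y k s)) k + Bop (coupling c p q) s (fun k => y k s) k).
  assert (Hmax : forall s, t0 < s -> Rmax s t0 = s) by (intros; apply Rmax_left; lra).
  apply is_derive_ext_loc with (fun s => synth (fun k => diter j (fun k => y k s) k) (x - c * s)).
  { generalize (open_gt t0 t Ht). apply filter_imp. intros s Hs. unfold phi. rewrite (Hmax s Hs). reflexivity. }
  set (M := A * Rabs nu + INR (length (coupling c p q)) * 4 ^ 3 * A).
  assert (Dy' : forall s, s < t + 1 -> dom 3 M (fun k => y' k s)).
  { intros s Hs. apply dom_plus.
    - apply dom_scal. apply dom_dseq, dom_dseq. apply HA. lra.
    - apply Bop_dom; [exact Hl|]. apply (dom_weaken 5 _ A); [lia|lra|apply HA; lra]. }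
  eapply is_derive_eq.
  - apply (is_derive_synth_time (fun k s => diter j (fun k => y k s) k) (fun k s => diter j (fun k => y' k s) k) c x A M t0 (t + 1) t).
    + lra.
    + intros k s Hs. apply diter_is_derive. intro i. eapply is_derive_eq; [apply H2; lra|].
      unfold y'. rewrite dseq_dseq. ring.
    + intros s Hs. apply diter_dom. apply (dom_weaken 5 _ A); [lia|lra|apply HA; lra].
    + intros s Hs. apply diter_dom. apply (dom_weaken 3 _ M); [lia|lra|apply Dy'; lra].
  - unfold phi. rewrite (Hmax t Ht).
    assert (E : synth (fun k => diter j (fun k => y' k t) k) (x - c * t) =
      nu * synth (diter (S (S j)) (fun k => y k t)) (x - c * t)
      + synth (diter j (Bop (coupling c p q) t (fun k => y k t))) (x - c * t)).
    { rewrite (synth_ext _ (fun k => nu * diter j (dseq (dseq (fun k => y k t))) k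
        + diter j (Bop (coupling c p q) t (fun k => y k t)) k)) by (intro; apply diter_lin).
      rewrite (synth_plus (A * Rabs nu) (INR (length (coupling c p q)) * 4 ^ (j + 2) * A)).
      - rewrite synth_scal. unfold diter. rewrite !Nat.iter_succ_r. reflexivity.
      - apply dom_scal. apply diter_dom. apply dom_dseq, dom_dseq. apply (dom_weaken 5 _ A); [lia|lra|apply HA; lra].
      - apply diter_dom, Bop_dom; [exact Hl|]. apply (dom_weaken 5 _ A); [lia|lra|apply HA; lra]. }
    rewrite E. reflexivity.
Qed.

Definition phi_t (t x : R) : R :=
  nu * phi c t0 y 2 t x - c * phi c t0 y 1 t x + V (Rmax t t0) x * phi c t0 y 0 t x.

Definition phi_xt (t x : R) : R :=
  nu * phi c t0 y 3 t x - c * phi c t0 y 2 t x +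
  (pot_x p q (Rmax t t0) x * phi c t0 y 0 t x + V (Rmax t t0) x * phi c t0 y 1 t x).

Lemma phi_derive_t t x : t0 < t -> is_derive (fun s => phi c t0 y 0 s x) t (phi_t t x).
Proof.
  intro Ht. eapply is_derive_eq; [apply (phi_derive_t_aux 0 t x); [lia|exact Ht]|].
  destruct Hy as (H1 & H2 & H3). destruct (H3 t) as [A HA].
  unfold phi_t. change (diter 0 (Bop (coupling c p q) t (fun k => y k t))) with (Bop (coupling c p q) t (fun k => y k t)).
  rewrite (synth_coupling c p q t x _ A) by (apply (dom_weaken 5 _ A); [lia|lra|apply HA; lra]).
  assert (E : phi c t0 y 0 t x = synth (fun k => y k t) (x - c * t)) by (unfold phi; rewrite Rmax_left by lra; reflexivity).
  rewrite E, Rmax_left by lra. unfold V. ring.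
Qed.

Lemma phi_derive_xt t x : t0 < t -> is_derive (fun s => phi c t0 y 1 s x) t (phi_xt t x).
Proof.
  intro Ht. eapply is_derive_eq; [apply (phi_derive_t_aux 1 t x); [lia|exact Ht]|].
  assert (Hl := coupling_finite_range c p q Hpq).
  destruct Hy as (H1 & H2 & H3). destruct (H3 t) as [A HA].
  assert (DA : dom 2 A (fun k => y k t)) by (apply (dom_weaken 5 _ A); [lia|lra|apply HA; lra]).
  (* The series of the coupling and the product [V phi] are one function of [x], so their
     derivatives agree. *)
  assert (E : synth (dseq (Bop (coupling c p q) t (fun k => y k t))) (x - c * t) =
    pot_x p q t x * phi c t0 y 0 t x + V t x * phi c t0 y 1 t x).
  { assert (D1 : is_derive (fun x => synth (Bop (coupling c p q) t (fun k => y k t)) (x - c * t)) x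
      (1 * synth (dseq (Bop (coupling c p q) t (fun k => y k t))) (x - c * t))).
    { apply (is_derive_Rcomp (synth (Bop (coupling c p q) t (fun k => y k t))) (fun x => x - c * t)).
      - auto_derive; [trivial|reflexivity].
      - apply (is_derive_synth (INR (length (coupling c p q)) * 4 ^ 3 * A)). apply Bop_dom; [exact Hl|].
        apply (dom_weaken 5 _ A); [lia|lra|apply HA; lra]. }
    assert (D2 : is_derive (fun x => synth (Bop (coupling c p q) t (fun k => y k t)) (x - c * t)) x
      (pot_x p q t x * phi c t0 y 0 t x + V t x * phi c t0 y 1 t x)).
    { apply is_derive_ext with (fun x => V t x * phi c t0 y 0 t x).
      - intro z. rewrite (synth_coupling c p q t z _ A DA). unfold phi. rewrite Rmax_left by lra. reflexivity.
      - apply is_derive_Rmult; [apply is_derive_pot|apply (phi_derive_x 0); lia]. }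
    apply is_derive_unique in D1. apply is_derive_unique in D2. lra. }
  unfold phi_xt. change (diter 1 (Bop (coupling c p q) t (fun k => y k t))) with (dseq (Bop (coupling c p q) t (fun k => y k t))).
  rewrite E, Rmax_left by lra. ring.
Qed.

Lemma cont2_Rmax_pot : cont2 (fun t x => V (Rmax t t0) x) /\ cont2 (fun t x => pot_x p q (Rmax t t0) x).
Proof.
  destruct (cont2_pot p q Hpq) as [C1 C2].
  assert (Cm : cont2 (fun t _ => Rmax t t0)) by (apply (cont2_fst (fun t => Rmax t t0)); intro; apply continuous_Rmax_r).
  assert (Ci : cont2 (fun _ x => x)) by (apply (cont2_snd (fun x => x)); intro; apply continuous_id).
  split; [apply (cont2_reparam V)|apply (cont2_reparam (pot_x p q))]; assumption.
Qed.

Lemma phi_regular : regular t0 (phi c t0 y 0) phi_t (phi c t0 y 1) (phi c t0 y 2).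
Proof.
  destruct cont2_Rmax_pot as [C1 C2].
  assert (C := phi_cont2).
  split; [repeat split|split; [|split; [|split]]].
  - apply C; lia.
  - unfold phi_t.
    cont2_tac; apply C; lia.
  - apply C; lia.
  - apply C; lia.
  - intros; apply phi_period.
  - intros; apply phi_derive_x; lia.
  - intros; apply phi_derive_x; lia.
  - intros; apply phi_derive_t; assumption.
Qed.

Lemma phi_x_regular : regular t0 (phi c t0 y 1) phi_xt (phi c t0 y 2) (phi c t0 y 3).
Proof.
  destruct cont2_Rmax_pot as [C1 C2].
  assert (C := phi_cont2).
  split; [repeat split|split; [|split; [|split]]].
  - apply C; lia.
  - unfold phi_xt.
    cont2_tac; apply C; lia.
  - apply C; lia.
  - apply C; lia.
  - intros; apply phi_period.
  - intros; apply phi_derive_x; lia.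
  - intros; apply phi_derive_x; lia.
  - intros; apply phi_derive_xt; assumption.
Qed.

(* [m exp (- 6 (t - t0))] is a subsolution since [|V| <= 6]. *)
Lemma phi_lower_bound m : 0 <= m -> (forall x, m <= phi c t0 y 0 t0 x) ->
  forall t x, t0 <= t -> m * exp (- 6 * (t - t0)) <= phi c t0 y 0 t x.
Proof.
  intros Hm H0 t x Ht. destruct phi_regular as ((Cg & Cgt & Cgx & Cgxx) & Hp & Hx & Hxx & Hdt).
  set (e := fun t => m * exp (- 6 * (t - t0))).
  assert (De : forall t, is_derive e t (m * (-6 * exp (- 6 * (t - t0))))) by (intro; apply (is_derive_Rscal m (fun t => exp (-6 * (t - t0)))), is_derive_exp_lin).
  assert (Ce : forall t, continuous (fun t => exp (-6 * (t - t0))) t) by (intro; eapply is_derive_continuous, is_derive_exp_lin).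
  assert (K : 0 <= phi c t0 y 0 t x - e t).
  { apply (minimum_principle nu c 6 t0 (fun t x => phi c t0 y 0 t x - e t)
      (fun t x => phi_t t x - m * (-6 * exp (- 6 * (t - t0)))) (phi c t0 y 1) (phi c t0 y 2) (fun t x => V (Rmax t t0) x)); auto.
    - split; [repeat split; auto|split; [|split; [|split]]].
      + apply cont2_minus; [exact Cg|]. apply (cont2_fst e). intro; eapply is_derive_continuous, De.
      + apply cont2_minus; [exact Cgt|]. apply (cont2_fst (fun t => m * (-6 * exp (-6 * (t - t0))))). intro; cont1.
      + intros; cbv beta. rewrite Hp. reflexivity.
      + intros s z. eapply is_derive_eq; [apply (is_derive_Rminus (phi c t0 y 0 s) (fun _ => e s)); [apply Hx|apply is_derive_Rconst]|]. ring.
      + exact Hxx.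
      + intros s z Hs. apply (is_derive_Rminus (fun s => phi c t0 y 0 s z) e); [apply Hdt, Hs|apply De].
    - intros s z. apply pot_bound, Hpq.
    - intros s z Hs. unfold phi_t, e. assert (B := pot_bound p q (Rmax s t0) z Hpq). fold V in B.
      apply Rabs_le_between in B. assert (Q := exp_pos (-6 * (s - t0))).
      assert (0 <= (V (Rmax s t0) z + 6) * (m * exp (-6 * (s - t0)))).
      { apply Rmult_le_pos; [lra|apply Rmult_le_pos; lra]. }
      lra.
    - intro z. unfold e. rewrite Rminus_eq_0, Rmult_0_r, exp_0, Rmult_1_r. specialize (H0 z). lra. }
  unfold e in K. lra.
Qed.

End Phi.

(** * The Cole-Hopf transformation *)

(** The working form of a classical solution on [[t0, +oo[]: the equation is required only after
    [t0], and continuity extends it to [t0]. *)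
Definition burgers (nu t0 : R) (f u : R -> R -> R) : Prop :=
  exists ut ux uxx, regular t0 u ut ux uxx /\
    (forall t x, t0 < t -> ut t x + u t x * ux t x - nu * uxx t x = f t x).

Lemma is_derive_Rdiv (f g : R -> R) (x df dg : R) : g x <> 0 ->
  is_derive f x df -> is_derive g x dg -> is_derive (fun t => f t / g t) x (df / g x - f x * dg / (g x * g x)).
Proof.
  intros Hg Df Dg. eapply is_derive_eq; [apply (is_derive_div f g x df dg Df Dg Hg)|]. field. exact Hg.
Qed.

Definition cole_hopf (nu c : R) (h hx : R -> R -> R) (t x : R) : R := c - 2 * nu * (hx t x / h t x).

(** For [psi = hx / h] the linear equation gives [psi_t + c psi_x = nu psi_xx + 2 nu psi psi_x +
    V_x], and [u = c - 2 nu psi] turns this into Burgers with force [- 2 nu V_x]. The mixed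
    derivative [hxt] is supplied by its own equation, so no exchange of derivatives is used. *)
Lemma cole_hopf_burgers (nu c t0 : R) (p q : nat -> R -> R) (h ht hx hxx hxt hxxx : R -> R -> R) :
  (forall t x, 0 < h t x) ->
  regular t0 h ht hx hxx -> regular t0 hx hxt hxx hxxx ->
  (forall t x, t0 < t -> ht t x = nu * hxx t x - c * hx t x + pot p q t x * h t x) ->
  (forall t x, t0 < t -> hxt t x = nu * hxxx t x - c * hxx t x + (pot_x p q t x * h t x + pot p q t x * hx t x)) ->
  burgers nu t0 (fun t x => - 2 * nu * pot_x p q t x) (cole_hopf nu c h hx).
Proof.
  intros Hpos ((C0 & C1 & C2 & C3) & Hp & Hx & Hxx & Ht) ((_ & C4 & _ & C5) & Hpx & _ & Hxxx & Hxt) E1 E2.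
  assert (Hne : forall t x, h t x <> 0) by (intros t x; specialize (Hpos t x); lra).
  assert (Hne2 : forall t x, h t x * h t x <> 0) by (intros; apply Rmult_integral_contrapositive_currified; apply Hne).
  set (psi := fun t x => hx t x / h t x).
  set (psix := fun t x => hxx t x / h t x - hx t x * hx t x / (h t x * h t x)).
  set (psixx := fun t x => (hxxx t x / h t x - hxx t x * hx t x / (h t x * h t x)) - (psix t x * psi t x + psi t x * psix t x)).
  set (psit := fun t x => hxt t x / h t x - hx t x * ht t x / (h t x * h t x)).
  assert (D1 : forall t x, is_derive (psi t) x (psix t x)) by (intros t x; apply (is_derive_Rdiv (hx t) (h t)); auto).
  assert (D2 : forall t x, is_derive (psix t) x (psixx t x)).
  { intros t x. apply is_derive_ext with (fun x => hxx t x / h t x - psi t x * psi t x).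
    - intro z. unfold psix, psi. change (hxx t z / h t z - hx t z / h t z * (hx t z / h t z) = hxx t z / h t z - hx t z * hx t z / (h t z * h t z) :> R). field. apply Hne.
    - apply (is_derive_Rminus (fun x => hxx t x / h t x) (fun x => psi t x * psi t x)).
      + apply (is_derive_Rdiv (hxx t) (h t)); auto.
      + apply (is_derive_Rmult (psi t) (psi t)); apply D1. }
  assert (D3 : forall t x, t0 < t -> is_derive (fun s => psi s x) t (psit t x)).
  { intros t x Htt. apply (is_derive_Rdiv (fun s => hx s x) (fun s => h s x)); auto. }
  assert (Cpsi : cont2 psi) by (apply cont2_div; auto).
  assert (Cpsix : cont2 psix) by (apply cont2_minus; apply cont2_div; auto; apply cont2_mult; auto).
  assert (Cpsixx : cont2 psixx).
  { apply cont2_minus; [apply cont2_minus; apply cont2_div; auto; apply cont2_mult; auto|apply cont2_plus; apply cont2_mult; auto]. }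
  assert (Cpsit : cont2 psit) by (apply cont2_minus; apply cont2_div; auto; apply cont2_mult; auto).
  exists (fun t x => - (2 * nu) * psit t x), (fun t x => - (2 * nu) * psix t x), (fun t x => - (2 * nu) * psixx t x).
  split.
  - split; [repeat split|split; [|split; [|split]]].
    + apply cont2_minus; [apply cont2_const|]. apply cont2_mult; [apply cont2_const|exact Cpsi].
    + apply cont2_mult; [apply cont2_const|assumption].
    + apply cont2_mult; [apply cont2_const|assumption].
    + apply cont2_mult; [apply cont2_const|assumption].
    + intros t x. unfold cole_hopf. rewrite Hp, Hpx. reflexivity.
    + intros t x. eapply is_derive_eq; [apply (is_derive_Rminus (fun _ => c) (fun x => 2 * nu * psi t x)); [apply is_derive_Rconst|apply is_derive_Rscal, D1]|]. ring.
    + intros t x. apply (is_derive_Rscal (- (2 * nu)) (psix t)), D2.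
    + intros t x Htt. eapply is_derive_eq; [apply (is_derive_Rminus (fun _ => c) (fun s => 2 * nu * psi s x)); [apply is_derive_Rconst|apply is_derive_Rscal, D3, Htt]|]. ring.
  - intros t x Htt. unfold cole_hopf, psit, psixx, psix, psi. rewrite (E1 t x Htt), (E2 t x Htt). field. apply Hne.
Qed.

(** [hx / h] is the derivative of the periodic function [ln h]. *)
Lemma cole_hopf_mean nu c (h hx : R -> R -> R) t : cont2 h -> cont2 hx ->
  (forall x, 0 < h t x) -> (forall x, is_derive (h t) x (hx t x)) -> (forall x, h t (x + 2 * PI) = h t x) ->
  RInt (cole_hopf nu c h hx t) 0 (2 * PI) = 2 * PI * c.
Proof.
  intros Ch Chx Hpos Hd Hp.
  assert (Cd : forall x, continuous (fun x => hx t x / h t x) x).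
  { intro x. apply (continuous_mult (K := R_AbsRing) (hx t)); [apply (cont2_slice_x hx), Chx|].
    apply (continuous_comp (h t) Rinv); [apply (cont2_slice_x h), Ch|].
    apply continuous_Rinv. specialize (Hpos x). lra. }
  assert (E : RInt (fun x => hx t x / h t x) 0 (2 * PI) = 0).
  { apply RInt_derive_periodic with (fun x => ln (h t x)); [|exact Cd|intro; rewrite Hp; reflexivity].
    intro x. eapply is_derive_eq; [apply (is_derive_Rcomp ln (h t) x (/ h t x)); [apply Hd|]|reflexivity].
    apply is_derive_ln, Hpos. }
  unfold cole_hopf. rewrite RInt_Rminus; [|intro; cont1|intro; cont1].
  rewrite RInt_constR, RInt_Rmult_l by exact Cd. rewrite E. Rring.
Qed.

(** * Energy estimates for the Burgers equation *)

Definition dist2 (u v : R -> R -> R) (t : R) : R := RInt (fun x => (u t x - v t x) ^ 2) 0 (2 * PI).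

Definition energy (c : R) (u : R -> R -> R) (t : R) : R := dist2 u (fun _ _ => c) t.

Lemma dist2_nonneg u v t : cont2 u -> cont2 v -> 0 <= dist2 u v t.
Proof.
  intros Cu Cv. assert (Hpi := PI_RGT_0). apply RInt_nonneg; [lra| |intros; apply pow2_ge_0].
  intro x. apply (cont2_slice_x (fun t x => (u t x - v t x) ^ 2) t). cont2_tac.
Qed.

Lemma continuous_dist2 u v t : cont2 u -> cont2 v -> continuous (dist2 u v) t.
Proof.
  intros Cu Cv. assert (Hpi := PI_RGT_0).
  apply (continuous_RInt_param (fun t x => (u t x - v t x) ^ 2)); [lra|]. cont2_tac.
Qed.

Lemma is_derive_sq (f : R -> R) x df : is_derive f x df -> is_derive (fun t => f t ^ 2) x (2 * f x * df).
Proof. intro H. eapply is_derive_eq; [apply (is_derive_pow f 2 x df H)|]. simpl. ring. Qed.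

Lemma burgers_cont2 nu t0 f u : burgers nu t0 f u -> cont2 u.
Proof. intros (ut & ux & uxx & ((C & _) & _) & _). exact C. Qed.

Lemma burgers_period nu t0 f u : burgers nu t0 f u -> forall t x, u t (x + 2 * PI) = u t x.
Proof. intros (ut & ux & uxx & (_ & Hp & _) & _). exact Hp. Qed.

Lemma burgers_later nu t0 t1 f u : t0 <= t1 -> burgers nu t0 f u -> burgers nu t1 f u.
Proof.
  intros Ht (ut & ux & uxx & (C & Hp & Hx & Hxx & Hd) & E).
  exists ut, ux, uxx. split; [split; [|split; [|split; [|split]]]|]; auto.
  - intros; apply Hd; lra.
  - intros; apply E; lra.
Qed.

Section Energy.

Variables (nu c Phi : R) (f F : R -> R -> R).
Hypothesis Hnu : 0 < nu.
Hypothesis Cf : cont2 f.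
Hypothesis CF : cont2 F.
Hypothesis HF : forall t x, is_derive (F t) x (f t x).
Hypothesis HFp : forall t x, F t (x + 2 * PI) = F t x.
Hypothesis HPhi : forall t, RInt (fun x => F t x ^ 2) 0 (2 * PI) <= Phi.

Let slice (g : R -> R -> R) t (H : cont2 g) : forall x, continuous (g t) x := fun x => cont2_slice_x g t x H.

(** [u_t] is the space derivative of the periodic function [F - u^2 / 2 + nu u_x]. *)
Lemma burgers_mean t0 u : burgers nu t0 f u ->
  forall t, t0 <= t -> RInt (u t) 0 (2 * PI) = RInt (u t0) 0 (2 * PI).
Proof.
  intros (ut & ux & uxx & ((C1 & C2 & C3 & C4) & Hp & Hx & Hxx & Hd) & E) t Ht.
  assert (Hpi := PI_RGT_0).
  assert (D : forall s, t0 < s -> is_derive (fun s => RInt (u s) 0 (2 * PI)) s 0).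
  { intros s Hs. eapply is_derive_eq; [apply (is_derive_RInt_time u ut 0 (2 * PI) t0); auto|].
    rewrite (RInt_eq _ (fun x => f s x - u s x * ux s x + nu * uxx s x)) by (intro x; specialize (E s x Hs); Rring || lra).
    apply RInt_derive_periodic with (fun x => F s x - / 2 * u s x ^ 2 + nu * ux s x).
    - intro x. eapply is_derive_eq.
      + apply (is_derive_Rplus (fun x => F s x - / 2 * u s x ^ 2)); [|apply is_derive_Rscal, Hxx].
        apply (is_derive_Rminus (F s)); [apply HF|]. apply is_derive_Rscal, is_derive_sq, Hx.
      + field.
    - apply (slice (fun s x => f s x - u s x * ux s x + nu * uxx s x)). cont2_tac.
    - intro x. rewrite HFp, Hp, (derive_periodic (u s) (ux s)); auto. }
  assert (C : forall s, continuous (fun s => RInt (u s) 0 (2 * PI)) s) by (intro; apply continuous_RInt_param; [lra|assumption]).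
  apply Rle_antisym.
  - apply (decreasing_of_derive_nonpos (fun s => RInt (u s) 0 (2 * PI)) (fun _ => 0)); auto; intros; [apply D|]; lra.
  - apply Ropp_le_cancel.
    apply (decreasing_of_derive_nonpos (fun s => - RInt (u s) 0 (2 * PI)) (fun _ => 0)); auto; [| |intros; lra].
    + intro s. cont1.
    + intros s Hs. eapply is_derive_eq; [apply (is_derive_opp (V := R_NormedModule)); apply D; lra|]. apply Ropp_0.
Qed.

(** Test with [2 (u - c)]: the nonlinear term integrates to zero, the force is integrated by parts
    so that only [F] enters, and Young's inequality gives up half of the dissipation [2 nu]. *)
Lemma energy_derive t0 u ut ux uxx t : regular t0 u ut ux uxx ->
  (forall t x, t0 < t -> ut t x + u t x * ux t x - nu * uxx t x = f t x) -> t0 < t ->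
  is_derive (energy c u) t (RInt (fun x => 2 * (u t x - c) * ut t x) 0 (2 * PI)) /\
  RInt (fun x => 2 * (u t x - c) * ut t x) 0 (2 * PI) <= - nu * RInt (fun x => ux t x ^ 2) 0 (2 * PI) + Phi / nu.
Proof.
  intros ((C1 & C2 & C3 & C4) & Hp & Hx & Hxx & Hd) E Ht.
  assert (Hpi := PI_RGT_0).
  split.
  - apply (is_derive_RInt_time (fun t x => (u t x - c) ^ 2) (fun t x => 2 * (u t x - c) * ut t x) 0 (2 * PI) t0); [cont2_tac|cont2_tac|exact Ht|].
    intros s x Hs. apply (is_derive_sq (fun s => u s x - c)).
    eapply is_derive_eq; [apply (is_derive_Rminus (fun s => u s x) (fun _ => c)); [apply Hd, Hs|apply is_derive_Rconst]|]. ring.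
  - assert (Q1 : forall x, continuous (fun x => 2 * (u t x - c) * ut t x) x) by (apply (slice (fun t x => 2 * (u t x - c) * ut t x)); cont2_tac).
    assert (Q2 : forall x, continuous (fun x => 2 * ux t x * (F t x + nu * ux t x)) x) by (apply (slice (fun t x => 2 * ux t x * (F t x + nu * ux t x))); cont2_tac).
    assert (Q3 : forall x, continuous (fun x => ux t x ^ 2) x) by (apply (slice (fun t x => ux t x ^ 2)); cont2_tac).
    assert (Q4 : forall x, continuous (fun x => F t x ^ 2) x) by (apply (slice (fun t x => F t x ^ 2)); cont2_tac).
    assert (I : RInt (fun x => 2 * (u t x - c) * ut t x + 2 * ux t x * (F t x + nu * ux t x)) 0 (2 * PI) = 0).
    (* [2/3 (u - c)^3 + c (u - c)^2] is a primitive of [2 (u - c) u u_x]. *)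
    { apply RInt_derive_periodic with (fun x => 2 * (u t x - c) * (F t x + nu * ux t x) - (2 / 3 * (u t x - c) ^ 3 + c * (u t x - c) ^ 2)).
      - intro x.
        assert (D0 : is_derive (fun x => u t x - c) x (ux t x)).
        { eapply is_derive_eq; [apply (is_derive_Rminus (u t) (fun _ => c)); [apply Hx|apply is_derive_Rconst]|]. ring. }
        eapply is_derive_eq.
        + apply (is_derive_Rminus (fun x => 2 * (u t x - c) * (F t x + nu * ux t x)) (fun x => 2 / 3 * (u t x - c) ^ 3 + c * (u t x - c) ^ 2)).
          * apply (is_derive_Rmult (fun x => 2 * (u t x - c)) (fun x => F t x + nu * ux t x)); [apply is_derive_Rscal, D0|].
            apply (is_derive_Rplus (F t)); [apply HF|apply is_derive_Rscal, Hxx].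
          * apply (is_derive_Rplus (fun x => 2 / 3 * (u t x - c) ^ 3)); [apply is_derive_Rscal, (is_derive_pow (fun x => u t x - c) 3 x _ D0)|].
            apply is_derive_Rscal, is_derive_sq, D0.
        + rewrite <- (E t x Ht). simpl. field.
      - intro x. cont1.
      - intro x. rewrite HFp, Hp, (derive_periodic (u t) (ux t)); auto. }
    rewrite RInt_Rplus in I by auto.
    assert (J : - nu * RInt (fun x => ux t x ^ 2) 0 (2 * PI) + / nu * RInt (fun x => F t x ^ 2) 0 (2 * PI)
      >= - RInt (fun x => 2 * ux t x * (F t x + nu * ux t x)) 0 (2 * PI)).
    { rewrite <- !RInt_Rmult_l by auto. rewrite <- RInt_Rplus by (intro; cont1).
      replace (- RInt (fun x => 2 * ux t x * (F t x + nu * ux t x)) 0 (2 * PI))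
        with (-1 * RInt (fun x => 2 * ux t x * (F t x + nu * ux t x)) 0 (2 * PI)) by Rring.
      rewrite <- RInt_Rmult_l by auto. apply Rle_ge, RInt_mono; [lra|intro; cont1|intro; cont1|].
      (* Young's inequality [- 2 u_x F <= nu u_x^2 + F^2 / nu], by completing the square. *)
      intros x _. assert (S := pow2_ge_0 (nu * ux t x + F t x)).
      apply Rmult_le_reg_l with nu; [lra|]. field_simplify; [|lra]. nra. }
    assert (K := HPhi t).
    assert (K' : / nu * RInt (fun x => F t x ^ 2) 0 (2 * PI) <= / nu * Phi) by (apply Rmult_le_compat_l; [left; apply Rinv_0_lt_compat, Hnu|exact K]).
    unfold Rdiv. lra.
Qed.

Lemma continuous_energy u t : cont2 u -> continuous (energy c u) t.
Proof. intro H. apply continuous_dist2; [exact H|apply cont2_const]. Qed.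

Lemma RInt_Rminus_mean t (u : R -> R -> R) : cont2 u -> RInt (u t) 0 (2 * PI) = 2 * PI * c ->
  RInt (fun x => u t x - c) 0 (2 * PI) = 0.
Proof.
  intros C H. rewrite RInt_Rminus; [|apply slice, C|intro; apply continuous_const].
  rewrite RInt_constR, H. Rring.
Qed.

(** By Poincare the energy [e] satisfies [e' <= - (nu / PI^2) e + Phi / nu]; the added constant is
    the equilibrium of this inequality. *)
Lemma energy_bound t0 u t : burgers nu t0 f u -> RInt (u t0) 0 (2 * PI) = 2 * PI * c -> t0 <= t ->
  energy c u t <= energy c u t0 + PI ^ 2 * Phi / nu ^ 2.
Proof.
  intros Hu Hm Ht. assert (M := burgers_mean t0 u Hu).
  destruct Hu as (ut & ux & uxx & Hr & E).
  assert (Hpi := PI_RGT_0). assert (Cu : cont2 u) by apply Hr.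
  assert (HPhi0 : 0 <= Phi).
  { eapply Rle_trans; [|apply (HPhi 0)]. apply RInt_nonneg; [lra| |intros; apply pow2_ge_0].
    apply (slice (fun t x => F t x ^ 2)). cont2_tac. }
  set (K := PI ^ 2 * Phi / nu ^ 2).
  assert (HK : 0 <= K).
  { unfold K. apply Rmult_le_pos; [apply Rmult_le_pos; [apply pow2_ge_0|exact HPhi0]|left; apply Rinv_0_lt_compat, pow_lt, Hnu]. }
  assert (G : energy c u t - K <= (energy c u t0 - K) * exp (- (nu / PI ^ 2) * (t - t0))).
  { apply (Gronwall (fun t => energy c u t - K) (fun t => RInt (fun x => 2 * (u t x - c) * ut t x) 0 (2 * PI))); [| | |exact Ht].
    - intro s. assert (Q := continuous_energy u s Cu). cont1.
    - intros s Hs. eapply is_derive_eq; [apply (is_derive_Rminus (energy c u) (fun _ => K)); [apply (energy_derive t0 u ut ux uxx s Hr E); lra|apply is_derive_Rconst]|]. Rring.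
    - intros s Hs. destruct (energy_derive t0 u ut ux uxx s Hr E) as [_ D]; [lra|].
      eapply Rle_trans; [exact D|].
      assert (P : energy c u s <= PI ^ 2 * RInt (fun x => ux s x ^ 2) 0 (2 * PI)).
      { destruct Hr as ((C1 & C2 & C3 & C4) & Hp & Hx & Hxx & Hd).
        apply (Poincare (fun x => u s x - c) (ux s)).
        - intro x. eapply is_derive_eq; [apply (is_derive_Rminus (u s) (fun _ => c)); [apply Hx|apply is_derive_Rconst]|]. ring.
        - apply slice, C3.
        - assert (Q := Hp s 0). rewrite Rplus_0_l in Q. rewrite Q. reflexivity.
        - apply RInt_Rminus_mean; [exact C1|]. rewrite M, Hm by lra. reflexivity. }
      set (X := RInt (fun x => ux s x ^ 2) 0 (2 * PI)) in *.
      replace (- (nu / PI ^ 2) * (energy c u s - K)) with (- (nu / PI ^ 2) * energy c u s + Phi / nu) by (unfold K; field; lra).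
      apply Rplus_le_compat_r.
      replace (- nu * X) with (- (nu / PI ^ 2) * (PI ^ 2 * X)) by (field; lra).
      rewrite !Ropp_mult_distr_l_reverse. apply Ropp_le_contravar. apply Rmult_le_compat_l; [|exact P].
      apply Rmult_le_pos; [lra|left; apply Rinv_0_lt_compat, pow_lt, Hpi]. }
  assert (N0 : 0 <= energy c u t0) by (apply dist2_nonneg; [exact Cu|apply cont2_const]).
  assert (Q := exp_pos (- (nu / PI ^ 2) * (t - t0))).
  assert (Q' : exp (- (nu / PI ^ 2) * (t - t0)) <= 1).
  { rewrite <- exp_0. apply exp_le. assert (0 <= nu / PI ^ 2 * (t - t0)); [|lra].
    apply Rmult_le_pos; [|lra]. apply Rmult_le_pos; [lra|left; apply Rinv_0_lt_compat, pow_lt, Hpi]. }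
  nra.
Qed.

(* With [p2 = int w_x^2], [q2 = int w^2], [X2 = int u_x^2]: Cauchy-Schwarz and the sup bound
   [w^2 <= (PI/2) p2] give [(1/2 int u_x w^2)^2 <= (PI/8) p2 X2 q2]; conclude by AM-GM. *)
Lemma transport_bound (w w' g : R -> R) : (forall x, is_derive w x (w' x)) -> (forall x, continuous w' x) ->
  w (2 * PI) = w 0 -> RInt w 0 (2 * PI) = 0 -> (forall x, continuous g x) ->
  - / 2 * RInt (fun x => g x * w x ^ 2) 0 (2 * PI) <=
  RInt (fun x => w' x ^ 2) 0 (2 * PI) + PI / 32 * (RInt (fun x => g x ^ 2) 0 (2 * PI) * RInt (fun x => w x ^ 2) 0 (2 * PI)).
Proof.
  intros Hd Hc Hper H0 Hg. assert (Hpi := PI_RGT_0).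
  assert (Hw : forall x, continuous w x) by (intro; eapply is_derive_continuous, Hd).
  assert (S := sup_bound_derive w w' Hd Hc Hper H0).
  set (p2 := RInt (fun x => w' x ^ 2) 0 (2 * PI)) in *.
  set (q2 := RInt (fun x => w x ^ 2) 0 (2 * PI)).
  set (X2 := RInt (fun x => g x ^ 2) 0 (2 * PI)).
  set (I := RInt (fun x => g x * w x ^ 2) 0 (2 * PI)).
  assert (Gw : forall x, continuous (fun x => g x * w x) x) by (intro; cont1).
  assert (G2 : forall x, continuous (fun x => g x ^ 2) x) by (intro; apply continuous_pow, Hg).
  assert (Hp2 : 0 <= p2) by (apply RInt_nonneg; [lra|intro; apply continuous_pow, Hc|intros; apply pow2_ge_0]).
  assert (Hq2 : 0 <= q2) by (apply RInt_nonneg; [lra|intro; apply continuous_pow, Hw|intros; apply pow2_ge_0]).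
  assert (HX2 : 0 <= X2) by (apply RInt_nonneg; [lra|exact G2|intros; apply pow2_ge_0]).
  assert (CS := Cauchy_Schwarz_RInt (fun x => g x * w x) w 0 (2 * PI) ltac:(lra) Gw Hw).
  rewrite (RInt_eq (fun x => g x * w x * w x) (fun x => g x * w x ^ 2)) in CS by (intro; Rring). fold I q2 in CS.
  assert (B : RInt (fun x => (g x * w x) ^ 2) 0 (2 * PI) <= PI / 2 * p2 * X2).
  { unfold X2. rewrite <- RInt_Rmult_l by exact G2.
    apply RInt_mono; [lra|intro; apply continuous_pow, Gw|intro; cont1|].
    intros x Hx. rewrite Rpow_mult_distr. specialize (S x Hx). assert (Q := pow2_ge_0 (g x)). nra. }
  assert (CS' : I ^ 2 <= PI / 2 * p2 * X2 * q2) by (eapply Rle_trans; [exact CS|apply Rmult_le_compat_r; assumption]).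
  set (a := X2 * q2) in *. assert (Ha : 0 <= a) by (apply Rmult_le_pos; assumption).
  replace (PI / 2 * p2 * X2 * q2) with (PI / 2 * p2 * a) in CS' by (unfold a; ring).
  assert (T : 0 <= p2 + PI / 32 * a) by (assert (0 <= PI / 32 * a) by (apply Rmult_le_pos; lra); lra).
  assert (AG : (- / 2 * I) ^ 2 <= (p2 + PI / 32 * a) ^ 2).
  { assert (0 <= (p2 - PI / 32 * a) ^ 2) by apply pow2_ge_0. nra. }
  apply Rnot_lt_le. intro Hlt. assert (P : 0 < - / 2 * I) by lra.
  assert ((p2 + PI / 32 * a) * (p2 + PI / 32 * a) < (- / 2 * I) * (- / 2 * I)) by (apply Rmult_le_0_lt_compat; assumption).
  lra.
Qed.

(** The subtracted term is [2 mu Phi / nu] with [mu = PI / (32 nu)]: the growth that the force may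
    cause in the exponent of the weight, for [u] and [v] together. *)
Definition decay_rate : R := 2 * (nu - 1) / PI ^ 2 - PI * Phi / (16 * nu ^ 2).

(* The weight [exp (PI / (32 nu) (energy u + energy v))] absorbs the terms [int u_x^2],
   [int v_x^2] produced by [transport_bound]; no smallness of the solutions is needed. *)
Lemma contraction t0 u v t : 1 <= nu -> burgers nu t0 f u -> burgers nu t0 f v ->
  RInt (u t0) 0 (2 * PI) = 2 * PI * c -> RInt (v t0) 0 (2 * PI) = 2 * PI * c -> t0 <= t ->
  dist2 u v t <= dist2 u v t0 * exp (PI / (32 * nu) * (energy c u t0 + energy c v t0)) * exp (- decay_rate * (t - t0)).
Proof.
  intros Hnu1 Hu Hv Mu0 Mv0 Ht. assert (Hpi := PI_RGT_0).
  assert (Mu := burgers_mean t0 u Hu). assert (Mv := burgers_mean t0 v Hv).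
  assert (Cu := burgers_cont2 _ _ _ _ Hu). assert (Cv := burgers_cont2 _ _ _ _ Hv).
  destruct Hu as (ut & ux & uxx & Ru & Eu). destruct Hv as (vt & vx & vxx & Rv & Ev).
  (* Chosen so that [mu nu = PI / 32]: the dissipation in the weight cancels exactly the last term
     of [transport_bound]. *)
  set (mu := PI / (32 * nu)).
  assert (Hmu : 0 < mu) by (apply Rdiv_lt_0_compat; lra).
  set (Nu' := fun t => RInt (fun x => 2 * (u t x - c) * ut t x) 0 (2 * PI)).
  set (Nv' := fun t => RInt (fun x => 2 * (v t x - c) * vt t x) 0 (2 * PI)).
  set (Nw' := fun t => RInt (fun x => 2 * (u t x - v t x) * (ut t x - vt t x)) 0 (2 * PI)).
  set (W := fun t => exp (mu * (energy c u t + energy c v t))).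
  assert (DW : forall s, t0 < s -> is_derive W s (mu * (Nu' s + Nv' s) * W s)).
  { intros s Hs. apply (is_derive_Rcomp exp (fun t => mu * (energy c u t + energy c v t))); [|apply is_derive_Rexp].
    apply is_derive_Rscal, is_derive_Rplus.
    - apply (energy_derive t0 u ut ux uxx s Ru Eu Hs).
    - apply (energy_derive t0 v vt vx vxx s Rv Ev Hs). }
  assert (Key : dist2 u v t * W t <= dist2 u v t0 * W t0 * exp (- decay_rate * (t - t0))).
  { apply (Gronwall (fun t => dist2 u v t * W t) (fun s => Nw' s * W s + dist2 u v s * (mu * (Nu' s + Nv' s) * W s))); [| | |exact Ht].
    - intro s. assert (K1 := continuous_dist2 u v s Cu Cv).
      assert (K2 := continuous_energy u s Cu). assert (K3 := continuous_energy v s Cv).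
      assert (continuous W s); [|cont1].
      apply (continuous_comp (fun t => mu * (energy c u t + energy c v t)) exp); [cont1|].
      eapply is_derive_continuous, is_derive_Rexp.
    - intros s Hs. apply is_derive_Rmult; [|apply DW; lra].
      destruct Ru as ((C1 & C2 & C3 & C4) & Hp & Hx & Hxx & Hd).
      destruct Rv as ((K1 & K2 & K3 & K4) & Kp & Kx & Kxx & Kd).
      apply (is_derive_RInt_time (fun t x => (u t x - v t x) ^ 2) (fun t x => 2 * (u t x - v t x) * (ut t x - vt t x)) 0 (2 * PI) t0); [cont2_tac|cont2_tac|lra|].
      intros r x Hr. apply (is_derive_sq (fun s => u s x - v s x)). apply is_derive_Rminus; [apply Hd|apply Kd]; exact Hr.
    - intros s Hs.
      destruct (energy_derive t0 u ut ux uxx s Ru Eu ltac:(lra)) as [_ Du]. fold (Nu' s) in Du.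
      destruct (energy_derive t0 v vt vx vxx s Rv Ev ltac:(lra)) as [_ Dv]. fold (Nv' s) in Dv.
      destruct Ru as ((C1 & C2 & C3 & C4) & Hp & Hx & Hxx & Hd).
      destruct Rv as ((K1 & K2 & K3 & K4) & Kp & Kx & Kxx & Kd).
      assert (Dw : forall x, is_derive (fun x => u s x - v s x) x (ux s x - vx s x)) by (intro; apply is_derive_Rminus; auto).
      assert (Cwx : forall x, continuous (fun x => ux s x - vx s x) x) by (apply (slice (fun s x => ux s x - vx s x)); cont2_tac).
      assert (Per : u s (2 * PI) - v s (2 * PI) = u s 0 - v s 0).
      { assert (Q1 := Hp s 0). assert (Q2 := Kp s 0). rewrite Rplus_0_l in Q1, Q2. lra. }
      assert (Mw : RInt (fun x => u s x - v s x) 0 (2 * PI) = 0).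
      { rewrite RInt_Rminus by (apply slice; assumption). rewrite Mu, Mv, Mu0, Mv0 by lra. Rring. }
      assert (Tu := transport_bound _ _ (ux s) Dw Cwx Per Mw (slice ux s C3)).
      assert (Tv := transport_bound _ _ (vx s) Dw Cwx Per Mw (slice vx s K3)).
      assert (Po := Poincare _ _ Dw Cwx Per Mw). cbv beta in Po, Tu, Tv.
      fold (dist2 u v s) in Po, Tu, Tv.
      set (p2 := RInt (fun x => (ux s x - vx s x) ^ 2) 0 (2 * PI)) in *.
      set (X2 := RInt (fun x => ux s x ^ 2) 0 (2 * PI)) in *.
      set (Y2 := RInt (fun x => vx s x ^ 2) 0 (2 * PI)) in *.
      assert (q2pos := dist2_nonneg u v s Cu Cv).
      set (q2 := dist2 u v s) in *.
      (* Symmetric form of the nonlinearity: with [w = u - v], [u u_x - v v_x] is half the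
         derivative of [(u + v) w], and two integrations by parts leave
         [- 1/2 int (u_x + v_x) w^2]. *)
      assert (Id : Nw' s = - 2 * nu * p2 + (- / 2 * RInt (fun x => ux s x * (u s x - v s x) ^ 2) 0 (2 * PI))
        + (- / 2 * RInt (fun x => vx s x * (u s x - v s x) ^ 2) 0 (2 * PI))).
      { assert (I : RInt (fun x => 2 * (u s x - v s x) * (ut s x - vt s x) + (2 * nu) * (ux s x - vx s x) ^ 2
          + / 2 * (ux s x * (u s x - v s x) ^ 2) + / 2 * (vx s x * (u s x - v s x) ^ 2)) 0 (2 * PI) = 0).
        { apply RInt_derive_periodic with (fun x => 2 * nu * ((u s x - v s x) * (ux s x - vx s x)) - / 2 * ((u s x + v s x) * (u s x - v s x) ^ 2)).
          - intro x. eapply is_derive_eq.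
            + apply (is_derive_Rminus (fun x => 2 * nu * ((u s x - v s x) * (ux s x - vx s x)))).
              * apply is_derive_Rscal. apply (is_derive_Rmult (fun x => u s x - v s x) (fun x => ux s x - vx s x)); [apply Dw|].
                apply is_derive_Rminus; auto.
              * apply is_derive_Rscal. apply (is_derive_Rmult (fun x => u s x + v s x) (fun x => (u s x - v s x) ^ 2)).
                -- apply is_derive_Rplus; auto.
                -- apply is_derive_sq, Dw.
            + replace (ut s x) with (f s x - u s x * ux s x + nu * uxx s x) by (rewrite <- (Eu s x) by lra; ring).
              replace (vt s x) with (f s x - v s x * vx s x + nu * vxx s x) by (rewrite <- (Ev s x) by lra; ring). field.
          - apply (slice (fun s x => 2 * (u s x - v s x) * (ut s x - vt s x) + (2 * nu) * (ux s x - vx s x) ^ 2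
              + / 2 * (ux s x * (u s x - v s x) ^ 2) + / 2 * (vx s x * (u s x - v s x) ^ 2)) s). cont2_tac.
          - intro x. rewrite Hp, Kp, (derive_periodic (u s) (ux s)), (derive_periodic (v s) (vx s)); auto. }
        assert (J1 : forall x, continuous (fun x => 2 * (u s x - v s x) * (ut s x - vt s x)) x) by (apply (slice (fun s x => 2 * (u s x - v s x) * (ut s x - vt s x))); cont2_tac).
        assert (J2 : forall x, continuous (fun x => (ux s x - vx s x) ^ 2) x) by (apply (slice (fun s x => (ux s x - vx s x) ^ 2)); cont2_tac).
        assert (J3 : forall x, continuous (fun x => ux s x * (u s x - v s x) ^ 2) x) by (apply (slice (fun s x => ux s x * (u s x - v s x) ^ 2)); cont2_tac).
        assert (J4 : forall x, continuous (fun x => vx s x * (u s x - v s x) ^ 2) x) by (apply (slice (fun s x => vx s x * (u s x - v s x) ^ 2)); cont2_tac).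
        rewrite !RInt_Rplus, !RInt_Rmult_l in I by (intro; cont1).
        unfold Nw'. fold p2 in I. lra. }
      assert (Wp : 0 < W s) by apply exp_pos.
      assert (NW : Nw' s + q2 * (mu * (Nu' s + Nv' s)) <= - decay_rate * q2).
      { assert (S1 : Nw' s <= - 2 * (nu - 1) * p2 + PI / 32 * (X2 + Y2) * q2) by (rewrite Id; lra).
        assert (S2 : mu * (Nu' s + Nv' s) <= mu * (- nu * (X2 + Y2) + 2 * (Phi / nu))) by (apply Rmult_le_compat_l; lra).
        assert (S3 : mu * (- nu * (X2 + Y2) + 2 * (Phi / nu)) = - (PI / 32) * (X2 + Y2) + PI * Phi / (16 * nu ^ 2)) by (unfold mu; field; lra).
        assert (S4 : q2 * (mu * (Nu' s + Nv' s)) <= q2 * (- (PI / 32) * (X2 + Y2) + PI * Phi / (16 * nu ^ 2))).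
        { apply Rmult_le_compat_l; [exact q2pos|]. rewrite <- S3. exact S2. }
        assert (S5 : 2 * (nu - 1) / PI ^ 2 * q2 <= 2 * (nu - 1) * p2).
        { replace (2 * (nu - 1) * p2) with (2 * (nu - 1) / PI ^ 2 * (PI ^ 2 * p2)) by (field; lra).
          apply Rmult_le_compat_l; [|exact Po].
          apply Rmult_le_pos; [lra|left; apply Rinv_0_lt_compat, pow_lt, Hpi]. }
        unfold decay_rate. lra. }
      apply Rle_trans with ((Nw' s + q2 * (mu * (Nu' s + Nv' s))) * W s); [apply Req_le; ring|].
      apply Rle_trans with ((- decay_rate * q2) * W s); [|apply Req_le; ring].
      apply Rmult_le_compat_r; lra. }
  (* At time [t] the weight may be dropped; at [t0] it becomes the prefactor, the only place where
     the data enter. *)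
  assert (W1 : 1 <= W t).
  { unfold W. rewrite <- exp_0 at 1. apply exp_le. apply Rmult_le_pos; [lra|].
    assert (A1 : 0 <= energy c u t) by (apply dist2_nonneg; [exact Cu|apply cont2_const]).
    assert (A2 : 0 <= energy c v t) by (apply dist2_nonneg; [exact Cv|apply cont2_const]). lra. }
  assert (q2pos := dist2_nonneg u v t Cu Cv).
  eapply Rle_trans; [|exact Key]. rewrite <- (Rmult_1_r (dist2 u v t)) at 1.
  apply Rmult_le_compat_l; assumption.
Qed.

End Energy.

(** * A bound on [PI] and Parseval's identity for the potential *)

(** The first term of the Machin-type series for [PI / 4 = 2 atan (1/3) + atan (1/7)] already gives
    [PI <= 68/21]. *)
Lemma PI_lt_324 : PI < 3.24.
Proof.
  destruct (PI_2_3_7_ineq 0) as [_ H]. simpl in H.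
  unfold tg_alt, PI_2_3_7_tg, Ratan_seq in H. simpl in H. lra.
Qed.

(** Parseval: [p cos (j x) + q sin (j x)] has the coefficients [(p + q) / 2] and [(p - q) / 2] at
    [j] and [- j], whose squares add up to [(p^2 + q^2) / 2]. *)
Lemma RInt_pot_sq p q t :
  RInt (fun x => pot p q t x ^ 2) 0 (2 * PI) =
  PI * (p 1%nat t ^ 2 + q 1%nat t ^ 2 + p 2%nat t ^ 2 + q 2%nat t ^ 2 + p 3%nat t ^ 2 + q 3%nat t ^ 2).
Proof.
  set (y := fun m : Z => match m with
    | 1%Z => / 2 * (p 1%nat t + q 1%nat t) | (-1)%Z => / 2 * (p 1%nat t - q 1%nat t)
    | 2%Z => / 2 * (p 2%nat t + q 2%nat t) | (-2)%Z => / 2 * (p 2%nat t - q 2%nat t)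
    | 3%Z => / 2 * (p 3%nat t + q 3%nat t) | (-3)%Z => / 2 * (p 3%nat t - q 3%nat t)
    | _ => 0 end).
  set (e := fun (m : Z) x => cas (IZR m * (x - 0))).
  set (g := fun x => y 1%Z * e 1%Z x + y (-1)%Z * e (-1)%Z x + y 2%Z * e 2%Z x + y (-2)%Z * e (-2)%Z x
    + y 3%Z * e 3%Z x + y (-3)%Z * e (-3)%Z x).
  assert (Ce : forall m x, continuous (e m) x) by (intros; apply continuous_cas_lin).
  assert (Hg : forall x, pot p q t x = g x).
  { intro x. unfold pot, pot_term, g, e, y, cas. rewrite Rminus_0_r. simpl INR.
    replace (1 + 1 + 1) with 3 by ring. replace (1 + 1) with 2 by ring.
    replace (-1 * x) with (- (1 * x)) by ring. replace (-2 * x) with (- (2 * x)) by ring. replace (-3 * x) with (- (3 * x)) by ring.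
    rewrite !cos_neg, !sin_neg. field. }
  assert (Cg : forall x, continuous g x) by (intro; unfold g; cont1).
  assert (Hge : forall m, RInt (fun x => g x * e m x) 0 (2 * PI) =
    y 1%Z * (if Z.eq_dec 1 m then 2 * PI else 0) + y (-1)%Z * (if Z.eq_dec (-1) m then 2 * PI else 0)
    + y 2%Z * (if Z.eq_dec 2 m then 2 * PI else 0) + y (-2)%Z * (if Z.eq_dec (-2) m then 2 * PI else 0)
    + y 3%Z * (if Z.eq_dec 3 m then 2 * PI else 0) + y (-3)%Z * (if Z.eq_dec (-3) m then 2 * PI else 0)).
  { intro m.
    rewrite (RInt_eq _ (fun x => y 1%Z * (e 1%Z x * e m x) + y (-1)%Z * (e (-1)%Z x * e m x) + y 2%Z * (e 2%Z x * e m x)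
      + y (-2)%Z * (e (-2)%Z x * e m x) + y 3%Z * (e 3%Z x * e m x) + y (-3)%Z * (e (-3)%Z x * e m x)))
      by (intro; unfold g; Rring).
    rewrite !RInt_Rplus, !RInt_Rmult_l by (intro; cont1).
    unfold e. rewrite !RInt_cas_cas. reflexivity. }
  rewrite (RInt_eq _ (fun x => y 1%Z * (g x * e 1%Z x) + y (-1)%Z * (g x * e (-1)%Z x) + y 2%Z * (g x * e 2%Z x)
      + y (-2)%Z * (g x * e (-2)%Z x) + y 3%Z * (g x * e 3%Z x) + y (-3)%Z * (g x * e (-3)%Z x))).
  (* Only one factor is expanded, which leaves six integrals, all given by [Hge]. *)
  2:{ intro x. rewrite Hg. transitivity (g x * g x); [Rring|]. unfold g at 2. Rring. }
  rewrite !RInt_Rplus, !RInt_Rmult_l, !Hge by (intro; cont1).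
  repeat (destruct Z.eq_dec; try lia). unfold y. Rfield.
Qed.

(** * The forcing term as a potential *)

Section Forcing.

Variables (nu : R) (beta gamma : nat -> R -> R).
Hypothesis hnu : 2 <= nu <= 2.1.
Hypothesis hbeta : forall k : nat, (1 <= k <= 3)%nat ->
  (forall t : R, continuous (beta k) t) /\ (forall t : R, -0.03 <= beta k t <= 0.03).
Hypothesis hgamma : forall k : nat, (1 <= k <= 3)%nat ->
  (forall t : R, continuous (gamma k) t) /\ (forall t : R, -0.03 <= gamma k t <= 0.03).

(** [fp] and [fq] are the coefficients of [- F / (2 nu)]. The constants [2/3] and [0.8] come from
    the primitives [2/3 cos (3 x)] of [- 2 sin (3 x)] and [0.8 sin (2 x)] of [1.6 cos (2 x)]. *)
Definition fp (k : nat) (t : R) : R :=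
  - / (2 * nu) * ((if Nat.eq_dec k 3 then 2 / 3 else 0) - / INR k * beta k t).

Definition fq (k : nat) (t : R) : R :=
  - / (2 * nu) * ((if Nat.eq_dec k 2 then 0.8 else 0) + / INR k * gamma k t).

Let INR_inv_bound k : (1 <= k <= 3)%nat -> 0 < / INR k <= 1.
Proof.
  intros Hk. assert (1 <= INR k) by (apply (le_INR 1); lia).
  split; [apply Rinv_0_lt_compat; lra|]. rewrite <- Rinv_1. apply Rinv_le_contravar; lra.
Qed.

Lemma fpq_good : good_coefs fp fq.
Proof.
  intros k Hk. destruct (hbeta k Hk) as [Cb Bb]. destruct (hgamma k Hk) as [Cc Bc].
  assert (I := INR_inv_bound k Hk).
  assert (Hn : 0 < / (2 * nu) <= / 4).
  { split; [apply Rinv_0_lt_compat; lra|apply Rinv_le_contravar; lra]. }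
  assert (B : forall a b, 0 <= a <= 1 -> -0.03 <= b <= 0.03 -> Rabs (- / (2 * nu) * (a + / INR k * b)) <= 1).
  { intros a b Ha Hb. rewrite Rabs_mult, Rabs_Ropp, (Rabs_pos_eq (/ (2 * nu))) by lra.
    assert (Rabs (a + / INR k * b) <= 2) by (apply Rabs_le; nra).
    assert (Q := Rabs_pos (a + / INR k * b)). nra. }
  repeat split.
  - intro t. unfold fp. cont1.
  - intro t. unfold fq. cont1.
  - intro t. unfold fp. replace (/ INR k * beta k t) with (- (/ INR k * - beta k t)) by ring.
    unfold Rminus. rewrite Ropp_involutive. apply B; [destruct Nat.eq_dec; lra|specialize (Bb t); lra].
  - intro t. unfold fq. apply B; [destruct Nat.eq_dec; lra|apply Bc].
Qed.

Lemma forcing_pot t x : forcing beta gamma t x = - 2 * nu * pot_x fp fq t x.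
Proof.
  unfold forcing.
  rewrite 2!sum_Sn_m by lia. rewrite sum_n_n. unfold pot_x, pot_term_x, fp, fq.
  change (@plus R_AbelianMonoid) with Rplus. change (@plus R_AbelianGroup) with Rplus.
  simpl Nat.eq_dec. cbv iota. simpl INR.
  replace (1 + 1 + 1) with 3 by ring. replace (1 + 1) with 2 by ring.
  unfold plus; simpl. replace 1.6 with (8 / 5) by lra. replace 0.8 with (4 / 5) by lra. field. lra.
Qed.

Definition Fprim (t x : R) : R := - 2 * nu * pot fp fq t x.

Lemma Fprim_sq t : RInt (fun x => Fprim t x ^ 2) 0 (2 * PI) <= 1.125 * PI.
Proof.
  assert (Hpi := PI_RGT_0).
  assert (C := proj1 (cont2_pot fp fq fpq_good)).
  rewrite (RInt_eq _ (fun x => (2 * nu) ^ 2 * pot fp fq t x ^ 2)) by (intro; unfold Fprim; Rring).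
  rewrite RInt_Rmult_l by (intro; apply continuous_pow, cont2_slice_x, C).
  rewrite RInt_pot_sq. unfold fp, fq. simpl Nat.eq_dec. cbv iota. simpl INR.
  replace (1 + 1 + 1) with 3 by ring. replace (1 + 1) with 2 by ring.
  destruct (hbeta 1%nat ltac:(lia)) as [_ b1]. destruct (hbeta 2%nat ltac:(lia)) as [_ b2]. destruct (hbeta 3%nat ltac:(lia)) as [_ b3].
  destruct (hgamma 1%nat ltac:(lia)) as [_ g1]. destruct (hgamma 2%nat ltac:(lia)) as [_ g2]. destruct (hgamma 3%nat ltac:(lia)) as [_ g3].
  specialize (b1 t). specialize (b2 t). specialize (b3 t). specialize (g1 t). specialize (g2 t). specialize (g3 t).
  set (x1 := beta 1%nat t) in *. set (x2 := beta 2%nat t) in *. set (x3 := beta 3%nat t) in *.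
  set (y1 := gamma 1%nat t) in *. set (y2 := gamma 2%nat t) in *. set (y3 := gamma 3%nat t) in *.
  clearbody x1 x2 x3 y1 y2 y3.
  (* At the extreme perturbations the sum is about [1.1242]; [0.8^2 + (2/3)^2] accounts for [1.0844]
     of it. *)
  assert (E : x1 ^ 2 + y1 ^ 2 + (x2 / 2) ^ 2 + (0.8 + y2 / 2) ^ 2 + (2 / 3 - x3 / 3) ^ 2 + (y3 / 3) ^ 2 <= 1.125) by nra.
  apply Rle_trans with (PI * (x1 ^ 2 + y1 ^ 2 + (x2 / 2) ^ 2 + (0.8 + y2 / 2) ^ 2 + (2 / 3 - x3 / 3) ^ 2 + (y3 / 3) ^ 2)).
  - apply Req_le. field. lra.
  - rewrite Rmult_comm. apply Rmult_le_compat_r; lra.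
Qed.

(** The worst case is [nu = 2]; with [PI^2 < 10.4976] the two terms are bounded by [0.1905] from
    below and [0.1846] from above. *)
Lemma decay_rate_pos : 1 / 200 <= decay_rate nu (1.125 * PI).
Proof.
  assert (H1 := PI_lt_324). assert (H2 := PI_RGT_0). assert (H3 := PI2_1).
  unfold decay_rate.
  assert (Hp : PI ^ 2 < 10.4976) by nra. assert (Hp' : 1 < PI ^ 2) by nra.
  assert (A : 0.1905 <= 2 * (nu - 1) / PI ^ 2).
  { apply Rmult_le_reg_r with (PI ^ 2); [lra|]. unfold Rdiv. rewrite Rmult_assoc, Rinv_l, Rmult_1_r by lra. nra. }
  assert (B : PI * (1.125 * PI) / (16 * nu ^ 2) <= 0.1846).
  { assert (Hn : 4 <= nu ^ 2) by nra.
    apply Rmult_le_reg_r with (16 * nu ^ 2); [lra|]. unfold Rdiv. rewrite Rmult_assoc, Rinv_l, Rmult_1_r by lra. nra. }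
  lra.
Qed.

End Forcing.

(** * Solving the Cauchy problem *)

Lemma Ck_shift n g a : Ck n g -> Ck n (fun x => g (x + a)).
Proof.
  revert g. induction n as [|n IH]; intros g H.
  - intro x. apply (continuous_comp (fun x => x + a) g); [cont1|apply H].
  - destruct H as [g' [Hd Hk]]. exists (fun x => g' (x + a)). split; [|apply IH, Hk].
    intro x. eapply is_derive_eq; [apply (is_derive_Rcomp g (fun x => x + a) x); [|apply Hd]|].
    + apply is_derive_Rplus; [apply (is_derive_id (K := R_AbsRing))|apply is_derive_Rconst].
    + change (@one R_AbsRing) with 1. ring.
Qed.

Lemma class_C_Ck n g : class_C n g -> Ck n g.
Proof.
  revert g. induction n as [|n IH]; intros g [H1 H2].
  - exact H2.
  - exists (Derive g). split.
    + intro x. apply Derive_correct. apply (H1 1%nat x). lia.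
    + apply IH. split.
      * intros k x Hk. assert (K := H1 (S k) x ltac:(lia)).
        destruct k as [|k]; [exact I|]. simpl in K |- *.
        apply ex_derive_ext with (2 := K). intro z.
        change (Derive (Derive_n g k) z) with (Derive_n g (S k) z).
        replace (S k) with (k + 1)%nat by lia. symmetry. apply (Derive_n_comp g k 1).
      * intro x. apply continuous_ext with (2 := H2 x). intro z.
        replace (S n) with (n + 1)%nat by lia. symmetry. apply (Derive_n_comp g n 1).
Qed.

Section Cauchy.

Variables (nu c : R) (p q : nat -> R -> R).
Hypothesis Hnu : 0 < nu.
Hypothesis Hpq : good_coefs p q.

Let f (t x : R) : R := - 2 * nu * pot_x p q t x.

Definition ch (t0 : R) (y : Z -> R -> R) : R -> R -> R :=
  cole_hopf nu c (phi c t0 y 0) (phi c t0 y 1).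

Lemma phi_frozen t0 y j t x : t <= t0 -> phi c t0 y j t x = phi c t0 y j t0 x.
Proof. intro H. unfold phi. rewrite !Rmax_right by lra. reflexivity. Qed.

Lemma phi_pos t0 y m : lin_sol (coupling c p q) nu t0 y -> 0 < m -> (forall x, m <= phi c t0 y 0 t0 x) ->
  forall t x, 0 < phi c t0 y 0 t x.
Proof.
  intros Hy Hm H0 t x. destruct (Rle_lt_dec t0 t) as [Ht|Ht].
  - eapply Rlt_le_trans; [|apply (phi_lower_bound nu c t0 p q y Hnu Hpq Hy m); [lra|exact H0|exact Ht]].
    apply Rmult_lt_0_compat; [exact Hm|apply exp_pos].
  - rewrite phi_frozen by lra. specialize (H0 x). lra.
Qed.

Lemma ch_burgers t0 y m : lin_sol (coupling c p q) nu t0 y -> 0 < m -> (forall x, m <= phi c t0 y 0 t0 x) ->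
  burgers nu t0 f (ch t0 y).
Proof.
  intros Hy Hm H0.
  apply (cole_hopf_burgers nu c t0 p q (phi c t0 y 0) (phi_t nu c t0 p q y) (phi c t0 y 1) (phi c t0 y 2)
    (phi_xt nu c t0 p q y) (phi c t0 y 3)).
  - apply phi_pos with m; assumption.
  - apply phi_regular; assumption.
  - apply phi_x_regular; assumption.
  - intros t x Ht. unfold phi_t. rewrite Rmax_left by lra. reflexivity.
  - intros t x Ht. unfold phi_xt. rewrite Rmax_left by lra. reflexivity.
Qed.

Lemma ch_mean t0 y m t : lin_sol (coupling c p q) nu t0 y -> 0 < m -> (forall x, m <= phi c t0 y 0 t0 x) ->
  RInt (ch t0 y t) 0 (2 * PI) = 2 * PI * c.
Proof.
  intros Hy Hm H0. destruct (phi_regular nu c t0 p q y Hpq Hy) as ((C0 & _ & C1 & _) & Hp & Hx & _).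
  apply cole_hopf_mean; auto. intro x. apply phi_pos with m; assumption.
Qed.

(** Inverse Cole-Hopf: the linear system starts from [h = exp (- W / (2 nu))], [W] being the
    primitive of [u0 - c]. *)
Lemma Cauchy_exists t0 (u0 : R -> R) : Ck 4 u0 -> (forall x, u0 (x + 2 * PI) = u0 x) ->
  RInt u0 0 (2 * PI) = 2 * PI * c ->
  exists u, burgers nu t0 f u /\ forall x, u t0 x = u0 x.
Proof.
  intros Hk Hp Hm. assert (Hpi := PI_RGT_0).
  assert (C0 : forall x, continuous u0 x) by (apply (Ck_continuous 4), Hk).
  assert (C1 : forall x, continuous (fun x => u0 x - c) x) by (intro; cont1).
  set (W := fun x => RInt (fun x => u0 x - c) 0 x).
  set (a := - / (2 * nu)).
  set (h := fun x => exp (a * W x)).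
  assert (DW : forall x, is_derive W x (u0 x - c)) by (intro; apply (is_derive_primitive (fun x => u0 x - c)), C1).
  assert (Dh : forall x, is_derive h x (a * (u0 x - c) * h x)).
  { intro x. apply (is_derive_Rcomp exp (fun x => a * W x)); [apply is_derive_Rscal, DW|apply is_derive_Rexp]. }
  assert (Ch : forall x, continuous h x) by (intro; eapply is_derive_continuous, Dh).
  (* The condition on the mean of [u0] is what makes the primitive periodic. *)
  assert (Wp : forall x, W (x + 2 * PI) = W x).
  { intro x.
    assert (D : forall s, is_derive (fun x => W (x + 2 * PI) - W x) s 0).
    { intro s. eapply is_derive_eq.
      - apply (is_derive_Rminus (fun x => W (x + 2 * PI)) W); [|apply DW].
        apply (is_derive_Rcomp W (fun x => x + 2 * PI)); [|apply DW].
        apply is_derive_Rplus; [apply (is_derive_id (K := R_AbsRing))|apply is_derive_Rconst].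
      - change (@one R_AbsRing) with 1. cbv beta. rewrite Hp. ring. }
    assert (E : RInt (fun _ => 0) 0 x = (W (x + 2 * PI) - W x) - (W (0 + 2 * PI) - W 0)).
    { apply (RInt_FTC (fun x => W (x + 2 * PI) - W x)); [exact D|intro; apply continuous_const]. }
    rewrite RInt_constR, Rmult_0_r, Rplus_0_l in E.
    assert (E1 : W (2 * PI) = 0).
    { unfold W. rewrite RInt_Rminus; [|exact C0|intro; apply continuous_const]. rewrite Hm, RInt_constR. Rring. }
    assert (E2 : W 0 = 0) by (unfold W; rewrite RInt_point; reflexivity).
    lra. }
  assert (hp : forall x, h (x + 2 * PI) = h x) by (intro; unfold h; rewrite Wp; reflexivity).
  (* Bootstrap on [h' = a (u0 - c) h]: each derivative of [h] uses one derivative less of [u0]. *)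
  assert (Kh : Ck 5 h).
  { assert (K : forall n, (n <= 5)%nat -> Ck n h).
    { induction n as [|n IH]; intro Hn; [exact Ch|].
      exists (fun x => a * (u0 x - c) * h x). split; [exact Dh|].
      apply Ck_mult; [|apply IH; lia]. apply Ck_mult; [apply Ck_const|].
      unfold Rminus. apply Ck_plus; [|apply Ck_const].
      clear - Hk Hn. assert (exists j, 4 = n + j)%nat as [j Hj] by (exists (4 - n)%nat; lia).
      rewrite Hj in Hk. clear Hj Hn. induction j as [|j IH]; [rewrite Nat.add_0_r in Hk; exact Hk|].
      apply IH, Ck_pred. rewrite Nat.add_succ_r in Hk. exact Hk. }
    apply K. lia. }
  (* The coefficients live in the moving variable [x - c t0]. *)
  set (g := fun x => h (x + c * t0)).
  assert (gp : forall x, g (x + 2 * PI) = g x).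
  { intro x. unfold g. rewrite <- (hp (x + c * t0)). f_equal. ring. }
  assert (Kg : Ck 5 g) by (apply Ck_shift, Kh).
  destruct (fcoef_decay 5 g Kg gp) as [A HA].
  destruct (lin_sol_exists (coupling c p q) nu t0 (fcoef g) (coupling_finite_range c p q Hpq) Hnu A HA) as [y [Hy Hy0]].
  assert (P0 : forall x, phi c t0 y 0 t0 x = h x).
  { intro x. unfold phi. rewrite Rmax_left by lra.
    change (diter 0 (fun k => y k t0)) with (fun k => y k t0).
    rewrite (synth_ext _ (fcoef g) _ Hy0).
    rewrite (Fourier_inversion g A).
    - unfold g. f_equal. ring.
    - apply (Ck_continuous 5), Kg.
    - exact gp.
    - apply (dom_weaken 5 _ A); [lia|lra|exact HA]. }
  assert (P1 : forall x, phi c t0 y 1 t0 x = a * (u0 x - c) * h x).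
  { intro x. assert (D := phi_derive_x nu c t0 p q y Hy 0 t0 x ltac:(lia)).
    apply is_derive_unique in D. rewrite (Derive_ext _ h) in D by exact P0.
    rewrite (is_derive_unique _ _ _ (Dh x)) in D. lra. }
  destruct (continuity_ab_min h 0 (2 * PI)) as [xm [Hmin _]].
  { lra. }
  { intros z _. apply continuity_pt_filterlim, Ch. }
  exists (ch t0 y). split.
  - apply ch_burgers with (h xm); [exact Hy|apply exp_pos|].
    intro x. rewrite P0. apply (periodic_forall h (fun z => h xm <= z) hp). exact Hmin.
  - intro x. unfold ch, cole_hopf. rewrite P0, P1. unfold a. field.
    split; [lra|apply Rgt_not_eq, exp_pos].
Qed.

End Cauchy.

(** * The pullback limit *)

Lemma Rabs_le_of_sq a b : 0 <= b -> a ^ 2 <= b ^ 2 -> Rabs a <= b.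
Proof. intros Hb H. apply Rabs_le. split; nra. Qed.

Lemma exp_Lipschitz a b L : Rabs a <= L -> Rabs b <= L -> Rabs (exp a - exp b) <= exp (L + 1) * Rabs (a - b).
Proof.
  intros Ha Hb. apply Rabs_le_between in Ha. apply Rabs_le_between in Hb.
  (* Enlarged by 1, since the mean value inequality is stated on an open interval. *)
  apply (bounded_derive_Lipschitz exp exp (- L - 1) (L + 1)); try lra.
  - intros; apply is_derive_Rexp.
  - intros t Ht. rewrite Rabs_pos_eq by (left; apply exp_pos). apply exp_le. lra.
Qed.

Section Pullback.

Variables (nu c Phi : R) (p q : nat -> R -> R).
Hypothesis Hnu : 1 <= nu.
Hypothesis Hpq : good_coefs p q.

Let l := coupling c p q.
Let Hl : finite_range l := coupling_finite_range c p q Hpq.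
Let f (t x : R) : R := - 2 * nu * pot_x p q t x.
Let F (t x : R) : R := - 2 * nu * pot p q t x.
Hypothesis HPhi : forall t, RInt (fun x => F t x ^ 2) 0 (2 * PI) <= Phi.
Hypothesis Hrate : 0 < decay_rate nu Phi.

Lemma cont2_forcing : cont2 f /\ cont2 F.
Proof. destruct (cont2_pot p q Hpq) as [A B]. split; unfold f, F; cont2_tac. Qed.

Lemma F_derive t x : is_derive (F t) x (f t x).
Proof. unfold F, f. apply (is_derive_Rscal (-2 * nu) (pot p q t)), is_derive_pot. Qed.

Lemma F_period t x : F t (x + 2 * PI) = F t x.
Proof.
  unfold F, pot, pot_term.
  assert (C : forall j, cos (INR j * (x + 2 * PI)) = cos (INR j * x)).
  { intro j. replace (INR j * (x + 2 * PI)) with (INR j * x + 2 * INR j * PI) by ring. apply cos_period. }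
  assert (S : forall j, sin (INR j * (x + 2 * PI)) = sin (INR j * x)).
  { intro j. replace (INR j * (x + 2 * PI)) with (INR j * x + 2 * INR j * PI) by ring. apply sin_period. }
  rewrite !C, !S. reflexivity.
Qed.

(** [u] determines [phi] only up to a positive factor; fixing the value at [x = 0] makes the
    potentials of different solutions comparable. *)
Definition normalised (s : R) (z : Z -> R -> R) : Prop :=
  lin_sol l nu s z /\ (forall x, 0 < phi c s z 0 s x) /\ phi c s z 0 s 0 = 1.

(** Inverse of Cole-Hopf; the normalisation fixes the constant of integration. *)
Lemma normalised_log s z : normalised s z -> forall x,
  ln (phi c s z 0 s x) = - / (2 * nu) * RInt (fun x => ch nu c s z s x - c) 0 x.
Proof.
  intros (Hz & Hpos & H1) x.
  destruct (phi_regular nu c s p q z Hpq Hz) as ((C0 & _ & C1 & _) & _ & Hx & _).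
  assert (Cr : forall x, continuous (fun x => phi c s z 1 s x / phi c s z 0 s x) x).
  { intro y. apply (continuous_mult (K := R_AbsRing) (phi c s z 1 s)); [apply cont2_slice_x, C1|].
    apply (continuous_comp (phi c s z 0 s) Rinv); [apply cont2_slice_x, C0|].
    apply continuous_Rinv. specialize (Hpos y). lra. }
  rewrite <- RInt_Rmult_l by (intro; unfold ch, cole_hopf; cont1).
  rewrite (RInt_eq _ (fun x => phi c s z 1 s x / phi c s z 0 s x)).
  - rewrite (RInt_FTC (fun x => ln (phi c s z 0 s x))); [rewrite H1, ln_1; Rring| |exact Cr].
    intro y. eapply is_derive_eq; [apply (is_derive_Rcomp ln (phi c s z 0 s)); [apply Hx|apply is_derive_ln, Hpos]|]. reflexivity.
  - intro y. unfold ch, cole_hopf. Rfield. split; [apply Rgt_not_eq, Hpos|lra].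
Qed.

(** Cauchy-Schwarz against 1; [8] is [2 PI] rounded up. *)
Lemma RInt_partial_sq (g : R -> R) x : (forall x, continuous g x) -> 0 <= x <= 2 * PI ->
  RInt g 0 x ^ 2 <= 8 * RInt (fun x => g x ^ 2) 0 (2 * PI).
Proof.
  intros Hg Hx. assert (Hpi := PI_4). assert (Hpi' := PI_RGT_0).
  assert (CS := Cauchy_Schwarz_RInt (fun _ => 1) g 0 x ltac:(lra) ltac:(intro; apply continuous_const) Hg).
  rewrite (RInt_eq (fun x => 1 * g x) g) in CS by (intro; Rring).
  rewrite (RInt_eq (fun x => 1 ^ 2) (fun _ => 1)) in CS by (intro; Rring). rewrite RInt_constR in CS.
  assert (C2 : forall x, continuous (fun x => g x ^ 2) x) by (intro; apply continuous_pow, Hg).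
  assert (Ch := RInt_Chasles_cont (fun x => g x ^ 2) 0 x (2 * PI) C2).
  assert (P1 : 0 <= RInt (fun x => g x ^ 2) 0 x) by (apply RInt_nonneg; [lra|exact C2|intros; apply pow2_ge_0]).
  assert (P2 : 0 <= RInt (fun x => g x ^ 2) x (2 * PI)) by (apply RInt_nonneg; [lra|exact C2|intros; apply pow2_ge_0]).
  rewrite <- Ch. nra.
Qed.

(* Closeness of two solutions in L2 is closeness of their logarithmic potentials in the sup norm,
   which the heat semigroup upgrades to closeness of all Fourier coefficients with weight [k^6]. *)
Lemma smoothing_compare (E0 : R) : exists C m, 0 <= C /\ 0 < m /\
  forall s z1 z2 d, normalised s z1 -> normalised s z2 -> 0 <= d ->
    energy c (ch nu c s z1) s <= E0 -> energy c (ch nu c s z2) s <= E0 ->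
    dist2 (ch nu c s z1) (ch nu c s z2) s <= d ^ 2 ->
    dom 6 (C * d) (fun k => z1 k (s + 1) - z2 k (s + 1)) /\
    forall x, m <= phi c s z1 0 (s + 1) x.
Proof.
  assert (Hpi := PI_RGT_0).
  (* Bound for [|ln phi|], whose square is at most [8 E0 <= (1 + 8 E0)^2]. *)
  set (L := 1 + 8 * E0).
  (* Cost of one application of [lin_sol_smoothing] within a third of the unit time; three of them
     lead from weight 0 to weight 6. *)
  set (G := fun m : nat => 1 + 4 * (/ (/ 3) + INR (length l) * 4 ^ m) / nu).
  set (N1 := 2 * (exp (L + 1) * 3) * exp (INR (length l))).
  exists (N1 * G 0%nat * G 2%nat * G 4%nat), (exp (- L) * exp (- 6)).
  assert (HG : forall m, 0 <= G m).
  { intro m. unfold G. assert (0 <= 4 * (/ / 3 + INR (length l) * 4 ^ m) / nu); [|lra].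
    apply Rmult_le_pos; [|left; apply Rinv_0_lt_compat; lra].
    assert (0 <= INR (length l) * 4 ^ m) by (apply Rmult_le_pos; [apply pos_INR|apply pow_le; lra]). lra. }
  assert (HN1 : 0 <= N1).
  { unfold N1. assert (A := exp_pos (L + 1)). assert (B := exp_pos (INR (length l))). apply Rmult_le_pos; nra. }
  split; [do 3 (apply Rmult_le_pos; [|apply HG]); exact HN1|]. split; [apply Rmult_lt_0_compat; apply exp_pos|].
  intros s z1 z2 d N_1 N_2 Hd He1 He2 Hdist.
  assert (Cch : forall z, normalised s z -> forall x, continuous (ch nu c s z s) x).
  { intros z (Hz & Hpos & _) x.
    destruct (phi_regular nu c s p q z Hpq Hz) as ((C0 & _ & C1 & _) & _).
    assert (continuous (fun x => phi c s z 1 s x / phi c s z 0 s x) x).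
    { apply (continuous_mult (K := R_AbsRing) (phi c s z 1 s)); [apply cont2_slice_x, C1|].
      apply (continuous_comp (phi c s z 0 s) Rinv); [apply cont2_slice_x, C0|].
      apply continuous_Rinv. specialize (Hpos x). lra. }
    unfold ch, cole_hopf. cont1. }
  assert (Hinv : 0 < / (2 * nu) <= 1 / 2).
  { split; [apply Rinv_0_lt_compat; lra|]. unfold Rdiv. rewrite Rmult_1_l. apply Rinv_le_contravar; lra. }
  assert (LB : forall z, normalised s z -> energy c (ch nu c s z) s <= E0 ->
    forall x, 0 <= x <= 2 * PI -> Rabs (ln (phi c s z 0 s x)) <= L).
  { intros z Hz He x Hx. rewrite (normalised_log s z Hz).
    assert (Cz := Cch z Hz).
    assert (K : RInt (fun x => ch nu c s z s x - c) 0 x ^ 2 <= 8 * energy c (ch nu c s z) s)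
      by (apply RInt_partial_sq; [intro; cont1|exact Hx]).
    set (w := RInt (fun x => ch nu c s z s x - c) 0 x) in *.
    assert (0 <= 8 * E0) by (assert (Q := pow2_ge_0 w); lra).
    apply Rabs_le_of_sq; [unfold L; lra|].
    replace ((- / (2 * nu) * w) ^ 2) with ((/ (2 * nu)) ^ 2 * w ^ 2) by ring.
    assert (Q := pow2_ge_0 w). assert ((/ (2 * nu)) ^ 2 <= 1) by nra.
    unfold L. nra. }
  (* The factor [3] exceeds the square root of [8]. *)
  assert (LD : forall x, 0 <= x <= 2 * PI -> Rabs (ln (phi c s z1 0 s x) - ln (phi c s z2 0 s x)) <= 3 * d).
  { intros x Hx. rewrite (normalised_log s z1 N_1), (normalised_log s z2 N_2).
    assert (C1 := Cch z1 N_1). assert (C2 := Cch z2 N_2).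
    assert (K : RInt (fun x => ch nu c s z1 s x - ch nu c s z2 s x) 0 x ^ 2 <= 8 * dist2 (ch nu c s z1) (ch nu c s z2) s)
      by (apply (RInt_partial_sq (fun x => ch nu c s z1 s x - ch nu c s z2 s x)); [intro; cont1|exact Hx]).
    rewrite (RInt_eq (fun x => ch nu c s z1 s x - ch nu c s z2 s x) (fun x => (ch nu c s z1 s x - c) - (ch nu c s z2 s x - c))) in K by (intro; Rring).
    rewrite RInt_Rminus in K by (intro; cont1).
    set (w1 := RInt (fun x => ch nu c s z1 s x - c) 0 x) in *. set (w2 := RInt (fun x => ch nu c s z2 s x - c) 0 x) in *.
    apply Rabs_le_of_sq; [lra|].
    replace ((- / (2 * nu) * w1 - - / (2 * nu) * w2) ^ 2) with ((/ (2 * nu)) ^ 2 * (w1 - w2) ^ 2) by ring.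
    assert (Q := pow2_ge_0 (w1 - w2)). assert ((/ (2 * nu)) ^ 2 <= 1) by nra. nra. }
  assert (Pd : forall x, Rabs (phi c s z1 0 s x - phi c s z2 0 s x) <= exp (L + 1) * 3 * d).
  { apply (periodic_forall (fun x => phi c s z1 0 s x - phi c s z2 0 s x) (fun y => Rabs y <= exp (L + 1) * 3 * d)).
    - intro x. rewrite !phi_period. reflexivity.
    - intros x Hx.
      rewrite <- (exp_ln (phi c s z1 0 s x)) by apply N_1. rewrite <- (exp_ln (phi c s z2 0 s x)) by apply N_2.
      eapply Rle_trans; [apply (exp_Lipschitz _ _ L); apply LB; assumption|].
      rewrite Rmult_assoc. apply Rmult_le_compat_l; [left; apply exp_pos|]. apply LD, Hx. }
  destruct N_1 as (S1 & Pos1 & One1). destruct N_2 as (S2 & Pos2 & One2).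
  split.
  - set (D := fun k t => z1 k t - z2 k t).
    assert (SD : lin_sol l nu s D) by (apply lin_sol_minus; assumption).
    assert (D0 : forall k, Rabs (D k s) <= 2 * (exp (L + 1) * 3) * d).
    { intro k. destruct (proj2 (proj2 S1) s) as [A1 HA1]. destruct (proj2 (proj2 S2) s) as [A2 HA2].
      specialize (HA1 s (Rle_refl s)). specialize (HA2 s (Rle_refl s)).
      apply (dom_weaken 5 2 A1 A1) in HA1; [|lia|lra]. apply (dom_weaken 5 2 A2 A2) in HA2; [|lia|lra].
      assert (I := RInt_synth_cas (A1 + A2) (fun k => D k s) k (c * s) (dom_minus _ _ _ _ _ HA1 HA2)).
      assert (E : forall x, synth (fun k => D k s) (x - c * s) = phi c s z1 0 s x - phi c s z2 0 s x).
      { intro x. unfold phi. rewrite Rmax_left by lra. apply (synth_minus A1 A2 (fun k => z1 k s) (fun k => z2 k s)); assumption. }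
      rewrite (RInt_eq _ (fun x => (phi c s z1 0 s x - phi c s z2 0 s x) * cas (IZR k * (x - c * s)))) in I by (intro; rewrite E; reflexivity).
      assert (B : Rabs (RInt (fun x => (phi c s z1 0 s x - phi c s z2 0 s x) * cas (IZR k * (x - c * s))) 0 (2 * PI)) <= (2 * PI - 0) * (exp (L + 1) * 3 * d * 2)).
      { apply abs_RInt_le_const; [lra| |].
        - apply cont_ex_RInt. intro x.
          assert (Cp : forall z, lin_sol l nu s z -> continuous (phi c s z 0 s) x).
          { intros z Hz. apply cont2_slice_x. apply (phi_cont2 nu c s p q z Hz). lia. }
          assert (K1 := Cp z1 S1). assert (K2 := Cp z2 S2). assert (K3 := continuous_cas_lin (IZR k) (c * s) x).
          cont1.
        - intros t _. rewrite Rabs_mult. apply Rmult_le_compat; try apply Rabs_pos; [apply Pd|apply cas_bound]. }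
      rewrite I, Rabs_mult, (Rabs_pos_eq (2 * PI)) in B by lra.
      apply Rmult_le_reg_l with (2 * PI); [lra|]. nra. }
    assert (B0 : forall t, s <= t <= s + 1 -> dom 0 (N1 * d) (fun k => D k t)).
    { intros t Ht. apply dom_0_iff. intro k.
      eapply Rle_trans; [apply (lin_sol_sup_bound l nu s D _ t k Hl ltac:(lra) SD D0 ltac:(lra))|].
      unfold N1.
      assert (exp (INR (length l) * (t - s)) <= exp (INR (length l))).
      { apply exp_le. assert (Q := pos_INR (length l)). nra. }
      assert (0 <= 2 * (exp (L + 1) * 3) * d) by (apply Rmult_le_pos; [assert (Q := exp_pos (L + 1)); lra|exact Hd]).
      replace (2 * (exp (L + 1) * 3) * exp (INR (length l)) * d) with (2 * (exp (L + 1) * 3) * d * exp (INR (length l))) by ring.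
      apply Rmult_le_compat_l; assumption. }
    assert (B2 := lin_sol_smoothing l nu s D 0 (N1 * d) s (s + 1) (/ 3) Hl ltac:(lra) SD ltac:(lra) ltac:(lra) B0).
    assert (B4 := lin_sol_smoothing l nu s D 2 _ (s + / 3) (s + 1) (/ 3) Hl ltac:(lra) SD ltac:(lra) ltac:(lra) B2).
    assert (B6 := lin_sol_smoothing l nu s D 4 _ (s + / 3 + / 3) (s + 1) (/ 3) Hl ltac:(lra) SD ltac:(lra) ltac:(lra) B4).
    specialize (B6 (s + 1) ltac:(lra)).
    eapply (dom_weaken 6 6); [lia| |exact B6].
    fold (G 0%nat) (G 2%nat) (G 4%nat). apply Req_le. ring.
  - intro x.
    eapply Rle_trans; [|apply (phi_lower_bound nu c s p q z1 ltac:(lra) Hpq S1 (exp (- L))); [left; apply exp_pos| |lra]].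
    + apply Req_le. do 2 f_equal. ring.
    + apply (periodic_forall (phi c s z1 0 s) (fun y => exp (- L) <= y)); [intro; apply phi_period|].
      intros y Hy. rewrite <- (exp_ln (phi c s z1 0 s y)) by apply Pos1.
      apply exp_le. assert (K := LB z1 (conj S1 (conj Pos1 One1)) He1 y Hy). apply Rabs_le_between in K. lra.
Qed.

Definition kappa : R := decay_rate nu Phi.
(** The energy bound for a start from the constant [c], where the energy vanishes; it does not
    depend on the starting time. *)
Definition E0 : R := PI ^ 2 * Phi / nu ^ 2.

(** The potential [phi = 1] at [t0] represents the constant datum [c]. *)
Lemma unit_solution t0 : exists y, lin_sol l nu t0 y /\
  (forall x, phi c t0 y 0 t0 x = 1) /\ (forall x, phi c t0 y 1 t0 x = 0).
Proof.
  set (g := fun k : Z => if Z.eq_dec k 0 then 1 else 0).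
  assert (Hg : dom 5 1 g).
  { intro k. unfold g. destruct Z.eq_dec as [->|].
    - rewrite wt_0, pow1, Rabs_R1. lra.
    - rewrite Rabs_R0. lra. }
  destruct (lin_sol_exists l nu t0 g Hl ltac:(lra) 1 Hg) as [y [Hy Hy0]].
  exists y. split; [exact Hy|].
  assert (P0 : forall x, phi c t0 y 0 t0 x = 1).
  { intro x. unfold phi. rewrite Rmax_left by lra. change (diter 0 (fun k => y k t0)) with (fun k => y k t0).
    rewrite (synth_ext _ g _ Hy0). unfold synth.
    rewrite <- (zsum_delta 1 0). apply zsum_ext. intro k. unfold g. destruct Z.eq_dec as [->|]; [|ring].
    rewrite Rmult_0_l. unfold cas. rewrite cos_0, sin_0. ring. }
  split; [exact P0|]. intro x.
  assert (D := phi_derive_x nu c t0 p q y Hy 0 t0 x ltac:(lia)).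
  apply is_derive_unique in D. rewrite (Derive_ext _ (fun _ => 1)) in D by exact P0. rewrite Derive_const in D. lra.
Qed.

Definition ystart (n : nat) : Z -> R -> R :=
  proj1_sig (constructive_indefinite_description _ (unit_solution (- INR n))).

(* The solution starting from the constant [c] at time [- n]. *)
Definition U (n : nat) : R -> R -> R := ch nu c (- INR n) (ystart n).

Lemma ystart_spec n : lin_sol l nu (- INR n) (ystart n) /\
  (forall x, phi c (- INR n) (ystart n) 0 (- INR n) x = 1) /\ (forall x, phi c (- INR n) (ystart n) 1 (- INR n) x = 0).
Proof. unfold ystart. destruct constructive_indefinite_description as [y Hy]. exact Hy. Qed.

Lemma U_burgers n : burgers nu (- INR n) f (U n).
Proof.
  destruct (ystart_spec n) as (H1 & H2 & _).
  apply (ch_burgers nu c p q ltac:(lra) Hpq) with 1; [exact H1|lra|intro; rewrite H2; lra].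
Qed.

Lemma U_mean n t : RInt (U n t) 0 (2 * PI) = 2 * PI * c.
Proof.
  destruct (ystart_spec n) as (H1 & H2 & _).
  apply (ch_mean nu c p q ltac:(lra) Hpq) with 1; [exact H1|lra|intro; rewrite H2; lra].
Qed.

Lemma U_start n x : U n (- INR n) x = c.
Proof.
  destruct (ystart_spec n) as (_ & H2 & H3). unfold U, ch, cole_hopf. rewrite H2, H3. field.
Qed.

Lemma E0_nonneg : 0 <= E0.
Proof.
  assert (Hpi := PI_RGT_0). unfold E0. apply Rmult_le_pos; [|left; apply Rinv_0_lt_compat, pow_lt; lra].
  apply Rmult_le_pos; [apply pow2_ge_0|]. eapply Rle_trans; [|apply (HPhi 0)].
  apply RInt_nonneg; [lra| |intros; apply pow2_ge_0].
  intro x. apply (cont2_slice_x (fun t x => F t x ^ 2)). apply cont2_pow, cont2_forcing.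
Qed.

Lemma U_energy n t : - INR n <= t -> energy c (U n) t <= E0.
Proof.
  intro Ht. destruct cont2_forcing as [Cf CF].
  assert (B := energy_bound nu c Phi f F ltac:(lra) Cf CF F_derive F_period HPhi (- INR n) (U n) t (U_burgers n) (U_mean n _) Ht).
  replace (energy c (U n) (- INR n)) with 0 in B; [unfold E0; lra|].
  unfold energy, dist2. rewrite (RInt_eq _ (fun _ => 0)).
  - rewrite RInt_constR. Rring.
  - intro x. rewrite U_start. Rring.
Qed.

Lemma dist2_contraction t0 u v t K : burgers nu t0 f u -> burgers nu t0 f v ->
  RInt (u t0) 0 (2 * PI) = 2 * PI * c -> RInt (v t0) 0 (2 * PI) = 2 * PI * c -> t0 <= t ->
  energy c u t0 + energy c v t0 <= K ->
  dist2 u v t <= dist2 u v t0 * exp (PI / (32 * nu) * K) * exp (- kappa * (t - t0)).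
Proof.
  intros Hu Hv Mu Mv Ht HK. destruct cont2_forcing as [Cf CF].
  eapply Rle_trans; [apply (contraction nu c Phi f F ltac:(lra) Cf CF F_derive F_period HPhi t0 u v t); assumption|].
  apply Rmult_le_compat_r; [left; apply exp_pos|].
  apply Rmult_le_compat_l; [apply dist2_nonneg; eapply burgers_cont2; eassumption|].
  apply exp_le. apply Rmult_le_compat_l; [|exact HK].
  assert (Hpi := PI_RGT_0). apply Rmult_le_pos; [lra|left; apply Rinv_0_lt_compat; lra].
Qed.

(** The comparison starts at [- n]: there [U n] equals [c], so the initial distance is the energy of
    [U m], at most [E0] uniformly in [m]. *)
Lemma U_Cauchy s : exists K, 0 <= K /\ forall n m, (n <= m)%nat -> - INR n <= s ->
  dist2 (U n) (U m) s <= K * exp (- kappa * INR n).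
Proof.
  exists (E0 * exp (PI / (32 * nu) * (2 * E0)) * exp (- kappa * s)). split.
  - apply Rmult_le_pos; [apply Rmult_le_pos; [apply E0_nonneg|]|]; left; apply exp_pos.
  - intros n m Hnm Hs. assert (Hnm' := le_INR _ _ Hnm).
    eapply Rle_trans.
    + apply (dist2_contraction (- INR n) (U n) (U m) s (2 * E0) (U_burgers n)); try apply U_mean; try assumption.
      * apply (burgers_later nu (- INR m)); [lra|apply U_burgers].
      * assert (A := U_energy n (- INR n) ltac:(lra)). assert (B := U_energy m (- INR n) ltac:(lra)). lra.
    + replace (- kappa * (s - - INR n)) with (- kappa * s + - kappa * INR n) by ring. rewrite exp_plus, <- Rmult_assoc.
      apply Rmult_le_compat_r; [left; apply exp_pos|]. apply Rmult_le_compat_r; [left; apply exp_pos|].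
      apply Rmult_le_compat_r; [left; apply exp_pos|].
      apply Rle_trans with (energy c (U m) (- INR n)); [|apply U_energy; lra].
      apply Req_le. apply RInt_eq. intro x. rewrite U_start. Rring.
Qed.

Lemma diter_scal j a y k : diter j (fun k => a * y k) k = a * diter j y k.
Proof.
  revert k. induction j as [|j IH]; intro k; [reflexivity|]. rewrite !diter_S, IH. ring.
Qed.

(** The linear system and the Cole-Hopf map allow rescaling of [phi] by a positive constant. *)
Lemma U_normalised n s : - INR n <= s -> exists z, normalised s z /\
  forall t x, s <= t -> ch nu c s z t x = U n t x.
Proof.
  intro Hs. destruct (ystart_spec n) as (H1 & H2 & _).
  assert (Pos : forall t x, 0 < phi c (- INR n) (ystart n) 0 t x).
  { apply (phi_pos nu c p q ltac:(lra) Hpq) with 1; [exact H1|lra|intro; rewrite H2; lra]. }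
  set (a := / phi c (- INR n) (ystart n) 0 s 0).
  assert (Ha : 0 < a) by (apply Rinv_0_lt_compat, Pos).
  assert (E : forall j t x, s <= t -> phi c s (fun k t => a * ystart n k t) j t x = a * phi c (- INR n) (ystart n) j t x).
  { intros j t x Ht. unfold phi. rewrite !Rmax_left by lra. rewrite <- synth_scal. apply synth_ext. intro k. apply diter_scal. }
  exists (fun k t => a * ystart n k t). split; [split; [|split]|].
  - apply lin_sol_scal. apply (lin_sol_later l nu (- INR n)); assumption.
  - intro x. rewrite E by lra. apply Rmult_lt_0_compat; [exact Ha|apply Pos].
  - rewrite E by lra. unfold a. apply Rinv_l. apply Rgt_not_eq, Pos.
  - intros t x Ht. unfold U, ch, cole_hopf. rewrite !E by exact Ht. field.
    split; apply Rgt_not_eq; [apply Pos|exact Ha].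
Qed.

Lemma quotient_diff (a a' b b' m e B : R) : 0 < m -> m <= a -> m <= b -> Rabs (a - b) <= e -> Rabs (a' - b') <= e ->
  Rabs b' <= B -> Rabs (a' / a - b' / b) <= e * (/ m + B * / (m * m)).
Proof.
  intros Hm Ha Hb He He' HB.
  replace (a' / a - b' / b) with ((a' - b') * / a + b' * (- (a - b)) * / (a * b)) by (field; lra).
  eapply Rle_trans; [apply Rabs_triang|]. rewrite Rmult_plus_distr_l.
  assert (I1 : 0 < / a <= / m) by (split; [apply Rinv_0_lt_compat; lra|apply Rinv_le_contravar; lra]).
  assert (I2 : 0 < / (a * b) <= / (m * m)) by (split; [apply Rinv_0_lt_compat; nra|apply Rinv_le_contravar; nra]).
  assert (P1 := Rabs_pos (a' - b')). assert (P2 := Rabs_pos (a - b)). assert (P3 := Rabs_pos b').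
  apply Rplus_le_compat.
  - rewrite Rabs_mult, (Rabs_pos_eq (/ a)) by lra. apply Rmult_le_compat; lra.
  - rewrite !Rabs_mult, Rabs_Ropp, (Rabs_pos_eq (/ (a * b))) by lra.
    rewrite <- Rmult_assoc. apply Rmult_le_compat; [apply Rmult_le_pos; lra|lra| |lra].
    rewrite Rmult_comm. apply Rmult_le_compat; lra.
Qed.

Lemma fun_choice {A B : Type} (P : A -> B -> Prop) : (forall x, exists y, P x y) -> exists g, forall x, P x (g x).
Proof.
  intro H. exists (fun x => proj1_sig (constructive_indefinite_description _ (H x))).
  intro x. destruct constructive_indefinite_description as [y Hy]. exact Hy.
Qed.

(** Only the coefficients at the single time [s + 1] are passed to the limit; the linear system is
    then solved anew from their limit [Y], so no limit is taken in the equation. The unit delay is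
    the time needed for smoothing. *)
Lemma pullback s : exists v H n0, burgers nu (s + 1) f v /\
  (forall t, RInt (v t) 0 (2 * PI) = 2 * PI * c) /\
  forall n, (n0 <= n)%nat -> dist2 (U n) v (s + 1) <= H * exp (- kappa * INR n).
Proof.
  assert (Hpi := PI_RGT_0). assert (Zc := zconst_pos).
  destruct (INR_unbounded (- s)) as [n0 Hn0].
  destruct (U_Cauchy s) as [K [HK HU]].
  destruct (smoothing_compare E0) as (C & m & HC & Hm & HS).
  assert (Hi : forall i : nat, - INR (n0 + i) <= s) by (intro i; rewrite plus_INR; assert (Q := pos_INR i); lra).
  destruct (fun_choice (fun (i : nat) z => normalised s z /\ forall t x, s <= t -> ch nu c s z t x = U (n0 + i) t x)
    (fun i => U_normalised (n0 + i) s (Hi i))) as [z Hz].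
  (* The root appears because [dist2] is a squared distance. *)
  set (d := fun i => sqrt (K * exp (- kappa * INR (n0 + i)))).
  assert (Hd0 : forall i, 0 <= d i) by (intro; apply sqrt_pos).
  assert (Hd2 : forall i, d i ^ 2 = K * exp (- kappa * INR (n0 + i))).
  { intro i. apply pow2_sqrt. apply Rmult_le_pos; [exact HK|left; apply exp_pos]. }
  assert (Hen : forall i, energy c (ch nu c s (z i)) s <= E0).
  { intro i. eapply Rle_trans; [|apply (U_energy (n0 + i) s (Hi i))].
    apply Req_le, RInt_eq. intro x. rewrite (proj2 (Hz i)) by lra. reflexivity. }
  assert (Hcmp : forall i j, (i <= j)%nat -> dom 6 (C * d i) (fun k => z i k (s + 1) - z j k (s + 1)) /\
    forall x, m <= phi c s (z i) 0 (s + 1) x).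
  { intros i j Hij. apply HS; auto; try apply Hz.
    rewrite Hd2. eapply Rle_trans; [|apply (HU (n0 + i)%nat (n0 + j)%nat); [lia|apply Hi]].
    apply Req_le, RInt_eq. intro x. rewrite (proj2 (Hz i)), (proj2 (Hz j)) by lra. reflexivity. }
  (* [exp (- x) <= 1 / x] is enough: [kappa N] only has to exceed [(C + 1)^2 (K + 1) / eps^2], where
     the [+ 1] ensures positivity. *)
  assert (Hdlim : forall eps, 0 < eps -> exists N, C * d N < eps).
  { intros eps He.
    destruct (INR_unbounded (((C + 1) ^ 2 * (K + 1) / eps ^ 2) / kappa)) as [N HN].
    exists N.
    assert (Hk : 0 < kappa) by exact Hrate.
    assert (X : (C + 1) ^ 2 * (K + 1) / eps ^ 2 < kappa * INR (n0 + N)).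
    { rewrite plus_INR. assert (Q := pos_INR n0).
      apply (Rmult_lt_compat_l kappa) in HN; [|exact Hk].
      replace (kappa * ((C + 1) ^ 2 * (K + 1) / eps ^ 2 / kappa)) with ((C + 1) ^ 2 * (K + 1) / eps ^ 2) in HN by (field; lra). nra. }
    set (X0 := (C + 1) ^ 2 * (K + 1) / eps ^ 2) in *.
    assert (X0p : 0 < X0) by (apply Rdiv_lt_0_compat; [apply Rmult_lt_0_compat; [apply pow_lt; lra|lra]|apply pow_lt, He]).
    assert (Y : exp (- kappa * INR (n0 + N)) < / X0).
    { replace (- kappa * INR (n0 + N)) with (- (kappa * INR (n0 + N))) by ring.
      eapply Rle_lt_trans; [apply exp_neg_le_inv; lra|]. apply Rinv_lt_contravar; [apply Rmult_lt_0_compat; lra|exact X]. }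
    assert (Z2 : (C * d N) ^ 2 < eps ^ 2).
    { rewrite Rpow_mult_distr, Hd2. set (ex := exp (- kappa * INR (n0 + N))) in *.
      assert (exp_p : 0 < ex) by apply exp_pos.
      assert (Y2 : ex * X0 < 1).
      { apply (Rmult_lt_compat_r X0) in Y; [|exact X0p]. rewrite Rinv_l in Y by lra. exact Y. }
      assert (Y3 : (C + 1) ^ 2 * (K + 1) = X0 * eps ^ 2) by (unfold X0; field; lra).
      assert (Y4 : C ^ 2 * (K * ex) <= (C + 1) ^ 2 * (K + 1) * ex).
      { assert (C ^ 2 <= (C + 1) ^ 2) by nra. assert (0 <= C ^ 2) by apply pow2_ge_0.
        rewrite Rmult_assoc. apply Rmult_le_compat; try nra. }
      rewrite Y3 in Y4. assert (0 < eps ^ 2) by (apply pow_lt, He). nra. }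
    assert (0 <= C * d N) by (apply Rmult_le_pos; auto). nra. }
  assert (Hlim : forall k, exists y : R, is_lim_seq (fun i => z i k (s + 1)) y).
  { intro k. destruct (proj2 (ex_lim_seq_cauchy_corr (fun i => z i k (s + 1)))) as [y Hy]; [|exists y; exact Hy].
    intros eps. destruct (Hdlim (eps / 2) ltac:(assert (Q := cond_pos eps); lra)) as [N HN].
    exists N. intros i j Hin Hjn.
    assert (A1 := dom_abs _ _ _ k (proj1 (Hcmp N i Hin))). assert (A2 := dom_abs _ _ _ k (proj1 (Hcmp N j Hjn))).
    cbv beta in A1, A2.
    replace (z i k (s + 1) - z j k (s + 1)) with ((z N k (s + 1) - z j k (s + 1)) - (z N k (s + 1) - z i k (s + 1))) by ring.
    eapply Rle_lt_trans; [apply Rabs_triang|]. rewrite Rabs_Ropp. lra. }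
  destruct (fun_choice _ Hlim) as [Y HY].
  assert (HYd : forall i, dom 6 (C * d i) (fun k => z i k (s + 1) - Y k)).
  { intros i k. apply le_epsilon. intros eps He.
    assert (W := wt_pow_pos k 6).
    assert (L := HY k). apply is_lim_seq_spec in L.
    destruct (L (mkposreal (eps / wt k ^ 6) ltac:(apply Rdiv_lt_0_compat; lra))) as [N HN].
    change (forall n, (N <= n)%nat -> Rabs (z n k (s + 1) - Y k) < eps / wt k ^ 6) in HN.
    set (j := (N + i)%nat). specialize (HN j ltac:(unfold j; lia)).
    assert (A := proj1 (Hcmp i j ltac:(unfold j; lia)) k). cbv beta in A.
    replace (z i k (s + 1) - Y k) with ((z i k (s + 1) - z j k (s + 1)) + (z j k (s + 1) - Y k)) by ring.
    eapply Rle_trans; [apply Rmult_le_compat_r; [lra|apply Rabs_triang]|].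
    rewrite Rmult_plus_distr_r. apply Rplus_le_compat; [exact A|].
    apply Rle_trans with (eps / wt k ^ 6 * wt k ^ 6); [apply Rmult_le_compat_r; lra|apply Req_le; field; assert (Q := wt_ge_1 k); lra]. }
  (* [z 0] has weight five at time [s + 1] and differs from the limit by a sequence of weight
     six. *)
  assert (HYA : exists A, dom 5 A Y).
  { destruct (Hz 0%nat) as ((Hlin & _) & _). destruct (proj2 (proj2 Hlin) (s + 1)) as [A HA].
    exists (A + C * d 0%nat). intro k.
    assert (Q := dom_minus _ _ _ _ _ (HA (s + 1) (Rle_refl _)) (dom_weaken 6 5 _ _ _ ltac:(lia) (Rle_refl _) (HYd 0%nat)) k).
    cbv beta in Q. replace (z 0%nat k (s + 1) - (z 0%nat k (s + 1) - Y k)) with (Y k) in Q by ring. exact Q. }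
  destruct HYA as [A HA].
  destruct (lin_sol_exists l nu (s + 1) Y Hl ltac:(lra) A HA) as [y [Hy Hy0]].
  assert (HA4 := dom_dseq 4 A Y HA).
  assert (HA2 : dom 2 A Y) by (apply (dom_weaken 5 _ A); [lia|lra|exact HA]).
  assert (HA2' : dom 2 A (dseq Y)) by (apply (dom_weaken 4 _ A); [lia|lra|exact HA4]).
  assert (P0 : forall x, phi c (s + 1) y 0 (s + 1) x = synth Y (x - c * (s + 1))).
  { intro x. unfold phi. rewrite Rmax_left by lra. apply synth_ext. intro k. apply Hy0. }
  assert (P1 : forall x, phi c (s + 1) y 1 (s + 1) x = synth (dseq Y) (x - c * (s + 1))).
  { intro x. unfold phi. rewrite Rmax_left by lra. apply synth_ext. intro k. apply (diter_ext 1 _ Y k Hy0). }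
  assert (Hcl : forall i x, Rabs (phi c s (z i) 0 (s + 1) x - phi c (s + 1) y 0 (s + 1) x) <= C * d i * 2 * zconst /\
    Rabs (phi c s (z i) 1 (s + 1) x - phi c (s + 1) y 1 (s + 1) x) <= C * d i * 2 * zconst).
  { intros i x. rewrite P0, P1. unfold phi. rewrite Rmax_left by lra.
    destruct (Hz i) as ((Hlin & _) & _). destruct (proj2 (proj2 Hlin) (s + 1)) as [Ai HAi].
    specialize (HAi (s + 1) (Rle_refl _)).
    split.
    - change (diter 0 (fun k => z i k (s + 1))) with (fun k => z i k (s + 1)).
      rewrite <- (synth_minus Ai A (fun k => z i k (s + 1)) Y); [|apply (dom_weaken 5 _ Ai); [lia|lra|exact HAi]|exact HA2].
      apply synth_bound. apply (dom_weaken 6 _ (C * d i)); [lia|lra|apply HYd].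
    - change (diter 1 (fun k => z i k (s + 1))) with (dseq (fun k => z i k (s + 1))).
      rewrite <- (synth_minus Ai A (dseq (fun k => z i k (s + 1))) (dseq Y)); [|apply dom_dseq, (dom_weaken 5 _ Ai); [lia|lra|exact HAi]|exact HA2'].
      rewrite (synth_ext _ (dseq (fun k => z i k (s + 1) - Y k))) by (intro; unfold dseq; ring).
      apply synth_bound. apply dom_dseq, (dom_weaken 6 _ (C * d i)); [lia|lra|apply HYd]. }
  (* The lower bound is uniform along the sequence, hence positivity survives the limit and
     Cole-Hopf applies to it. *)
  assert (Psi : forall x, m <= phi c (s + 1) y 0 (s + 1) x).
  { intro x. apply le_epsilon. intros eps He.
    destruct (Hdlim (eps / (2 * zconst + 1))) as [N HN]; [apply Rdiv_lt_0_compat; lra|].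
    assert (Q1 := proj1 (Hcl N x)). assert (Q2 := proj2 (Hcmp N N (le_n N)) x). apply Rabs_le_between in Q1.
    assert (C * d N * 2 * zconst <= eps).
    { apply (Rmult_lt_compat_r (2 * zconst + 1)) in HN; [|lra].
      replace (eps / (2 * zconst + 1) * (2 * zconst + 1)) with eps in HN by (field; lra).
      assert (0 <= C * d N) by (apply Rmult_le_pos; auto). nra. }
    lra. }
  assert (Bv := ch_burgers nu c p q ltac:(lra) Hpq (s + 1) y m Hy Hm Psi).
  set (B := A * 2 * zconst).
  set (e := C * 2 * zconst). assert (He : 0 <= e) by (apply Rmult_le_pos; [apply Rmult_le_pos; lra|lra]).
  (* Lipschitz constant of [2 nu phi_x / phi], from [quotient_diff], with denominators at least [m]
     and the limit numerator at most [B]. *)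
  set (G := 2 * nu * (/ m + B * / (m * m))).
  exists (ch nu c (s + 1) y), (2 * PI * (e * G) ^ 2 * K), n0.
  split; [exact Bv|]. split; [intro t; apply (ch_mean nu c p q ltac:(lra) Hpq) with m; assumption|].
  intros n Hn. set (i := (n - n0)%nat). replace n with (n0 + i)%nat by (unfold i; lia).
  rewrite Rmult_assoc, <- Hd2.
  assert (Pt : forall x, (U (n0 + i) (s + 1) x - ch nu c (s + 1) y (s + 1) x) ^ 2 <= (e * d i * G) ^ 2).
  { intro x. rewrite <- (proj2 (Hz i)) by lra. unfold ch, cole_hopf.
    destruct (Hcl i x) as [Q1 Q2].
    assert (Q3 : Rabs (phi c (s + 1) y 1 (s + 1) x) <= B) by (rewrite P1; apply synth_bound, HA2').
    assert (Q := quotient_diff _ _ _ _ m _ B Hm (proj2 (Hcmp i i (le_n i)) x) (Psi x) Q1 Q2 Q3).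
    set (r1 := phi c s (z i) 1 (s + 1) x / phi c s (z i) 0 (s + 1) x) in *.
    set (r2 := phi c (s + 1) y 1 (s + 1) x / phi c (s + 1) y 0 (s + 1) x) in *.
    replace (c - 2 * nu * r1 - (c - 2 * nu * r2)) with (- (2 * nu) * (r1 - r2)) by ring.
    rewrite <- (pow2_abs (- (2 * nu) * (r1 - r2))). apply pow_incr. split; [apply Rabs_pos|].
    rewrite Rabs_mult, Rabs_Ropp, Rabs_pos_eq by lra.
    replace (e * d i * G) with (2 * nu * (C * d i * 2 * zconst * (/ m + B * / (m * m)))) by (unfold e, G; ring).
    apply Rmult_le_compat_l; [lra|exact Q]. }
  apply Rle_trans with (RInt (fun _ => (e * d i * G) ^ 2) 0 (2 * PI)).
  - assert (CU := burgers_cont2 _ _ _ _ (U_burgers (n0 + i))). assert (Cv := burgers_cont2 _ _ _ _ Bv).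
    apply RInt_mono; [lra| |intro; apply continuous_const|intros; apply Pt].
    intro x. apply (cont2_slice_x (fun t x => (U (n0 + i) t x - ch nu c (s + 1) y t x) ^ 2)). cont2_tac.
  - rewrite RInt_constR. apply Req_le. Rring.
Qed.

End Pullback.

(** * The attracting solution *)

(** The factors 2 are the price of working with squared distances. *)
Lemma dist2_triangle u v w t : cont2 u -> cont2 v -> cont2 w ->
  dist2 u w t <= 2 * dist2 v u t + 2 * dist2 v w t.
Proof.
  intros Cu Cv Cw. assert (Hpi := PI_RGT_0). unfold dist2.
  assert (C1 : forall x, continuous (fun x => (v t x - u t x) ^ 2) x) by (intro; apply (cont2_slice_x (fun t x => (v t x - u t x) ^ 2)); cont2_tac).
  assert (C2 : forall x, continuous (fun x => (v t x - w t x) ^ 2) x) by (intro; apply (cont2_slice_x (fun t x => (v t x - w t x) ^ 2)); cont2_tac).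
  rewrite <- !RInt_Rmult_l by assumption. rewrite <- RInt_Rplus by (intro; cont1).
  apply RInt_mono; [lra| |intro; cont1|].
  - intro; apply (cont2_slice_x (fun t x => (u t x - w t x) ^ 2)); cont2_tac.
  - intros x _. assert (Q := pow2_ge_0 ((v t x - u t x) + (v t x - w t x))). nra.
Qed.

Lemma dist2_zero u v t : cont2 u -> cont2 v ->
  (forall x, u t (x + 2 * PI) = u t x) -> (forall x, v t (x + 2 * PI) = v t x) ->
  dist2 u v t <= 0 -> forall x, u t x = v t x.
Proof.
  intros Cu Cv Pu Pv H x. assert (Hpi := PI_RGT_0). apply Rminus_diag_uniq.
  apply (periodic_forall (fun x => u t x - v t x) (fun y => y = 0)).
  - intro y. rewrite Pu, Pv. reflexivity.
  - intros y Hy.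
    assert (E : (u t y - v t y) ^ 2 = 0).
    { apply (RInt_zero_pointwise (fun x => (u t x - v t x) ^ 2) 0 (2 * PI)); [lra| |intros; apply pow2_ge_0|exact H|exact Hy].
      intro; apply (cont2_slice_x (fun t x => (u t x - v t x) ^ 2)); cont2_tac. }
    nra.
Qed.

Lemma exp_decay_eventually k H eps : 0 < k -> 0 < eps -> exists N, forall n, (N <= n)%nat -> H * exp (- k * INR n) <= eps.
Proof.
  intros Hk He.
  destruct (INR_unbounded (Rmax (H / eps) 0 / k)) as [N HN]. exists (S N). intros n Hn.
  assert (Hn' : INR N < INR n) by (apply lt_INR; lia).
  assert (E := exp_pos (- k * INR n)).
  destruct (Rle_lt_dec H 0) as [HH|HH]; [nra|].
  assert (B1 := Rmax_l (H / eps) 0).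
  assert (B : H / eps < k * INR n).
  { apply (Rmult_lt_compat_l k) in HN; [|exact Hk].
    replace (k * (Rmax (H / eps) 0 / k)) with (Rmax (H / eps) 0) in HN by (field; lra). nra. }
  assert (P : 0 < H / eps) by (apply Rdiv_lt_0_compat; lra).
  assert (E2 : exp (- k * INR n) <= / (H / eps)).
  { replace (- k * INR n) with (- (k * INR n)) by ring.
    eapply Rle_trans; [apply exp_neg_le_inv; lra|]. apply Rinv_le_contravar; lra. }
  apply Rle_trans with (H * / (H / eps)); [apply Rmult_le_compat_l; lra|].
  apply Req_le. field. lra.
Qed.

Lemma burgers_shift nu t0 f u T : burgers nu t0 f u -> (forall t x, f (t + T) x = f t x) ->
  burgers nu (t0 - T) f (fun t x => u (t + T) x).
Proof.
  intros (ut & ux & uxx & ((C1 & C2 & C3 & C4) & Hp & Hx & Hxx & Hd) & E) Hf.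
  assert (Sh : forall g, cont2 g -> cont2 (fun t x => g (t + T) x)).
  { intros g Hg. apply (cont2_reparam g (fun t _ => t + T) (fun _ x => x)); [exact Hg| |].
    - apply (cont2_fst (fun t => t + T)). intro; cont1.
    - apply (cont2_snd (fun x => x)). intro; apply continuous_id. }
  exists (fun t x => ut (t + T) x), (fun t x => ux (t + T) x), (fun t x => uxx (t + T) x).
  split; [split; [repeat split; auto|split; [|split; [|split]]]|]; auto.
  - intros t x Ht. eapply is_derive_eq.
    + apply (is_derive_Rcomp (fun s => u s x) (fun s => s + T)); [|apply Hd; lra].
      apply is_derive_Rplus; [apply (is_derive_id (K := R_AbsRing))|apply is_derive_Rconst].
    + change (@one R_AbsRing) with 1. ring.
  - intros t x Ht. rewrite <- Hf. apply E. lra.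
Qed.

Section Attractor.

Variables (nu c Phi : R) (p q : nat -> R -> R).
Hypothesis Hnu : 1 <= nu.
Hypothesis Hpq : good_coefs p q.
Let f (t x : R) : R := - 2 * nu * pot_x p q t x.
Hypothesis HPhi : forall t, RInt (fun x => (- 2 * nu * pot p q t x) ^ 2) 0 (2 * PI) <= Phi.
Hypothesis Hrate : 0 < decay_rate nu Phi.

Let k := decay_rate nu Phi.
Let UU := U nu c p q Hnu Hpq.
Let EE := E0 nu Phi.

(** [v t] is the pullback limit at time [t], with a rate. Such limits are unique and persist forward
    in time, which allows local solutions to be glued. *)
Definition attracted (v : R -> R -> R) (t : R) : Prop :=
  exists H n0, forall n, (n0 <= n)%nat -> dist2 (UU n) v t <= H * exp (- k * INR n).

Lemma UU_cont2 n : cont2 (UU n).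
Proof. eapply burgers_cont2. apply U_burgers. Qed.

Lemma attracted_later v t0 t : burgers nu t0 f v -> RInt (v t0) 0 (2 * PI) = 2 * PI * c ->
  t0 <= t -> attracted v t0 -> attracted v t.
Proof.
  intros Hv Mv Ht (H & n0 & A).
  destruct (INR_unbounded (- t0)) as [n1 Hn1].
  set (K := EE + energy c v t0).
  exists (H * (exp (PI / (32 * nu) * K) * exp (- k * (t - t0)))), (n0 + n1)%nat.
  intros n Hn. assert (Hn' : INR n1 <= INR n) by (apply le_INR; lia).
  eapply Rle_trans.
  - apply (dist2_contraction nu c Phi p q Hnu Hpq HPhi t0 (UU n) v t K); auto.
    + apply (burgers_later nu (- INR n)); [lra|apply U_burgers].
    + apply U_mean.
    + apply Rplus_le_compat_r. apply (U_energy nu c Phi p q Hnu Hpq HPhi). lra.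
  - specialize (A n ltac:(lia)). rewrite Rmult_assoc.
    replace (H * (exp (PI / (32 * nu) * K) * exp (- k * (t - t0))) * exp (- k * INR n))
      with (H * exp (- k * INR n) * (exp (PI / (32 * nu) * K) * exp (- k * (t - t0)))) by ring.
    apply Rmult_le_compat_r; [apply Rmult_le_pos; left; apply exp_pos|exact A].
Qed.

Lemma attracted_energy v t : cont2 v -> attracted v t -> energy c v t <= 2 * EE.
Proof.
  intros Cv (H & n0 & A). apply le_epsilon. intros eps He.
  destruct (exp_decay_eventually k H (eps / 2) Hrate ltac:(lra)) as [N HN].
  destruct (INR_unbounded (- t)) as [n1 Hn1].
  set (n := (n0 + N + n1)%nat). assert (Hn' : INR n1 <= INR n) by (apply le_INR; unfold n; lia).
  specialize (A n ltac:(unfold n; lia)). specialize (HN n ltac:(unfold n; lia)).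
  assert (B := U_energy nu c Phi p q Hnu Hpq HPhi n t ltac:(lra)). fold (UU n) EE in B.
  assert (T := dist2_triangle v (UU n) (fun _ _ => c) t Cv (UU_cont2 n) (cont2_const c)).
  fold (energy c v t) (energy c (UU n) t) in T. lra.
Qed.

Lemma attracted_unique v w t : cont2 v -> cont2 w -> attracted v t -> attracted w t -> dist2 v w t <= 0.
Proof.
  intros Cv Cw (H & n0 & A) (H' & n0' & A'). apply le_epsilon. intros eps He.
  destruct (exp_decay_eventually k H (eps / 4) Hrate ltac:(lra)) as [N HN].
  destruct (exp_decay_eventually k H' (eps / 4) Hrate ltac:(lra)) as [N' HN'].
  set (n := (n0 + N + n0' + N')%nat).
  specialize (A n ltac:(unfold n; lia)). specialize (HN n ltac:(unfold n; lia)).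
  specialize (A' n ltac:(unfold n; lia)). specialize (HN' n ltac:(unfold n; lia)).
  assert (T := dist2_triangle v (UU n) w t Cv (UU_cont2 n) Cw). lra.
Qed.

(** The global solution is not frozen before any time; the estimates reach it through solutions from
    [- j] on that coincide with it there. *)
Definition agrees_from (j : nat) (v w : R -> R -> R) : Prop :=
  burgers nu (- INR j) f w /\ (forall t, RInt (w t) 0 (2 * PI) = 2 * PI * c) /\
  (forall t, - INR j <= t -> energy c w t <= 2 * EE) /\
  (forall t x, - INR j <= t -> v t x = w t x).

Lemma global_exists : exists v, forall j, exists w, agrees_from j v w.
Proof.
  destruct (fun_choice (fun (j : nat) w => burgers nu (- INR j) f w /\
    (forall t, RInt (w t) 0 (2 * PI) = 2 * PI * c) /\ attracted w (- INR j))) as [vv Hvv].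
  (* One unit of time earlier, because [pullback] delivers a solution from [s + 1] on. *)
  { intro j. destruct (pullback nu c Phi p q Hnu Hpq HPhi Hrate (- INR j - 1)) as (v & H & n0 & A1 & A2 & A3).
    replace (- INR j - 1 + 1) with (- INR j) in * by ring.
    exists v. split; [exact A1|]. split; [exact A2|]. exists H, n0. exact A3. }
  assert (Att : forall j t, - INR j <= t -> attracted (vv j) t).
  { intros j t Ht. destruct (Hvv j) as (A1 & A2 & A3). apply (attracted_later _ (- INR j)); auto. }
  assert (C : forall j, cont2 (vv j)) by (intro j; eapply burgers_cont2, Hvv).
  (* Any index with [- J t <= t] serves: at time [t], all members of the family that have started
     are pullback limits, hence equal. *)
  set (J := fun t : R => Z.to_nat (up (- t))).
  assert (HJ : forall t, - INR (J t) <= t).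
  { intro t. unfold J. destruct (archimed (- t)) as [A _].
    destruct (Z_le_gt_dec 0 (up (- t))) as [P|P].
    - rewrite INR_IZR_INZ, Z2Nat.id by exact P. lra.
    - assert (IZR (up (- t)) <= 0) by (apply IZR_le; lia).
      assert (Q := pos_INR (Z.to_nat (up (- t)))). lra. }
  exists (fun t => vv (J t) t). intro j. exists (vv j).
  destruct (Hvv j) as (A1 & A2 & A3). split; [exact A1|]. split; [exact A2|]. split.
  - intros t Ht. apply attracted_energy; auto.
  - intros t x Ht.
    apply dist2_zero; auto.
    + intro; eapply burgers_period, Hvv.
    + intro; eapply burgers_period, Hvv.
    + apply attracted_unique; auto.
Qed.

(** The translate by [T] solves the same equation with the same energy bound; contraction from time
    [- j] bounds the distance at [t] by [M exp (- k j)] for every large [j], so it vanishes. *)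
Lemma global_periodic v T : (forall j, exists w, agrees_from j v w) -> 0 < T ->
  (forall t x, f (t + T) x = f t x) -> forall t x, v (t + T) x = v t x.
Proof.
  intros Hv HT Hf t.
  destruct (INR_unbounded (- t)) as [j0 Hj0].
  set (M := 8 * EE * 2 * exp (PI / (32 * nu) * (4 * EE)) * exp (- k * t)).
  assert (D : forall j, (j0 <= j)%nat -> exists w, agrees_from j v w /\
    dist2 (fun t x => w (t + T) x) w t <= M * exp (- k * INR j)).
  { intros j Hj. destruct (Hv j) as (w & W). exists w. split; [exact W|].
    destruct W as (W1 & W2 & W3 & W4).
    assert (Hj' := le_INR _ _ Hj).
    assert (Sw : burgers nu (- INR j) f (fun t x => w (t + T) x)).
    { apply (burgers_later nu (- INR j - T)); [lra|]. apply burgers_shift; assumption. }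
    assert (e1 := W3 (- INR j) ltac:(lra)). assert (e2 := W3 (- INR j + T) ltac:(lra)).
    assert (e2' : energy c (fun t x => w (t + T) x) (- INR j) <= 2 * EE) by exact e2.
    eapply Rle_trans.
    - apply (dist2_contraction nu c Phi p q Hnu Hpq HPhi (- INR j) (fun t x => w (t + T) x) w t (4 * EE)); auto; [lra|lra].
    - replace (- kappa nu Phi * (t - - INR j)) with (- k * t + - k * INR j) by (unfold kappa, k; ring).
      rewrite exp_plus, <- Rmult_assoc. apply Rmult_le_compat_r; [left; apply exp_pos|].
      unfold M. apply Rmult_le_compat_r; [left; apply exp_pos|]. apply Rmult_le_compat_r; [left; apply exp_pos|].
      assert (Cw := burgers_cont2 _ _ _ _ W1). assert (Cs := burgers_cont2 _ _ _ _ Sw).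
      assert (Tr := dist2_triangle (fun t x => w (t + T) x) (fun _ _ => c) w (- INR j) Cs (cont2_const c) Cw).
      assert (Sym : forall u, dist2 (fun _ _ => c) u (- INR j) = energy c u (- INR j)).
      { intro u. apply RInt_eq. intro; Rring. }
      rewrite !Sym in Tr. assert (P := E0_nonneg nu Phi p q Hnu Hpq HPhi). fold EE in P. lra. }
  assert (Z : forall x, v (t + T) x = v t x).
  { destruct (D j0 (le_n _)) as (w & (W1 & W2 & W3 & W4) & _).
    assert (Cw := burgers_cont2 _ _ _ _ W1). assert (Pw := burgers_period _ _ _ _ W1).
    assert (Cs : cont2 (fun t x => w (t + T) x)).
    { apply (burgers_cont2 nu (- INR j0 - T) f), burgers_shift; assumption. }
    intro x. rewrite !W4 by lra.
    apply (dist2_zero (fun t x => w (t + T) x) w t); auto.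
    apply le_epsilon. intros eps He.
    destruct (exp_decay_eventually k M eps Hrate He) as [N HN].
    destruct (D (j0 + N)%nat ltac:(lia)) as (w' & (W1' & W2' & W3' & W4') & D').
    rewrite Rplus_0_l. eapply Rle_trans; [|apply (HN (j0 + N)%nat); lia].
    eapply Rle_trans; [|exact D'].
    assert (Hle : INR j0 <= INR (j0 + N)) by (apply le_INR; lia).
    apply Req_le, RInt_eq. intro z. rewrite <- !W4, <- !W4' by lra. reflexivity. }
  exact Z.
Qed.

End Attractor.

(** * Classical solutions on a half line *)

Lemma filterdiff_within (I : R -> Prop) (g : R -> R) (t l : R) :
  I t -> is_derive g t l -> filterdiff g (within I (locally t)) (fun h => scal h l).
Proof.
  intros It [Hl Hd]. split; [exact Hl|].
  intros x Hx eps.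
  (* [filterdiff] quantifies over the limit points of the filter; as [I t] holds, [t] is the only
     one. *)
  assert (E : x = t).
  { apply NNPP. intro Hne. assert (P : 0 < Rabs (t - x) / 2) by (assert (0 < Rabs (t - x)) by (apply Rabs_pos_lt; lra); lra).
    assert (L : locally x (fun y => Rabs (y - x) < Rabs (t - x) / 2)) by (exists (mkposreal _ P); intros y Hy; exact Hy).
    specialize (Hx _ L). apply locally_singleton in Hx. specialize (Hx It). lra. }
  subst x. apply filter_le_within. apply Hd. intros P HP. exact HP.
Qed.

Lemma is_derive_of_within (I : R -> Prop) (g : R -> R) (t l : R) :
  locally t I -> filterdiff g (within I (locally t)) (fun h => scal h l) -> is_derive g t l.
Proof.
  intros It [Hl Hd]. split; [exact Hl|].
  intros x Hx eps.
  assert (L : within I (locally t) (fun y => norm (minus (minus (g y) (g x)) (scal (minus y x) l)) <= eps * norm (minus y x))).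
  { apply Hd. intros P HP. apply filter_le_within, Hx, HP. }
  generalize (filter_and _ _ It L). apply filter_imp. intros y [H1 H2]. apply H2, H1.
Qed.

(** The one-sided derivative at [t0] exists because [ut] is continuous up to [t0]. *)
Lemma regular_partial_derivatives t0 u ut ux uxx : regular t0 u ut ux uxx ->
  partial_derivatives (fun t => t0 <= t) u ut ux uxx.
Proof.
  intros ((C1 & C2 & C3 & C4) & Hp & Hx & Hxx & Hd) t x Ht.
  split; [|split; auto].
  (* [G] extends [u] across [t0] with the one-sided derivative. *)
  set (G := fun s => u t0 x + RInt (fun s => ut s x) t0 s).
  assert (Cut : forall s, continuous (fun s => ut s x) s) by (intro; apply cont2_slice_t, C2).
  assert (DG : forall s, is_derive G s (ut s x)).
  { intro s. eapply is_derive_eq; [apply (is_derive_Rplus (fun _ => u t0 x)); [apply is_derive_Rconst|apply is_derive_primitive, Cut]|]. ring. }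
  assert (EG : forall s, t0 <= s -> G s = u s x).
  { intros s Hs.
    assert (G0 : G t0 = u t0 x) by (unfold G; rewrite RInt_point; apply Rplus_0_r).
    assert (Cg : forall r, continuous G r) by (intro; eapply is_derive_continuous, DG).
    assert (Cu : forall r, continuous (fun s => u s x) r) by (intro; apply cont2_slice_t, C1).
    assert (A1 : G s - u s x <= G t0 - u t0 x).
    { apply (decreasing_of_derive_nonpos (fun s => G s - u s x) (fun s => ut s x - ut s x)); auto; [intro; cont1| |intros; lra].
      intros r Hr. apply is_derive_Rminus; [apply DG|apply Hd; lra]. }
    assert (A2 : u s x - G s <= u t0 x - G t0).
    { apply (decreasing_of_derive_nonpos (fun s => u s x - G s) (fun s => ut s x - ut s x)); auto; [intro; cont1| |intros; lra].
      intros r Hr. apply is_derive_Rminus; [apply Hd; lra|apply DG]. }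
    lra. }
  apply filterdiff_ext_loc with G.
  - unfold within. apply (filter_forall (F := locally t)). intros s Hs. apply EG, Hs.
  - intros z Hz. apply EG. apply Rnot_lt_le. intro Hlt.
    assert (L : locally z (fun y => y < t0)) by apply (open_lt t0 z Hlt).
    specialize (Hz _ L). apply locally_singleton in Hz. specialize (Hz Ht). lra.
  - apply filterdiff_within; [exact Ht|apply DG].
Qed.

Lemma cont2_jointly I g : cont2 g -> jointly_continuous I g.
Proof.
  intros Hg t x _ P HP. apply filter_le_within, (Hg (t, x) P HP).
Qed.

(** [Rmax t t0] maps the plane continuously into the time domain, so continuity relative to the half
    line is all that is needed. *)
Lemma jointly_cont2_clamp t0 g : jointly_continuous (fun t => t0 <= t) g -> cont2 (fun t x => g (Rmax t t0) x).
Proof.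
  intros Hg [t x].
  assert (Cm : continuous (fun q : R * R => (Rmax (fst q) t0, snd q)) (t, x)).
  { apply (continuous_comp_2 (fun q : R * R => Rmax (fst q) t0) snd (fun a b => (a, b)) (t, x)).
    - apply (continuous_comp fst (fun t => Rmax t t0)); [apply continuous_fst|apply continuous_Rmax_r].
    - apply continuous_snd.
    - apply continuous_ext with (fun q : R * R => q); [intros [a b]; reflexivity|apply continuous_id]. }
  apply (filterlim_comp _ _ _ (fun q : R * R => (Rmax (fst q) t0, snd q)) (fun q : R * R => g (fst q) (snd q))
    _ (within (fun q : R * R => t0 <= fst q) (locally (Rmax t t0, x)))).
  - intros P HP. unfold within in HP. specialize (Cm _ HP).
    change (locally (t, x) (fun q : R * R => t0 <= Rmax (fst q) t0 -> P (Rmax (fst q) t0, snd q))) in Cm.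
    change (locally (t, x) (fun q : R * R => P (Rmax (fst q) t0, snd q))).
    revert Cm. apply filter_imp. intros q Hq. apply Hq, Rmax_r.
  - apply Hg. simpl. apply Rmax_r.
Qed.

Lemma continuous_zero_extend (g : R -> R) t0 : (forall t, continuous g t) -> (forall t, t0 < t -> g t = 0) ->
  forall t, t0 <= t -> g t = 0.
Proof.
  intros Hc H0 t Ht. destruct (Rle_lt_or_eq_dec _ _ Ht) as [H|<-]; [auto|].
  apply NNPP. intro Hne.
  destruct (proj1 (filterlim_locally _ _) (Hc t0) (mkposreal (Rabs (g t0)) (Rabs_pos_lt _ Hne))) as [[d Hd] HH].
  assert (B : ball t0 d (t0 + d / 2)).
  { change (Rabs (t0 + d / 2 - t0) < d). rewrite Rplus_minus_l, Rabs_pos_eq; lra. }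
  specialize (HH _ B). change (Rabs (g (t0 + d / 2) - g t0) < Rabs (g t0)) in HH.
  rewrite H0 in HH by lra. rewrite Rminus_0_l, Rabs_Ropp in HH. lra.
Qed.

Lemma burgers_classical nu t0 f u : cont2 f -> burgers nu t0 f u ->
  classical_solution (fun t => t0 <= t) nu f u /\ C12 (fun t => t0 <= t) u.
Proof.
  intros Cf (ut & ux & uxx & Hr & E).
  assert (P := regular_partial_derivatives t0 u ut ux uxx Hr).
  destruct Hr as ((C1 & C2 & C3 & C4) & Hp & Hx & Hxx & Hd).
  split; exists ut, ux, uxx; (split; [exact P|]).
  - split; [|intros; symmetry; apply Hp].
    intros t x Ht. apply Rminus_diag_uniq.
    (* The equation at [t0] itself follows by continuity. *)
    apply (continuous_zero_extend (fun t => ut t x + u t x * ux t x - nu * uxx t x - f t x) t0).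
    + intro s. apply (cont2_slice_t (fun t x => ut t x + u t x * ux t x - nu * uxx t x - f t x)). cont2_tac.
    + intros s Hs. rewrite E by exact Hs. ring.
    + exact Ht.
  - repeat split; apply cont2_jointly; assumption.
Qed.

(** Brings an arbitrary competitor in the uniqueness claim within reach of the contraction
    estimate. *)
Lemma classical_burgers nu t0 f w :
  classical_solution (fun t => t0 <= t) nu f w -> C12 (fun t => t0 <= t) w ->
  burgers nu t0 f (fun t x => w (Rmax t t0) x).
Proof.
  intros (vt & vx & vxx & P & E & Hper) (ut & ux & uxx & Q & J1 & J2 & J3 & J4).
  assert (HM : forall t, t0 <= Rmax t t0) by (intro; apply Rmax_r).
  exists (fun t x => ut (Rmax t t0) x), (fun t x => ux (Rmax t t0) x), (fun t x => uxx (Rmax t t0) x).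
  assert (Int : forall t, t0 < t -> locally t (fun s => t0 <= s)).
  { intros t Ht. generalize (open_gt t0 t Ht). apply filter_imp. intros s Hs. apply Rlt_le, Hs. }
  split; [split; [repeat split|split; [|split; [|split]]]|].
  - apply jointly_cont2_clamp, J1.
  - apply jointly_cont2_clamp, J2.
  - apply jointly_cont2_clamp, J3.
  - apply jointly_cont2_clamp, J4.
  - intros t x. symmetry. apply Hper, HM.
  - intros t x. apply Q, HM.
  - intros t x. apply (Q (Rmax t t0) x), HM.
  - intros t x Ht. apply is_derive_ext_loc with (fun s => w s x).
    { generalize (open_gt t0 t Ht). apply filter_imp. intros s Hs. rewrite Rmax_left by (apply Rlt_le, Hs). reflexivity. }
    rewrite Rmax_left by lra. apply (is_derive_of_within (fun s => t0 <= s)); [apply Int, Ht|].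
    apply Q. lra.
  - intros t x Ht. rewrite Rmax_left by lra. rewrite <- (E t x) by lra.
    (* [classical_solution] and [C12] each bring their own derivatives; uniqueness of derivatives at
       interior times identifies them. *)
    assert (E1 : ut t x = vt t x).
    { rewrite <- (is_derive_unique (fun s => w s x) t (ut t x)); [rewrite <- (is_derive_unique (fun s => w s x) t (vt t x)); [reflexivity|]|];
        (apply (is_derive_of_within (fun s => t0 <= s)); [apply Int, Ht|]); [apply P|apply Q]; lra. }
    assert (E2 : forall z, ux t z = vx t z).
    { intro z. rewrite <- (is_derive_unique (w t) z (ux t z)); [rewrite <- (is_derive_unique (w t) z (vx t z)); [reflexivity|]|];
        [apply P|apply Q]; lra. }
    assert (E3 : uxx t x = vxx t x).
    { destruct (Q t x ltac:(lra)) as (_ & _ & D1). destruct (P t x ltac:(lra)) as (_ & _ & D2).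
      apply is_derive_unique in D1. apply is_derive_unique in D2. rewrite (Derive_ext _ _ x E2) in D1. lra. }
    rewrite E1, E2, E3. reflexivity.
Qed.

Lemma burgers_ext nu t0 f g u : (forall t x, f t x = g t x) -> burgers nu t0 f u -> burgers nu t0 g u.
Proof.
  intros H (ut & ux & uxx & R & E). exists ut, ux, uxx. split; [exact R|]. intros; rewrite <- H; auto.
Qed.

(** * Fourier coefficients *)

Lemma fourier_coeff_pair w k t : (forall x, continuous (w t) x) ->
  fourier_coeff w k t = (/ (2 * PI) * RInt (fun x => w t x * cos (- (IZR k * x))) 0 (2 * PI),
                         / (2 * PI) * RInt (fun x => w t x * sin (- (IZR k * x))) 0 (2 * PI)).
Proof.
  intro Hw.
  assert (Cc : forall x, continuous (fun x => cos (- (IZR k * x))) x).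
  { intro x. apply (ex_derive_continuous (V := R_NormedModule)). auto_derive. trivial. }
  assert (Cs : forall x, continuous (fun x => sin (- (IZR k * x))) x).
  { intro x. apply (ex_derive_continuous (V := R_NormedModule)). auto_derive. trivial. }
  unfold fourier_coeff.
  rewrite (@is_RInt_unique C_R_CompleteNormedModule _ 0 (2 * PI)
    (RInt (fun x => w t x * cos (- (IZR k * x))) 0 (2 * PI), RInt (fun x => w t x * sin (- (IZR k * x))) 0 (2 * PI))).
  - unfold RtoC, Cmult. simpl. f_equal; Rring.
  - apply (is_RInt_fct_extend_pair (U := R_NormedModule) (V := R_NormedModule)).
    + apply is_RInt_ext with (fun x => w t x * cos (- (IZR k * x))).
      * intros x _. unfold RtoC, cis, Cmult. simpl. Rring.
      * apply (RInt_correct (V := R_CompleteNormedModule)), cont_ex_RInt. intro; cont1.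
    + apply is_RInt_ext with (fun x => w t x * sin (- (IZR k * x))).
      * intros x _. unfold RtoC, cis, Cmult. simpl. Rring.
      * apply (RInt_correct (V := R_CompleteNormedModule)), cont_ex_RInt. intro; cont1.
Qed.

Lemma RInt_weighted_sq (w h : R -> R) : (forall x, continuous w x) -> (forall x, continuous h x) ->
  (forall x, -1 <= h x <= 1) ->
  (/ (2 * PI) * RInt (fun x => w x * h x) 0 (2 * PI)) ^ 2 <= RInt (fun x => w x ^ 2) 0 (2 * PI).
Proof.
  intros Cw Ch Hh. assert (Hpi := PI_RGT_0). assert (Hpi2 := PI2_1).
  assert (CS := Cauchy_Schwarz_RInt w h 0 (2 * PI) ltac:(lra) Cw Ch).
  assert (B : RInt (fun x => h x ^ 2) 0 (2 * PI) <= 2 * PI).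
  { apply Rle_trans with (RInt (fun _ => 1) 0 (2 * PI)).
    - apply RInt_mono; [lra|intro; apply continuous_pow, Ch|intro; apply continuous_const|].
      intros x _. specialize (Hh x). nra.
    - rewrite RInt_constR. lra. }
  assert (W0 : 0 <= RInt (fun x => w x ^ 2) 0 (2 * PI)) by (apply RInt_nonneg; [lra|intro; apply continuous_pow, Cw|intros; apply pow2_ge_0]).
  set (I := RInt (fun x => w x * h x) 0 (2 * PI)) in *. set (W := RInt (fun x => w x ^ 2) 0 (2 * PI)) in *.
  assert (I2 : I ^ 2 <= W * (2 * PI)) by (eapply Rle_trans; [exact CS|apply Rmult_le_compat_l; assumption]).
  rewrite Rpow_mult_distr.
  assert (P : 0 < / (2 * PI)) by (apply Rinv_0_lt_compat; lra).
  assert (P1 : / (2 * PI) <= 1) by (rewrite <- Rinv_1; apply Rinv_le_contravar; lra).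
  apply Rle_trans with ((/ (2 * PI)) ^ 2 * (W * (2 * PI))).
  - apply Rmult_le_compat_l; [apply pow2_ge_0|exact I2].
  - replace ((/ (2 * PI)) ^ 2 * (W * (2 * PI))) with (W * / (2 * PI)) by (field; lra). nra.
Qed.

(** Cauchy-Schwarz bounds the squares of the real and of the imaginary part by [dist2] each,
    uniformly in [k]. *)
Lemma fourier_coeff_dist u v k t : cont2 u -> cont2 v ->
  Cmod (fourier_coeff u k t - fourier_coeff v k t) <= sqrt (2 * dist2 u v t).
Proof.
  intros Cu Cv.
  assert (Su : forall x, continuous (u t) x) by (intro; apply cont2_slice_x, Cu).
  assert (Sv : forall x, continuous (v t) x) by (intro; apply cont2_slice_x, Cv).
  assert (Cc : forall x, continuous (fun x => cos (- (IZR k * x))) x).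
  { intro x. apply (ex_derive_continuous (V := R_NormedModule)). auto_derive. trivial. }
  assert (Cs : forall x, continuous (fun x => sin (- (IZR k * x))) x).
  { intro x. apply (ex_derive_continuous (V := R_NormedModule)). auto_derive. trivial. }
  rewrite !fourier_coeff_pair by assumption.
  assert (L : forall h : R -> R, (forall x, continuous h x) ->
    / (2 * PI) * RInt (fun x => u t x * h x) 0 (2 * PI) - / (2 * PI) * RInt (fun x => v t x * h x) 0 (2 * PI)
    = / (2 * PI) * RInt (fun x => (u t x - v t x) * h x) 0 (2 * PI)).
  { intros h Ch. rewrite (RInt_eq (fun x => (u t x - v t x) * h x) (fun x => u t x * h x - v t x * h x)) by (intro; Rring).
    rewrite RInt_Rminus by (intro; cont1). Rring. }
  unfold Cmod. apply sqrt_le_1_alt. unfold Cminus, Cplus, Copp. simpl fst. simpl snd.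
  change (?a + - ?b) with (a - b). rewrite !L by assumption.
  assert (A1 := RInt_weighted_sq (fun x => u t x - v t x) _ ltac:(intro; cont1) Cc (fun x => COS_bound _)).
  assert (A2 := RInt_weighted_sq (fun x => u t x - v t x) _ ltac:(intro; cont1) Cs (fun x => SIN_bound _)).
  cbv beta in A1, A2. unfold dist2. lra.
Qed.

(** Being a classical solution is local in time; the global derivatives are given by [Derive] and
    identified near each time with those of a local solution. *)
Lemma classical_of_local_solutions nu f v :
  (forall j : nat, exists w, burgers nu (- INR j) f w /\ forall t x, - INR j <= t -> v t x = w t x) ->
  classical_solution (fun _ => True) nu f v.
Proof.
  intro H.
  set (vt := fun t x => Derive (fun s => v s x) t).
  set (vx := fun t x => Derive (v t) x).
  set (vxx := fun t x => Derive (vx t) x).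
  assert (K : forall t x, (is_derive (fun s => v s x) t (vt t x) /\ is_derive (v t) x (vx t x) /\ is_derive (vx t) x (vxx t x)) /\
    vt t x + v t x * vx t x - nu * vxx t x = f t x /\ v t x = v t (x + 2 * PI)).
  (* A start strictly before [t] makes [t] an interior time. *)
  { intros t x. destruct (INR_unbounded (- t)) as [j Hj].
    destruct (H j) as (w & (wt & wx & wxx & (_ & Hp & Hx & Hxx & Hd) & E) & Hv).
    assert (D1 : is_derive (fun s => v s x) t (wt t x)).
    { apply is_derive_ext_loc with (fun s => w s x); [|apply Hd; lra].
      generalize (open_gt (- INR j) t ltac:(lra)). apply filter_imp. intros s Hs. symmetry. apply Hv. apply Rlt_le, Hs. }
    assert (D2 : forall z, is_derive (v t) z (wx t z)).
    { intro z. apply is_derive_ext with (w t); [intro; symmetry; apply Hv; lra|apply Hx]. }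
    assert (X : forall z, vx t z = wx t z) by (intro; apply is_derive_unique, D2).
    assert (D3 : is_derive (vx t) x (wxx t x)) by (apply is_derive_ext with (wx t); [intro; symmetry; apply X|apply Hxx]).
    assert (T : vt t x = wt t x) by apply is_derive_unique, D1.
    assert (XX : vxx t x = wxx t x) by apply is_derive_unique, D3.
    rewrite T, X, XX, !Hv by lra. split; [split; [exact D1|split; [apply D2|exact D3]]|]. split; [apply E; lra|symmetry; apply Hp]. }
  exists vt, vx, vxx. split; [|split].
  - intros t x _. destruct (K t x) as ((D1 & D2 & D3) & _). split; [|split]; auto.
    apply filterdiff_within; [exact I|exact D1].
  - intros t x _. apply K.
  - intros t x _. apply K.
Qed.

Theorem theorem1p1 (nu : R) (hnu : 2 <= nu <= 2.1)
    (beta gamma : nat -> R -> R)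
    (hbeta : forall k : nat, (1 <= k <= 3)%nat ->
       (forall t : R, continuous (beta k) t) /\
       (forall t : R, -0.03 <= beta k t <= 0.03))
    (hgamma : forall k : nat, (1 <= k <= 3)%nat ->
       (forall t : R, continuous (gamma k) t) /\
       (forall t : R, -0.03 <= gamma k t <= 0.03)) :
  exists v : R -> R -> R,
    classical_solution (fun _ : R => True) nu (forcing beta gamma) v /\
    attracts_exponentially nu (forcing beta gamma) v admissible_datum /\
    (time_periodic (forcing beta gamma) -> time_periodic v).
Proof.
  assert (Hpi := PI_RGT_0).
  set (f := forcing beta gamma). set (p := fp nu beta). set (q := fq nu gamma). set (Phi := 1.125 * PI).
  assert (Hf : forall t x, - 2 * nu * pot_x p q t x = f t x) by (intros; symmetry; apply forcing_pot, hnu).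
  assert (Hpq : good_coefs p q) by (apply fpq_good; assumption).
  assert (Hnu : 1 <= nu) by lra.
  assert (HPhi : forall t, RInt (fun x => (- 2 * nu * pot p q t x) ^ 2) 0 (2 * PI) <= Phi).
  { intro t. apply (Fprim_sq nu beta gamma hnu hbeta hgamma t). }
  set (k := decay_rate nu Phi).
  assert (Hrate : 0 < k) by (assert (Q := decay_rate_pos nu hnu); unfold k, Phi; lra).
  assert (Cf : cont2 f).
  { intro z. apply continuous_ext with (fun z => - 2 * nu * pot_x p q (fst z) (snd z)); [intros; apply Hf|].
    apply (proj1 (cont2_forcing nu p q Hpq)). }
  destruct (global_exists nu (1 / 2) Phi p q Hnu Hpq HPhi Hrate) as [v Hv].
  exists v. split; [|split].
  - apply classical_of_local_solutions. intro j. destruct (Hv j) as (w & W1 & _ & _ & W4).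
    exists w. split; [apply (burgers_ext nu _ _ f w Hf), W1|exact W4].
  (* Half of the rate of [dist2], which is a squared distance. *)
  - exists (k / 2). split; [lra|]. intros u0 (Hper & HC & Hmean) t0.
    assert (Mu0 : RInt u0 0 (2 * PI) = 2 * PI * (1 / 2)) by (rewrite Hmean; Rfield).
    destruct (Cauchy_exists nu (1 / 2) p q ltac:(lra) Hpq t0 u0 (class_C_Ck 4 u0 HC) Hper Mu0) as [u [Bu Iu]].
    assert (Mu : RInt (u t0) 0 (2 * PI) = 2 * PI * (1 / 2)) by (rewrite <- Mu0; apply RInt_eq, Iu).
    assert (Cu := burgers_cont2 _ _ _ _ Bu).
    exists u. split; [split|].
    + destruct (burgers_classical nu t0 f u Cf (burgers_ext nu t0 _ f u Hf Bu)) as [S1 S2].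
      split; [exact S1|split; [exact S2|exact Iu]].
    + intros w (S1 & S2 & Iw) t x Ht.
      assert (Bw : burgers nu t0 (fun t x => - 2 * nu * pot_x p q t x) (fun t x => w (Rmax t t0) x)).
      { apply (burgers_ext nu t0 f); [intros; symmetry; apply Hf|]. apply classical_burgers; assumption. }
      assert (Mw : RInt (w (Rmax t0 t0)) 0 (2 * PI) = 2 * PI * (1 / 2)).
      { rewrite <- Mu0. apply RInt_eq. intro z. rewrite Rmax_left by lra. apply Iw. }
      assert (Cw := burgers_cont2 _ _ _ _ Bw).
      assert (D := dist2_contraction nu (1 / 2) Phi p q Hnu Hpq HPhi t0 u _ t _ Bu Bw Mu Mw Ht (Rle_refl _)).
      assert (Z : dist2 u (fun t x => w (Rmax t t0) x) t0 = 0).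
      { unfold dist2. rewrite (RInt_eq _ (fun _ => 0)); [rewrite RInt_constR; Rring|].
        intro z. rewrite Rmax_left by lra. rewrite Iu, Iw. Rring. }
      rewrite Z, !Rmult_0_l in D.
      assert (R := dist2_zero u (fun t x => w (Rmax t t0) x) t Cu Cw (burgers_period _ _ _ _ Bu t) (burgers_period _ _ _ _ Bw t) D x).
      cbv beta in R. rewrite Rmax_left in R by lra. symmetry. exact R.
    (* Attraction: [u] is compared with a local solution that started before [t0] and coincides with
       [v] from there on. *)
    + destruct (INR_unbounded (- t0)) as [j Hj].
      destruct (Hv j) as (w & W1 & W2 & _ & W4).
      assert (Cw := burgers_cont2 _ _ _ _ W1).
      set (M := dist2 u w t0 * exp (PI / (32 * nu) * (energy (1 / 2) u t0 + energy (1 / 2) w t0))).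
      assert (HM : 0 <= M) by (apply Rmult_le_pos; [apply dist2_nonneg; assumption|left; apply exp_pos]).
      exists (sqrt (2 * M)). intros t Ht z.
      replace (fourier_coeff v z t) with (fourier_coeff w z t).
      2:{ unfold fourier_coeff. do 2 f_equal. apply functional_extensionality. intro x. rewrite W4 by lra. reflexivity. }
      eapply Rle_trans; [apply fourier_coeff_dist; assumption|].
      assert (D := dist2_contraction nu (1 / 2) Phi p q Hnu Hpq HPhi t0 u w t _ Bu
        (burgers_later nu (- INR j) t0 _ w ltac:(lra) W1) Mu (W2 t0) Ht (Rle_refl _)).
      fold M in D. unfold kappa in D. fold k in D.
      set (e := exp (- (k / 2) * (t - t0))).
      assert (E : exp (- k * (t - t0)) = e ^ 2).
      { unfold e. simpl. rewrite Rmult_1_r, <- exp_plus. f_equal. field. }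
      rewrite E in D.
      rewrite <- (sqrt_pow2 e) by (left; apply exp_pos).
      rewrite <- sqrt_mult_alt by lra. apply sqrt_le_1_alt. lra.
  - intros (T & HT & Hper). exists T. split; [exact HT|].
    apply (global_periodic nu (1 / 2) Phi p q Hnu Hpq HPhi Hrate v T Hv HT).
    intros t x. rewrite !Hf. apply Hper.
Qed.
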